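(* Let $(\mathcal E,T)$ be suitable. Then the forgetful functor $$(\mathcal E,T)\text{-}\mathbf{Multicat}\to\mathcal E'=(\mathcal E,T)\text{-}\mathbf{Graph}$$ has a left adjoint, the adjunction is monadic, and if $T'$ is the resulting monad on $\mathcal E'$ then $(\mathcal E',T')$ is suitable.
   Context: **Cartesian.** A category is *cartesian* if it has all finite limits. A monad $(T,\eta,\mu)$ on it is *cartesian* if $T$ preserves pullbacks and all naturality squares of $\eta$ and $\mu$ are pullbacks. **Suitable.** A *nested sequence* in $\mathcal E$ is a functor $\omega\to\mathcal E$ ($\omega$ = natural numbers with usual order) sending every morphism to a monic, i.e. $A_0\rightarrowtail A_1\rightarrowtail\cdots$. A category $\mathcal E$ is *suitable* if: (C1) it is cartesian; (C2) it has disjoint finite coproducts which are stable under pullback (disjoint: the coprojections are monic and for all $A,B$ the square with corners $0,A,B,A+B$ is a pullback); (C3) it has colimits of nested sequences, these commute with pullbacks, and their colimit coprojections are monic. A monad $(T,\eta,\mu)$ is *suitable* if: (M1) it is cartesian; (M2) $T$ preserves colimits of nested sequences. $(\mathcal E,T)$ is *suitable* if $T$ is a suitable monad on the suitable category $\mathcal E$. **Graphs and multicategories.** Let $\mathcal E$ and $T$ be cartesian. An *$(\mathcal E,T)$-graph* on $C_0\in\mathcal E$ is a diagram $TC_0\xleftarrow{d}C_1\xrightarrow{c}C_0$ in $\mathcal E$; a map of graphs $C\to\tilde C$ is a pair $f_0:C_0\to\tilde C_0$, $f_1:C_1\to\tilde C_1$ with $\tilde d f_1=T(f_0)d$ and $\tilde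 c f_1=f_0c$. These form $(\mathcal E,T)\text{-}\mathbf{Graph}$. Spans $TR\xleftarrow{d}M\xrightarrow{c}S$ and $TS\xleftarrow{q}N\xrightarrow{p}Q$ compose to $N\circ M$ = the pullback of $Tc:TM\to TS$ and $q:N\to TS$, with legs $N\circ M\to TM\xrightarrow{Td}T^2R\xrightarrow{\mu_R}TR$ and $N\circ M\to N\xrightarrow{p}Q$; the identity on $S$ is $TS\xleftarrow{\eta_S}S\xrightarrow{1}S$. These are the 1-cells of a bicategory with 0-cells the objects of $\mathcal E$ and 2-cells the maps of spans. An *$(\mathcal E,T)$-multicategory* is a monad in this bicategory: a graph $TC_0\leftarrow C_1\to C_0$ with maps of spans $\mathrm{ids}:C_0\to C_1$ and $\mathrm{comp}:C_1\circ C_1\to C_1$ satisfying associativity and unit laws. A map of multicategories is a map $f$ of underlying graphs with $f_1\,\mathrm{ids}=\widetilde{\mathrm{ids}}\,f_0$ and $f_1\,\mathrm{comp}=\widetilde{\mathrm{comp}}\,(f_1*f_1)$, where $f_1*f_1:C_1\circ C_1\to\tilde C_1\circ\tilde C_1$ is the induced map. These form $(\mathcal E,T)\text{-}\mathbf{Multicat}$. *)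

(* Defs.v *)
From Stdlib Require Import ssreflect List PeanoNat ProofIrrelevance IndefiniteDescription.

Set Implicit Arguments.
Unset Strict Implicit.
Unset Printing Implicit Defensive.

Record Category := {
  Obj :> Type;
  Hom : Obj -> Obj -> Type;
  idm : forall a, Hom a a;
  compose : forall a b c, Hom b c -> Hom a b -> Hom a c;
  compose_1m : forall a b (f : Hom a b), compose (idm b) f = f;
  compose_m1 : forall a b (f : Hom a b), compose f (idm a) = f;
  composeA : forall a b c d (h : Hom c d) (g : Hom b c) (f : Hom a b),
    compose h (compose g f) = compose (compose h g) f }.

Arguments Hom {_} _ _.
Arguments idm {_} _.
Arguments compose {_ _ _ _} _ _.

Declare Scope cat_scope.
Delimit Scope cat_scope with cat.
Open Scope cat_scope.

Notation "a ~> b" := (Hom a b) (at level 99, b at level 200) : cat_scope.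
Notation "g ∘ f" := (compose g f) (at level 40, left associativity) : cat_scope.

Record Functor (C D : Category) := {
  fobj :> Obj C -> Obj D;
  fmap : forall a b : C, (a ~> b) -> (fobj a ~> fobj b);
  fmap1 : forall a, fmap (idm a) = idm (fobj a);
  fmapM : forall (a b c : C) (g : b ~> c) (f : a ~> b),
    fmap (g ∘ f) = fmap g ∘ fmap f }.

Arguments fmap {C D} _ {a b} _.

Definition functor_id (C : Category) : Functor C C.
Proof. by exists (fun a => a) (fun _ _ f => f). Defined.

Definition functor_comp (C D E : Category) (G : Functor D E) (F : Functor C D) :
  Functor C E.
Proof.
exists (fun a => G (F a)) (fun _ _ f => fmap G (fmap F f)).
- abstract (by move=> a; rewrite !fmap1).
- abstract (by move=> *; rewrite !fmapM).
Defined.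

Record NatTrans (C D : Category) (F G : Functor C D) := {
  ntrans :> forall a : C, F a ~> G a;
  ntrans_natural : forall (a b : C) (f : a ~> b),
    ntrans b ∘ fmap F f = fmap G f ∘ ntrans a }.

Definition is_iso (C : Category) (a b : C) (f : a ~> b) : Prop :=
  exists g : b ~> a, g ∘ f = idm a /\ f ∘ g = idm b.

Definition nat_isomorphic (C D : Category) (F G : Functor C D) : Prop :=
  exists alpha : NatTrans F G, forall a, is_iso (alpha a).

Definition is_equivalence (C D : Category) (F : Functor C D) : Prop :=
  exists G : Functor D C,
    nat_isomorphic (functor_comp G F) (functor_id C) /\
    nat_isomorphic (functor_comp F G) (functor_id D).

Definition monic (C : Category) (a b : C) (m : a ~> b) : Prop :=
  forall (x : C) (f g : x ~> a), m ∘ f = m ∘ g -> f = g.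

Definition is_limit (J C : Category) (D : Functor J C)
    (L : C) (p : forall j, L ~> D j) : Prop :=
  (forall (i j : J) (u : i ~> j), fmap D u ∘ p i = p j) /\
  (forall (X : C) (q : forall j, X ~> D j),
     (forall (i j : J) (u : i ~> j), fmap D u ∘ q i = q j) ->
     exists! h : X ~> L, forall j, p j ∘ h = q j).

Definition is_colimit (J C : Category) (D : Functor J C)
    (L : C) (i : forall j, D j ~> L) : Prop :=
  (forall (j k : J) (u : j ~> k), i k ∘ fmap D u = i j) /\
  (forall (X : C) (q : forall j, D j ~> X),
     (forall (j k : J) (u : j ~> k), q k ∘ fmap D u = q j) ->
     exists! h : L ~> X, forall j, h ∘ i j = q j).

Definition is_finite (A : Type) : Prop := exists l : list A, forall x, In x l.

Definition finite_category (J : Category) : Prop :=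
  is_finite J /\ forall a b : J, is_finite (a ~> b).

Definition cartesian_category (C : Category) : Prop :=
  forall (J : Category) (D : Functor J C), finite_category J ->
    exists (L : C) (p : forall j, L ~> D j), is_limit p.

(** The square [f ∘ p = g ∘ q], with [p] and [q] issuing from its vertex. *)
Definition is_pullback (C : Category) (P A B S : C)
    (f : A ~> S) (g : B ~> S) (p : P ~> A) (q : P ~> B) : Prop :=
  f ∘ p = g ∘ q /\
  forall (X : C) (u : X ~> A) (v : X ~> B), f ∘ u = g ∘ v ->
    exists! h : X ~> P, p ∘ h = u /\ q ∘ h = v.

Definition is_initial (C : Category) (Z : C) : Prop :=
  forall X : C, exists! h : Z ~> X, True.

Definition is_coproduct (C : Category) (I : Type) (A : I -> C)
    (S : C) (i : forall k, A k ~> S) : Prop :=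
  forall (X : C) (q : forall k, A k ~> X),
    exists! h : S ~> X, forall k, h ∘ i k = q k.

Definition has_finite_coproducts (C : Category) : Prop :=
  forall (I : Type) (A : I -> C), is_finite I ->
    exists (S : C) (i : forall k, A k ~> S), is_coproduct i.

(** Binary coproducts are coproducts of families indexed by [bool]. *)
Definition coproducts_disjoint (C : Category) : Prop :=
  forall (A : bool -> C) (S : C) (i : forall b, A b ~> S), is_coproduct i ->
    (forall b, monic (i b)) /\
    (forall (Z : C) (u : Z ~> A true) (v : Z ~> A false),
       is_initial Z -> is_pullback (i true) (i false) u v).

Definition coproducts_stable (C : Category) : Prop :=
  forall (I : Type) (A : I -> C) (S : C) (i : forall k, A k ~> S),
    is_finite I -> is_coproduct i ->
    forall (X : C) (f : X ~> S)
      (P : I -> C) (p : forall k, P k ~> X) (q : forall k, P k ~> A k),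
      (forall k, is_pullback f (i k) (p k) (q k)) -> is_coproduct p.

Definition omega : Category.
Proof.
exists nat le Nat.le_refl (fun m n p (h : n <= p) (k : m <= n) => Nat.le_trans m n p k h).
all: abstract (by move=> *; exact: proof_irrelevance).
Defined.

Definition nested (C : Category) (A : Functor omega C) : Prop :=
  forall (m n : omega) (u : m ~> n), monic (fmap A u).

Definition has_nested_colimits (C : Category) : Prop :=
  forall A : Functor omega C, nested A ->
    exists (L : C) (i : forall n, A n ~> L), is_colimit i.

(** A levelwise pullback of nested sequences is again nested; its colimit is
    the pullback of the colimits.  The colimit [LP] of [P], the maps [f], [g],
    [p], [q] induced on the colimits are given by their defining properties. *)
Definition nested_colimits_commute_with_pullbacks (C : Category) : Prop :=
  forall (P A B S : Functor omega C)
    (phi : NatTrans A S) (psi : NatTrans B S)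
    (pi1 : NatTrans P A) (pi2 : NatTrans P B),
    nested A -> nested B -> nested S ->
    (forall n, is_pullback (phi n) (psi n) (pi1 n) (pi2 n)) ->
    forall (LP LA LB LS : C)
      (iP : forall n, P n ~> LP) (iA : forall n, A n ~> LA)
      (iB : forall n, B n ~> LB) (iS : forall n, S n ~> LS),
      is_colimit iP -> is_colimit iA -> is_colimit iB -> is_colimit iS ->
      forall (f : LA ~> LS) (g : LB ~> LS) (p : LP ~> LA) (q : LP ~> LB),
        (forall n, f ∘ iA n = iS n ∘ phi n) ->
        (forall n, g ∘ iB n = iS n ∘ psi n) ->
        (forall n, p ∘ iP n = iA n ∘ pi1 n) ->
        (forall n, q ∘ iP n = iB n ∘ pi2 n) ->
        is_pullback f g p q.

Definition nested_coprojections_monic (C : Category) : Prop :=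
  forall (A : Functor omega C) (L : C) (i : forall n, A n ~> L),
    nested A -> is_colimit i -> forall n, monic (i n).

Record suitable_category (C : Category) : Prop := {
  suitable_cartesian : cartesian_category C;
  suitable_coproducts : has_finite_coproducts C;
  suitable_disjoint : coproducts_disjoint C;
  suitable_stable : coproducts_stable C;
  suitable_nested : has_nested_colimits C;
  suitable_nested_pullback : nested_colimits_commute_with_pullbacks C;
  suitable_nested_monic : nested_coprojections_monic C }.

Record Monad (C : Category) := {
  mfun :> Functor C C;
  eta : forall a : C, a ~> mfun a;
  mu : forall a : C, mfun (mfun a) ~> mfun a;
  eta_natural : forall (a b : C) (f : a ~> b), eta b ∘ f = fmap mfun f ∘ eta a;
  mu_natural : forall (a b : C) (f : a ~> b),
    mu b ∘ fmap mfun (fmap mfun f) = fmap mfun f ∘ mu a;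
  mu_eta : forall a, mu a ∘ eta (mfun a) = idm (mfun a);
  mu_fmap_eta : forall a, mu a ∘ fmap mfun (eta a) = idm (mfun a);
  mu_mu : forall a, mu a ∘ mu (mfun a) = mu a ∘ fmap mfun (mu a) }.

Arguments eta {C} _ _.
Arguments mu {C} _ _.

Definition preserves_pullbacks (C D : Category) (F : Functor C D) : Prop :=
  forall (P A B S : C) (f : A ~> S) (g : B ~> S) (p : P ~> A) (q : P ~> B),
    is_pullback f g p q ->
    is_pullback (fmap F f) (fmap F g) (fmap F p) (fmap F q).

Definition preserves_nested_colimits (C D : Category) (F : Functor C D) : Prop :=
  forall (A : Functor omega C) (L : C) (i : forall n, A n ~> L),
    nested A -> is_colimit i ->
    is_colimit (D := functor_comp F A) (fun n => fmap F (i n)).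

Record cartesian_monad (C : Category) (T : Monad C) : Prop := {
  cartesian_functor : preserves_pullbacks T;
  cartesian_eta : forall (a b : C) (f : a ~> b),
    is_pullback (eta T b) (fmap T f) f (eta T a);
  cartesian_mu : forall (a b : C) (f : a ~> b),
    is_pullback (mu T b) (fmap T f) (fmap T (fmap T f)) (mu T a) }.

Record suitable_monad (C : Category) (T : Monad C) : Prop := {
  suitable_cartesian_monad : cartesian_monad T;
  suitable_monad_nested : preserves_nested_colimits T }.

Definition suitable (C : Category) (T : Monad C) : Prop :=
  suitable_category C /\ suitable_monad T.

Section Algebras.
Context {C : Category} (T : Monad C).

Record Algebra := {
  acarrier :> C;
  aact : T acarrier ~> acarrier;
  aact_eta : aact ∘ eta T acarrier = idm acarrier;
  aact_mu : aact ∘ mu T acarrier = aact ∘ fmap T aact }.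

Record AlgebraMap (X Y : Algebra) := {
  amap :> acarrier X ~> acarrier Y;
  amap_act : amap ∘ aact X = aact Y ∘ fmap T amap }.

Lemma AlgebraMap_eq (X Y : Algebra) (f g : AlgebraMap X Y) :
  amap f = amap g -> f = g.
Proof.
case: f g => [f ef] [g eg] /= fg; case: _ / fg in eg *.
by rewrite (proof_irrelevance _ ef eg).
Qed.

Definition algebra_cat : Category.
Proof.
unshelve refine {| Obj := Algebra; Hom := AlgebraMap;
  idm := fun X => {| amap := idm (acarrier X) |};
  compose := fun X Y Z g f => {| amap := amap g ∘ amap f |} |}.
- abstract (by rewrite compose_1m fmap1 compose_m1).
- abstract (by rewrite -composeA amap_act composeA amap_act -composeA fmapM).
- abstract (by move=> *; apply: AlgebraMap_eq; rewrite /= compose_1m).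
- abstract (by move=> *; apply: AlgebraMap_eq; rewrite /= compose_m1).
- abstract (by move=> *; apply: AlgebraMap_eq; rewrite /= composeA).
Defined.

End Algebras.

Record Adjunction (C D : Category) (F : Functor C D) (U : Functor D C) := {
  unit : forall c : C, c ~> U (F c);
  counit : forall d : D, F (U d) ~> d;
  unit_natural : forall (a b : C) (f : a ~> b),
    unit b ∘ f = fmap U (fmap F f) ∘ unit a;
  counit_natural : forall (a b : D) (f : a ~> b),
    counit b ∘ fmap F (fmap U f) = f ∘ counit a;
  counit_unit : forall c, counit (F c) ∘ fmap F (unit c) = idm (F c);
  unit_counit : forall d, fmap U (counit d) ∘ unit (U d) = idm (U d) }.

Arguments unit {C D F U} _ _.
Arguments counit {C D F U} _ _.

Section Monadicity.
Context {C D : Category} {F : Functor C D} {U : Functor D C} (adj : Adjunction F U).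

Definition adj_monad : Monad C.
Proof.
unshelve refine {| mfun := functor_comp U F; eta := unit adj;
  mu := fun a => fmap U (counit adj (F a)) |}.
- abstract (exact: unit_natural).
- abstract (by move=> a b f /=; rewrite -!fmapM counit_natural).
- abstract (by move=> a /=; rewrite unit_counit).
- abstract (by move=> a /=; rewrite -fmapM counit_unit fmap1).
- abstract (by move=> a /=; rewrite -!fmapM counit_natural).
Defined.

Definition comparison_obj (d : D) : Algebra adj_monad.
Proof.
unshelve refine (@Build_Algebra C adj_monad (U d) (fmap U (counit adj d)) _ _).
- abstract (exact: unit_counit).
- abstract (by rewrite /= -!fmapM counit_natural).
Defined.

Definition comparison_map (a b : D) (f : a ~> b) :
  AlgebraMap (comparison_obj a) (comparison_obj b).
Proof.
unshelve refine (@Build_AlgebraMap C adj_monad (comparison_obj a) (comparison_obj b) (fmap U f) _).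
by rewrite /= -!fmapM counit_natural.
Defined.

Definition comparison : Functor D (algebra_cat adj_monad).
Proof.
unshelve refine {| fobj := comparison_obj : D -> algebra_cat adj_monad;
  fmap := comparison_map |}.
- abstract (by move=> a; apply: AlgebraMap_eq; rewrite /= fmap1).
- abstract (by move=> *; apply: AlgebraMap_eq; rewrite /= fmapM).
Defined.

(** Up to equivalence, not isomorphism, of categories. *)
Definition monadic : Prop := is_equivalence comparison.

End Monadicity.

Record Pullback (C : Category) (A B S : C) (f : A ~> S) (g : B ~> S) := {
  pb :> C;
  pb1 : pb ~> A;
  pb2 : pb ~> B;
  pb_comm : f ∘ pb1 = g ∘ pb2;
  pb_pair : forall (X : C) (u : X ~> A) (v : X ~> B), f ∘ u = g ∘ v -> (X ~> pb);
  pb1_pair : forall (X : C) (u : X ~> A) (v : X ~> B) (e : f ∘ u = g ∘ v),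
    pb1 ∘ pb_pair e = u;
  pb2_pair : forall (X : C) (u : X ~> A) (v : X ~> B) (e : f ∘ u = g ∘ v),
    pb2 ∘ pb_pair e = v;
  pb_ext : forall (X : C) (h k : X ~> pb),
    pb1 ∘ h = pb1 ∘ k -> pb2 ∘ h = pb2 ∘ k -> h = k }.

Arguments pb_pair {C A B S f g} p {X} u v e.

Definition PullbackChoice (C : Category) :=
  forall (A B S : C) (f : A ~> S) (g : B ~> S), Pullback f g.

Lemma pb_is_pullback (C : Category) (A B S : C) (f : A ~> S) (g : B ~> S)
  (P : Pullback f g) : is_pullback f g (pb1 P) (pb2 P).
Proof.
split; first exact: pb_comm.
move=> X u v e; exists (pb_pair P u v e); split.
  by rewrite pb1_pair pb2_pair.
by move=> h [h1 h2]; apply: pb_ext; rewrite ?pb1_pair ?pb2_pair.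
Qed.

Lemma is_pullback_choice (C : Category) (P A B S : C) (f : A ~> S) (g : B ~> S)
  (p : P ~> A) (q : P ~> B) : is_pullback f g p q -> Pullback f g.
Proof.
case=> e univ.
have ex X (u : X ~> A) (v : X ~> B) (euv : f ∘ u = g ∘ v) :
    {h : X ~> P | p ∘ h = u /\ q ∘ h = v}.
  apply: constructive_indefinite_description.
  by case: (univ X u v euv) => h [hP _]; exists h.
unshelve refine {| pb := P; pb1 := p; pb2 := q; pb_comm := e;
  pb_pair := fun X u v euv => proj1_sig (ex X u v euv) |}.
- by move=> X u v euv; case: (ex X u v euv) => h [].
- by move=> X u v euv; case: (ex X u v euv) => h [].
- move=> X h k e1 e2.
  have ek : f ∘ (p ∘ k) = g ∘ (q ∘ k) by rewrite !composeA e.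
  case: (univ X _ _ ek) => l [_ uniql].
  by rewrite -(uniql h) // -(uniql k).
Qed.

Definition cospan_le (x y : option bool) : Prop :=
  match x, y with
  | _, None | Some true, Some true | Some false, Some false => True
  | _, _ => False
  end.

Lemma cospan_le_refl x : cospan_le x x.
Proof. by case: x => [[]|]. Qed.

Lemma cospan_le_trans x y z : cospan_le y z -> cospan_le x y -> cospan_le x z.
Proof. by case: x => [[]|]; case: y => [[]|]; case: z => [[]|]. Qed.

Definition cospan : Category.
Proof.
exists (option bool) cospan_le cospan_le_refl cospan_le_trans.
all: abstract (by move=> *; exact: proof_irrelevance).
Defined.

Lemma cospan_finite : finite_category cospan.
Proof.
split; first by exists (None :: Some true :: Some false :: nil : list (option bool)) => -[[]|] /=; tauto.
move=> [[]|] [[]|] /=;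
  by [exists (I :: nil) => -[]; left | exists nil].
Qed.

Definition cospan_functor (C : Category) (A B S : C) (f : A ~> S) (g : B ~> S) :
  Functor cospan C.
Proof.
unshelve refine {| fobj := fun x : cospan =>
  match x with None => S | Some true => A | Some false => B end |}.
- move=> [[]|] [[]|] u; [exact: idm | by case: u | exact: f | by case: u | exact: idm
    | exact: g | by case: u | by case: u | exact: idm].
- abstract (by move=> [[]|]).
- abstract (by move=> [[]|] [[]|] [[]|] //= *; rewrite ?compose_1m ?compose_m1).
Defined.

(** Choosing pullbacks is no restriction on a cartesian category. *)
Lemma cartesian_pullback_choice (C : Category) :
  cartesian_category C -> inhabited (PullbackChoice C).
Proof.
move=> cart; apply: inhabits => A B S f g.
have ex : exists P (p : P ~> A) (q : P ~> B), is_pullback f g p q.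
  have [P [p [nat univ]]] := cart _ (cospan_functor f g) cospan_finite.
  have ep : f ∘ p (Some true) = p None := nat (Some true) None I.
  have eq : g ∘ p (Some false) = p None := nat (Some false) None I.
  exists P, (p (Some true)), (p (Some false)); split; first by rewrite ep eq.
  move=> X u v e.
  pose r x : X ~> cospan_functor f g x :=
    match x with Some true => u | Some false => v | None => f ∘ u end.
  case: (univ X r) => [|h [hr uniq]].
    by move=> [[]|] [[]|] //= _; rewrite ?compose_1m.
  exists h; split; first by split; [exact: (hr (Some true)) | exact: (hr (Some false))].
  move=> k [k1 k2]; apply: uniq => -[[]|] //=.
  by rewrite -ep -composeA k1.
move/constructive_indefinite_description: ex => [P].
move/constructive_indefinite_description => [p].
move/constructive_indefinite_description => [q].
exact: is_pullback_choice.
Qed.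

Section Spans.
Context {E : Category} (T : Monad E) (P : PullbackChoice E).

Record Span (R S : E) := {
  apex :> E;
  dleg : apex ~> T R;
  cleg : apex ~> S }.

Record SpanMap (R S : E) (M N : Span R S) := {
  smap :> apex M ~> apex N;
  smap_d : dleg N ∘ smap = dleg M;
  smap_c : cleg N ∘ smap = cleg M }.

Definition span_idm (R S : E) (M : Span R S) : SpanMap M M :=
  {| smap := idm (apex M); smap_d := compose_m1 _; smap_c := compose_m1 _ |}.

Definition span_id (S : E) : Span S S :=
  {| apex := S; dleg := eta T S; cleg := idm S |}.

Definition span_pb (R S Q : E) (N : Span S Q) (M : Span R S) :
  Pullback (fmap T (cleg M)) (dleg N) := P (fmap T (cleg M)) (dleg N).

Definition span_comp (R S Q : E) (N : Span S Q) (M : Span R S) : Span R Q :=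
  {| apex := span_pb N M;
     dleg := mu T R ∘ fmap T (dleg M) ∘ pb1 (span_pb N M);
     cleg := cleg N ∘ pb2 (span_pb N M) |}.

Lemma span_comp_map_proof (R S Q R' S' Q' : E)
    (N : Span S Q) (M : Span R S) (N' : Span S' Q') (M' : Span R' S')
    (s : S ~> S') (n : apex N ~> apex N') (m : apex M ~> apex M') :
  dleg N' ∘ n = fmap T s ∘ dleg N -> cleg M' ∘ m = s ∘ cleg M ->
  fmap T (cleg M') ∘ (fmap T m ∘ pb1 (span_pb N M)) =
  dleg N' ∘ (n ∘ pb2 (span_pb N M)).
Proof.
by move=> en em; rewrite !composeA en -fmapM em fmapM -!composeA pb_comm.
Qed.

(** The map [n * m] induced on composites by maps [n] and [m] lying over the
    same [s] on the common foot. *)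
Definition span_comp_map (R S Q R' S' Q' : E)
    (N : Span S Q) (M : Span R S) (N' : Span S' Q') (M' : Span R' S')
    (s : S ~> S') (n : apex N ~> apex N') (m : apex M ~> apex M')
    (en : dleg N' ∘ n = fmap T s ∘ dleg N) (em : cleg M' ∘ m = s ∘ cleg M) :
  apex (span_comp N M) ~> apex (span_comp N' M') :=
  pb_pair (span_pb N' M') (fmap T m ∘ pb1 (span_pb N M)) (n ∘ pb2 (span_pb N M))
    (span_comp_map_proof en em).

Definition span_hcomp (R S Q : E) (N N' : Span S Q) (M M' : Span R S)
    (n : SpanMap N N') (m : SpanMap M M') :
  SpanMap (span_comp N M) (span_comp N' M').
Proof.
unshelve refine {| smap := span_comp_map (s := idm S) (n := n) (m := m) _ _ |}.
- abstract (by rewrite fmap1 compose_1m smap_d).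
- abstract (by rewrite compose_1m smap_c).
- abstract (by rewrite /= -!composeA pb1_pair (composeA (fmap T (dleg M'))) -fmapM smap_d).
- abstract (by rewrite /= -!composeA pb2_pair composeA smap_c).
Defined.

(** The coherence isomorphisms are taken in the direction in which they are
    given by the universal property of the target alone; no inverse is needed
    to state the monad laws. *)
Definition span_unitl (R S : E) (M : Span R S) :
  SpanMap M (span_comp (span_id S) M).
Proof.
unshelve refine (@Build_SpanMap _ _ M (span_comp (span_id S) M)
  (pb_pair (span_pb (span_id S) M) (eta T (apex M)) (cleg M) _) _ _).
- abstract (by rewrite /= eta_natural).
- abstract (by rewrite /= -!composeA pb1_pair -eta_natural composeA mu_eta compose_1m).
- abstract (by rewrite /= compose_1m pb2_pair).
Defined.

Definition span_unitr (R S : E) (M : Span R S) :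
  SpanMap M (span_comp M (span_id R)).
Proof.
unshelve refine (@Build_SpanMap _ _ M (span_comp M (span_id R))
  (pb_pair (span_pb M (span_id R)) (dleg M) (idm (apex M)) _) _ _).
- abstract (by rewrite /= fmap1 compose_1m compose_m1).
- abstract (by rewrite /= -!composeA pb1_pair composeA mu_fmap_eta compose_1m).
- abstract (by rewrite /= -!composeA pb2_pair compose_m1).
Defined.

Lemma span_assoc_proof (A B C D : E) (L : Span C D) (N : Span B C) (M : Span A B) :
  fmap T (cleg N) ∘ (fmap T (pb2 (span_pb N M)) ∘ pb1 (span_pb L (span_comp N M))) =
  dleg L ∘ pb2 (span_pb L (span_comp N M)).
Proof. by rewrite composeA -fmapM (pb_comm (span_pb L (span_comp N M))). Qed.

Definition span_assoc (A B C D : E) (L : Span C D) (N : Span B C) (M : Span A B) :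
  SpanMap (span_comp L (span_comp N M)) (span_comp (span_comp L N) M).
Proof.
unshelve refine (@Build_SpanMap _ _ (span_comp L (span_comp N M)) (span_comp (span_comp L N) M)
  (pb_pair (span_pb (span_comp L N) M)
  (mu T (apex M) ∘ fmap T (pb1 (span_pb N M)) ∘ pb1 (span_pb L (span_comp N M)))
  (pb_pair (span_pb L N)
    (fmap T (pb2 (span_pb N M)) ∘ pb1 (span_pb L (span_comp N M)))
    (pb2 (span_pb L (span_comp N M))) (span_assoc_proof L N M)) _) _ _).
- abstract (rewrite /= -!composeA pb1_pair !composeA -mu_natural;
    by rewrite -!composeA !(composeA (fmap T _)) -!fmapM pb_comm).
- abstract (rewrite /= -!composeA pb1_pair !composeA; congr (_ ∘ _);
    rewrite !fmapM -(composeA (mu T A) (fmap T (dleg M))) -mu_natural;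
    by rewrite !composeA mu_mu).
- abstract (by rewrite /= -!composeA !pb2_pair).
Defined.

Record Graph := {
  gr0 : E;
  gr1 : Span gr0 gr0 }.

Record GraphMap (C D : Graph) := {
  gm0 : gr0 C ~> gr0 D;
  gm1 : apex (gr1 C) ~> apex (gr1 D);
  gm_d : dleg (gr1 D) ∘ gm1 = fmap T gm0 ∘ dleg (gr1 C);
  gm_c : cleg (gr1 D) ∘ gm1 = gm0 ∘ cleg (gr1 C) }.

Lemma GraphMap_eq (C D : Graph) (f g : GraphMap C D) :
  gm0 f = gm0 g -> gm1 f = gm1 g -> f = g.
Proof.
case: f g => [f0 f1 fd fc] [g0 g1 gd gc] /= e0 e1; subst g0 g1.
by rewrite (proof_irrelevance _ fd gd) (proof_irrelevance _ fc gc).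
Qed.

Definition graph_cat : Category.
Proof.
unshelve refine {| Obj := Graph; Hom := GraphMap;
  idm := fun C => {| gm0 := idm (gr0 C); gm1 := idm (apex (gr1 C)) |};
  compose := fun C D F g f => {| gm0 := gm0 g ∘ gm0 f; gm1 := gm1 g ∘ gm1 f |} |}.
- abstract (by rewrite fmap1 compose_1m compose_m1).
- abstract (by rewrite compose_1m compose_m1).
- abstract (by rewrite composeA gm_d -composeA gm_d composeA fmapM).
- abstract (by rewrite composeA gm_c -composeA gm_c composeA).
- abstract (by move=> *; apply: GraphMap_eq; rewrite /= compose_1m).
- abstract (by move=> *; apply: GraphMap_eq; rewrite /= compose_m1).
- abstract (by move=> *; apply: GraphMap_eq; rewrite /= composeA).
Defined.

(** Monads in the bicategory of spans. *)
Record Multicat := {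
  mc_graph :> Graph;
  mc_ids : SpanMap (span_id (gr0 mc_graph)) (gr1 mc_graph);
  mc_comp : SpanMap (span_comp (gr1 mc_graph) (gr1 mc_graph)) (gr1 mc_graph);
  mc_assoc :
    mc_comp ∘ span_hcomp (span_idm (gr1 mc_graph)) mc_comp =
    mc_comp ∘ span_hcomp mc_comp (span_idm (gr1 mc_graph))
            ∘ span_assoc (gr1 mc_graph) (gr1 mc_graph) (gr1 mc_graph);
  mc_unitl :
    mc_comp ∘ span_hcomp mc_ids (span_idm (gr1 mc_graph)) ∘ span_unitl (gr1 mc_graph) =
    idm (apex (gr1 mc_graph));
  mc_unitr :
    mc_comp ∘ span_hcomp (span_idm (gr1 mc_graph)) mc_ids ∘ span_unitr (gr1 mc_graph) =
    idm (apex (gr1 mc_graph)) }.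

(** [f_1 * f_1], both factors lying over [f_0] on the common foot. *)
Definition graph_map_square (C D : Graph) (f : GraphMap C D) :
  apex (span_comp (gr1 C) (gr1 C)) ~> apex (span_comp (gr1 D) (gr1 D)) :=
  span_comp_map (gm_d f) (gm_c f).

Record MulticatMap (C D : Multicat) := {
  mm_graph :> GraphMap C D;
  mm_ids : gm1 mm_graph ∘ mc_ids C = mc_ids D ∘ gm0 mm_graph;
  mm_comp : gm1 mm_graph ∘ mc_comp C = mc_comp D ∘ graph_map_square mm_graph }.

Lemma MulticatMap_eq (C D : Multicat) (f g : MulticatMap C D) :
  mm_graph f = mm_graph g -> f = g.
Proof.
case: f g => [f fi fc] [g gi gc] /= e; subst g.
by rewrite (proof_irrelevance _ fi gi) (proof_irrelevance _ fc gc).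
Qed.

Lemma pb1_graph_map_square (C D : Graph) (f : GraphMap C D) :
  pb1 (span_pb (gr1 D) (gr1 D)) ∘ graph_map_square f =
  fmap T (gm1 f) ∘ pb1 (span_pb (gr1 C) (gr1 C)).
Proof. exact: pb1_pair. Qed.

Lemma pb2_graph_map_square (C D : Graph) (f : GraphMap C D) :
  pb2 (span_pb (gr1 D) (gr1 D)) ∘ graph_map_square f =
  gm1 f ∘ pb2 (span_pb (gr1 C) (gr1 C)).
Proof. exact: pb2_pair. Qed.

Lemma graph_map_square1 (C : Graph) :
  graph_map_square (idm (C : graph_cat)) = idm (apex (span_comp (gr1 C) (gr1 C))).
Proof.
apply: (@pb_ext _ _ _ _ _ _ (span_pb (gr1 C) (gr1 C))).
  by rewrite pb1_graph_map_square /= fmap1 compose_1m compose_m1.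
by rewrite pb2_graph_map_square /= compose_1m compose_m1.
Qed.

Lemma graph_map_squareM (C D F : graph_cat) (g : D ~> F) (f : C ~> D) :
  graph_map_square (g ∘ f) = graph_map_square g ∘ graph_map_square f.
Proof.
apply: (@pb_ext _ _ _ _ _ _ (span_pb (gr1 F) (gr1 F))); rewrite composeA.
  rewrite !pb1_graph_map_square -composeA pb1_graph_map_square /=.
  by rewrite fmapM composeA.
by rewrite !pb2_graph_map_square -[RHS]composeA pb2_graph_map_square composeA.
Qed.

Definition multicat_cat : Category.
Proof.
unshelve refine {| Obj := Multicat; Hom := MulticatMap;
  idm := fun C => {| mm_graph := idm (mc_graph C : graph_cat) |};
  compose := fun C D F g f =>
    {| mm_graph := (mm_graph g : (mc_graph D : graph_cat) ~> mc_graph F) ∘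
                   (mm_graph f : (mc_graph C : graph_cat) ~> mc_graph D) |} |}.
- abstract (by rewrite compose_1m compose_m1).
- abstract (by rewrite graph_map_square1 compose_1m compose_m1).
- abstract (by rewrite /= -composeA mm_ids composeA mm_ids composeA).
- abstract (by rewrite graph_map_squareM /= -[LHS]composeA mm_comp [LHS]composeA mm_comp -[LHS]composeA).
- abstract (by move=> *; apply: MulticatMap_eq; exact: (@compose_1m graph_cat)).
- abstract (by move=> *; apply: MulticatMap_eq; exact: (@compose_m1 graph_cat)).
- abstract (by move=> *; apply: MulticatMap_eq; exact: (@composeA graph_cat)).
Defined.

Definition forgetful : Functor multicat_cat graph_cat.
Proof. by exists mc_graph mm_graph. Defined.

End Spans.

(* Main.v *)
From Stdlib Require Import ssreflect PeanoNat ProofIrrelevance IndefiniteDescription.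
Require Import Defs.

Set Implicit Arguments.
Unset Strict Implicit.
Unset Printing Implicit Defensive.

(** Composition with a graph [C], regarded as a span, is an endofunctor [C_1 ∘ -] of the slice over
    the object [C_0] of vertices. The arrows of the free multicategory on [C] are the trees with
    nodes in [C]: they form the initial algebra of [C_0 + C_1 ∘ -], the colimit of the nested
    sequence of the trees of height less than [n]. This colimit works because suitability makes
    [T] and pullbacks, hence [C_1 ∘ -], preserve monics and colimits of nested sequences
    ([tree_exists]). More generally, there are trees whose leaves are labelled by any object [X]
    over [C_0]; [is_tree] describes them by their stages, which give induction ([tree_ext]) and
    recursion along a map of graphs ([tree_rec]).

    The key fact is [tree_pullback]. Suppose that [Q] lies over an object of trees [R], and that
    leaves and nodes of [Q] are the pullbacks of leaves and nodes of [R]. Then [Q] is itself an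
    object of trees, as its stages can be pulled back from those of [R]. There are three uses.

    First, [eta] and [mu] being cartesian, the composite of the span of trees with an object [X]
    over [C_0] lies in this way over the trees, so it is the object of trees with leaves in [X]
    ([forest_tree]). Recursion over it defines grafting, and induction over it proves the laws of
    a multicategory and the universal property ([free_lift], [free_lift_unique]).

    Second, a square whose parallel sides are defined by recursion is a pullback when the data of the
    recursions are ([tree_square]), because the pullback in question is an object of trees. Hence
    the free multicategory monad preserves pullbacks, and the naturality squares of grafting and
    of the multiplication are pullbacks. That maps of trees restrict to pullback squares on leaves
    and on nodes comes from disjointness and stability of coproducts ([cop_cartesian_l]).

    Third, a colimit of objects of trees is an object of trees on the colimit of the graphs
    ([free_colim_edges]), so the monad preserves colimits of nested sequences.

    Graphs form a suitable category because pullbacks, finite coproducts and colimits of nested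
    sequences of graphs are computed on vertices and edges separately ([graph_suitable]).
    Monadicity holds for every left adjoint of the forgetful functor: a multicategory structure
    consists of maps between functors of the underlying graph, so it descends along the split
    quotient that presents an algebra ([multicat_monadic]). *)

(** * Pullback squares and monics *)

Section Squares.
Context {C : Category}.

(** Applies an equation between composites inside a longer, right-nested composite. *)
Lemma comp_l (a b c d : C) (g : b ~> c) (f : a ~> b) (k : a ~> c) :
  g ∘ f = k -> forall h : d ~> a, g ∘ (f ∘ h) = k ∘ h.
Proof. by move=> <- h; rewrite composeA. Qed.

Lemma pb_sq_sym (Q A B S : C) (f : A ~> S) (g : B ~> S) (p : Q ~> A) (q : Q ~> B) :
  is_pullback f g p q -> is_pullback g f q p.
Proof.
case=> e univ; split=> // X u v euv.
case: (univ X v u (eq_sym euv)) => h [[h1 h2] uni].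
by exists h; split=> // k [k1 k2]; apply: uni.
Qed.

Lemma pb_sq_ext (Q A B S : C) (f : A ~> S) (g : B ~> S) (p : Q ~> A) (q : Q ~> B) :
  is_pullback f g p q -> forall (X : C) (h k : X ~> Q),
  p ∘ h = p ∘ k -> q ∘ h = q ∘ k -> h = k.
Proof.
case=> e univ X h k e1 e2.
have ek : f ∘ (p ∘ k) = g ∘ (q ∘ k) by rewrite !composeA e.
case: (univ X _ _ ek) => l [_ uniql].
by rewrite -(uniql h) // -(uniql k).
Qed.

Lemma pb_sq_lift (Q A B S : C) (f : A ~> S) (g : B ~> S) (p : Q ~> A) (q : Q ~> B) :
  is_pullback f g p q -> forall (X : C) (u : X ~> A) (v : X ~> B),
  f ∘ u = g ∘ v -> exists h : X ~> Q, p ∘ h = u /\ q ∘ h = v.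
Proof. by case=> _ univ X u v /univ [h [hP _]]; exists h. Qed.

Lemma pb_sq_intro (Q A B S : C) (f : A ~> S) (g : B ~> S) (p : Q ~> A) (q : Q ~> B) :
  f ∘ p = g ∘ q ->
  (forall (X : C) (u : X ~> A) (v : X ~> B),
     f ∘ u = g ∘ v -> exists h : X ~> Q, p ∘ h = u /\ q ∘ h = v) ->
  (forall (X : C) (h k : X ~> Q), p ∘ h = p ∘ k -> q ∘ h = q ∘ k -> h = k) ->
  is_pullback f g p q.
Proof.
move=> e ex ext; split=> // X u v /ex [h [h1 h2]].
by exists h; split=> // k [k1 k2]; apply: ext; rewrite ?h1 ?h2 ?k1 ?k2.
Qed.

(** The two pasting laws; in [is_pullback f g p q] the side [f] is drawn at the bottom and [q] on
    top, and the squares are pasted horizontally. *)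
Lemma pb_sq_paste (Q A A2 S B1 B2 : C) (f1 : A ~> A2) (g1 : B1 ~> A2) (p : Q ~> A)
    (q1 : Q ~> B1) (f2 : A2 ~> S) (g2 : B2 ~> S) (q2 : B1 ~> B2) :
  is_pullback f1 g1 p q1 -> is_pullback f2 g2 g1 q2 ->
  is_pullback (f2 ∘ f1) g2 p (q2 ∘ q1).
Proof.
move=> pb1 pb2; apply: pb_sq_intro.
- by rewrite -composeA (proj1 pb1) !composeA (proj1 pb2).
- move=> X u v; rewrite -composeA => /(pb_sq_lift pb2) [w [w1 w2]].
  case: (pb_sq_lift pb1 (eq_sym w1)) => h [h1 h2].
  by exists h; rewrite -composeA h2.
- move=> X h k e1; rewrite -!composeA => e2; apply: (pb_sq_ext pb1) => //.
  apply: (pb_sq_ext pb2) => //.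
  by rewrite !composeA -(proj1 pb1) -!composeA e1.
Qed.

Lemma pb_sq_cancel (Q A A2 S B1 B2 : C) (f1 : A ~> A2) (g1 : B1 ~> A2) (p : Q ~> A)
    (q1 : Q ~> B1) (f2 : A2 ~> S) (g2 : B2 ~> S) (q2 : B1 ~> B2) :
  is_pullback f2 g2 g1 q2 -> f1 ∘ p = g1 ∘ q1 ->
  is_pullback (f2 ∘ f1) g2 p (q2 ∘ q1) -> is_pullback f1 g1 p q1.
Proof.
move=> pb2 e pbo; apply: pb_sq_intro => //.
- move=> X u v euv.
  have e2 : f2 ∘ f1 ∘ u = g2 ∘ (q2 ∘ v).
    by rewrite -composeA euv !composeA (proj1 pb2).
  case: (pb_sq_lift pbo e2) => h [h1 h2]; exists h; split=> //.
  apply: (pb_sq_ext pb2); last by rewrite composeA.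
  by rewrite composeA -e -composeA h1.
- move=> X h k e1 e2; apply: (pb_sq_ext pbo) => //.
  by rewrite -!composeA e2.
Qed.

Lemma pb_sq_id (A B : C) (f : A ~> B) : is_pullback (idm B) f f (idm A).
Proof.
apply: pb_sq_intro; first by rewrite compose_1m compose_m1.
- by move=> X u v; rewrite compose_1m => ->; exists v; rewrite compose_1m.
- by move=> X h k _; rewrite !compose_1m.
Qed.

Lemma pb_sq_iso (Q Q' A B S : C) (f : A ~> S) (g : B ~> S) (p : Q ~> A) (q : Q ~> B)
    (k : Q' ~> Q) (p' : Q' ~> A) (q' : Q' ~> B) :
  is_pullback f g p q -> is_iso k -> p ∘ k = p' -> q ∘ k = q' -> is_pullback f g p' q'.
Proof.
move=> pbq [l [lk kl]] <- <-; apply: pb_sq_intro.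
- by rewrite !composeA (proj1 pbq).
- move=> X u v /(pb_sq_lift pbq) [h [h1 h2]]; exists (l ∘ h).
  by rewrite -!composeA (comp_l kl) compose_1m.
- move=> X h h'; rewrite -!composeA => /(pb_sq_ext pbq) /[apply] e.
  by rewrite -(compose_1m h) -lk -composeA e composeA lk compose_1m.
Qed.

Lemma pb_sq_unique (Q Q' A B S : C) (f : A ~> S) (g : B ~> S) (p : Q ~> A) (q : Q ~> B)
    (p' : Q' ~> A) (q' : Q' ~> B) :
  is_pullback f g p q -> is_pullback f g p' q' ->
  exists k : Q' ~> Q, is_iso k /\ p ∘ k = p' /\ q ∘ k = q'.
Proof.
move=> pb1 pb2.
case: (pb_sq_lift pb1 (proj1 pb2)) => k [k1 k2].
case: (pb_sq_lift pb2 (proj1 pb1)) => l [l1 l2].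
exists k; split=> //; exists l; split.
  by apply: (pb_sq_ext pb2); rewrite composeA ?l1 ?l2 ?k1 ?k2 compose_m1.
by apply: (pb_sq_ext pb1); rewrite composeA ?k1 ?k2 ?l1 ?l2 compose_m1.
Qed.

Lemma monic_pb (A B : C) (m : A ~> B) :
  monic m <-> is_pullback m m (idm A) (idm A).
Proof.
split=> [mm|pbm X f g e].
  apply: pb_sq_intro => //.
    by move=> X u v /mm ->; exists v; rewrite compose_1m.
  by move=> X h k; rewrite !compose_1m.
by case: (pb_sq_lift pbm e) => h []; rewrite !compose_1m => <- <-.
Qed.

Lemma monic_pullback (Q A B S : C) (f : A ~> S) (g : B ~> S) (p : Q ~> A) (q : Q ~> B) :
  is_pullback f g p q -> monic g -> monic p.
Proof.
move=> pbq mg X h k e; apply: (pb_sq_ext pbq) => //; apply: mg.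
by rewrite !composeA -(proj1 pbq) -!composeA e.
Qed.

Lemma monic_comp (a b c : C) (g : b ~> c) (f : a ~> b) :
  monic g -> monic f -> monic (g ∘ f).
Proof. by move=> mg mf X h k; rewrite -!composeA => /mg /mf. Qed.

Lemma monic_cancel (a b c : C) (g : b ~> c) (f : a ~> b) : monic (g ∘ f) -> monic f.
Proof. by move=> m X h k e; apply: m; rewrite -!composeA e. Qed.

Lemma pb1_pair_l (A B S : C) (f : A ~> S) (g : B ~> S) (p : Pullback f g) (X W : C)
    (u : X ~> A) (v : X ~> B) (e : f ∘ u = g ∘ v) (w : W ~> X) :
  pb1 p ∘ (pb_pair p u v e ∘ w) = u ∘ w.
Proof. by rewrite composeA pb1_pair. Qed.

Lemma pb2_pair_l (A B S : C) (f : A ~> S) (g : B ~> S) (p : Pullback f g) (X W : C)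
    (u : X ~> A) (v : X ~> B) (e : f ∘ u = g ∘ v) (w : W ~> X) :
  pb2 p ∘ (pb_pair p u v e ∘ w) = v ∘ w.
Proof. by rewrite composeA pb2_pair. Qed.

End Squares.

Lemma preserves_monic (C D : Category) (F : Functor C D) : preserves_pullbacks F ->
  forall (a b : C) (m : a ~> b), monic m -> monic (fmap F m).
Proof. by move=> pF a b m /monic_pb /pF; rewrite !fmap1 => /monic_pb. Qed.

(** * Binary coproducts in a suitable category *)

Definition is_cop (C : Category) (A B S : C) (a : A ~> S) (b : B ~> S) : Prop :=
  forall (X : C) (u : A ~> X) (v : B ~> X), exists! h : S ~> X, h ∘ a = u /\ h ∘ b = v.

Section Coproducts.
Context {C : Category}.

Definition fam2 (A B : C) (k : bool) : C := if k then A else B.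

Definition fam2_map (A B S : C) (a : A ~> S) (b : B ~> S) (k : bool) : fam2 A B k ~> S :=
  match k with true => a | false => b end.

Lemma cop_coproduct (A B S : C) (a : A ~> S) (b : B ~> S) :
  is_cop a b <-> is_coproduct (fam2_map a b).
Proof.
split=> [ab X q|ab X u v].
  case: (ab X (q true) (q false)) => h [[h1 h2] uni].
  exists h; split=> [[]//|k kq]; apply: uni; split; [exact: (kq true)|exact: (kq false)].
case: (ab X (fam2_map u v)) => h [hq uni].
exists h; split=> [|k [k1 k2]]; first by split; [exact: (hq true)|exact: (hq false)].
by apply: uni => -[].
Qed.

Lemma coproduct_cop (A : bool -> C) (S : C) (i : forall b, A b ~> S) :
  is_coproduct i -> is_cop (i true) (i false).
Proof.
move=> ii X u v.
pose q (k : bool) : A k ~> X := match k with true => u | false => v end.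
case: (ii X q) => h [hq uni].
exists h; split=> [|k [k1 k2]]; first by split; [exact: (hq true)|exact: (hq false)].
by apply: uni => -[].
Qed.

Lemma cop_lift (A B S : C) (a : A ~> S) (b : B ~> S) : is_cop a b ->
  forall (X : C) (u : A ~> X) (v : B ~> X), exists h : S ~> X, h ∘ a = u /\ h ∘ b = v.
Proof. by move=> ab X u v; case: (ab X u v) => h [hP _]; exists h. Qed.

Lemma cop_ext (A B S : C) (a : A ~> S) (b : B ~> S) : is_cop a b ->
  forall (X : C) (h k : S ~> X), h ∘ a = k ∘ a -> h ∘ b = k ∘ b -> h = k.
Proof.
move=> ab X h k e1 e2; case: (ab X (k ∘ a) (k ∘ b)) => l [_ uni].
by rewrite -(uni h) // -(uni k).
Qed.

Lemma cop_intro (A B S : C) (a : A ~> S) (b : B ~> S) :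
  (forall (X : C) (u : A ~> X) (v : B ~> X), exists h : S ~> X, h ∘ a = u /\ h ∘ b = v) ->
  (forall (X : C) (h k : S ~> X), h ∘ a = k ∘ a -> h ∘ b = k ∘ b -> h = k) -> is_cop a b.
Proof.
move=> ex ext X u v; case: (ex X u v) => h [h1 h2].
by exists h; split=> // k [k1 k2]; apply: ext; rewrite ?h1 ?h2 ?k1 ?k2.
Qed.

Lemma bool_finite : is_finite bool.
Proof. by exists (true :: false :: nil)%list => -[]; [left|right; left]. Qed.

Lemma false_finite : is_finite False.
Proof. by exists nil. Qed.

Lemma initial_coproduct (A : False -> C) (Z : C) (i : forall k, A k ~> Z) :
  is_initial Z <-> is_coproduct i.
Proof.
split=> [iz X q|iz X].
  by case: (iz X) => h [_ uni]; exists h; split=> [[]|k _]; apply: uni.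
have [h [_ uni]] := iz X (fun k : False => match k with end).
by exists h; split=> // k _; apply: uni => -[].
Qed.

Lemma initial_ext (Z : C) : is_initial Z -> forall (X : C) (h k : Z ~> X), h = k.
Proof. by move=> iz X h k; case: (iz X) => l [_ uni]; rewrite -(uni h) // -(uni k). Qed.

Hypothesis sC : suitable_category C.

Lemma cop_exists (A B : C) : exists (S : C) (a : A ~> S) (b : B ~> S), is_cop a b.
Proof.
case: (suitable_coproducts sC (fam2 A B) bool_finite) => S [i ii].
by exists S, (i true), (i false); apply: (coproduct_cop ii).
Qed.

Lemma initial_exists : exists Z : C, is_initial Z.
Proof.
case: (suitable_coproducts sC (fun k : False => match k with end) false_finite) => Z [i ii].
by exists Z; apply: (proj2 (initial_coproduct i)).
Qed.

Lemma cop_stable (A B S : C) (a : A ~> S) (b : B ~> S) (X : C) (f : X ~> S)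
    (PA PB : C) (p : PA ~> X) (q : PA ~> A) (p' : PB ~> X) (q' : PB ~> B) :
  is_cop a b -> is_pullback f a p q -> is_pullback f b p' q' -> is_cop p p'.
Proof.
move=> /cop_coproduct ab pa pb.
apply/cop_coproduct.
apply: (suitable_stable sC bool_finite ab (f := f) (P := fam2 PA PB)
          (q := fun k => match k with true => q | false => q' end)).
by case.
Qed.

(** The empty coproduct is stable under pullback along [f]. *)
Lemma initial_strict (X Z : C) (f : X ~> Z) : is_initial Z -> is_initial X.
Proof.
pose A (k : False) : C := match k with end.
pose i (Y : C) (k : False) : A k ~> Y := match k with end.
move=> /(proj1 (initial_coproduct (i Z))) iz; apply: (proj2 (initial_coproduct (i X))).
by apply: (suitable_stable sC false_finite iz (f := f) (q := fun k => match k with end)) => -[].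
Qed.

Lemma cop_monic (A B S : C) (a : A ~> S) (b : B ~> S) : is_cop a b -> monic a /\ monic b.
Proof.
move=> /cop_coproduct ab; have [m _] := suitable_disjoint sC ab.
by split; [exact: (m true)|exact: (m false)].
Qed.

Lemma cop_disjoint (A B S X : C) (a : A ~> S) (b : B ~> S) (u : X ~> A) (v : X ~> B) :
  is_cop a b -> a ∘ u = b ∘ v -> is_initial X.
Proof.
move=> /cop_coproduct ab e.
have [_ dis] := suitable_disjoint sC ab.
have [Z iZ] := initial_exists.
have [u0 _] := iZ A; have [v0 _] := iZ B.
by case: (pb_sq_lift (dis Z u0 v0 iZ) e) => h _; exact: initial_strict h iZ.
Qed.

Lemma initial_monic (Z X : C) (f : Z ~> X) : is_initial Z -> monic f.
Proof.
move=> iZ Y h k _; exact: initial_ext (initial_strict h iZ) _ _ _.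
Qed.

Context (P : PullbackChoice C).

(** Split a test object [X] over the two summands of [S]; over [B] it maps to both
    summands of [S'], so that piece is initial and [X] lives over [A] alone. *)
Lemma cop_cartesian_l (A B S A' B' S' : C) (a : A ~> S) (b : B ~> S) (a' : A' ~> S')
    (b' : B' ~> S') (h : S ~> S') (u : A ~> A') (v : B ~> B') :
  is_cop a b -> is_cop a' b' -> h ∘ a = a' ∘ u -> h ∘ b = b' ∘ v ->
  is_pullback h a' a u.
Proof.
move=> ab ab' ea eb.
have [ma _] := cop_monic ab; have [ma' _] := cop_monic ab'.
apply: pb_sq_intro => // [X s t est|X k l]; last by move=> /ma.
have pA := pb_is_pullback (P s a); have pB := pb_is_pullback (P s b).
have cX := cop_stable ab pA pB.
have iB : is_initial (P s b).
  apply: (cop_disjoint (u := t ∘ pb1 (P s b)) (v := v ∘ pb2 (P s b)) ab').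
  by rewrite !composeA -est -eb -!composeA pb_comm.
case: (iB A) => z _.
case: (cop_lift cX (pb2 (P s a)) z) => m [m1 m2]; exists m.
have am : a ∘ m = s.
  apply: (cop_ext cX); first by rewrite -composeA m1 pb_comm.
  exact: initial_ext iB _ _ _.
split=> //; apply: ma'.
by rewrite composeA -ea -composeA am.
Qed.

Lemma cop_sym (A B S : C) (a : A ~> S) (b : B ~> S) : is_cop a b -> is_cop b a.
Proof.
move=> ab; apply: cop_intro => [X u v|X h k e1 e2]; last exact: (cop_ext ab).
by case: (cop_lift ab v u) => h [h1 h2]; exists h.
Qed.

Lemma cop_cartesian_r (A B S A' B' S' : C) (a : A ~> S) (b : B ~> S) (a' : A' ~> S')
    (b' : B' ~> S') (h : S ~> S') (u : A ~> A') (v : B ~> B') :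
  is_cop a b -> is_cop a' b' -> h ∘ a = a' ∘ u -> h ∘ b = b' ∘ v ->
  is_pullback h b' b v.
Proof. by move=> /cop_sym ab /cop_sym ab' ea eb; exact: cop_cartesian_l ab ab' eb ea. Qed.

(** Equality of two maps into [S] can be tested over each summand of [S']; there both maps factor
    through one summand of [S], by [cop_cartesian_l] and [cop_cartesian_r]. *)
Lemma cop_monic_sum (A B S A' B' S' : C) (a : A ~> S) (b : B ~> S) (a' : A' ~> S')
    (b' : B' ~> S') (h : S ~> S') (u : A ~> A') (v : B ~> B') :
  is_cop a b -> is_cop a' b' -> h ∘ a = a' ∘ u -> h ∘ b = b' ∘ v ->
  monic u -> monic v -> monic h.
Proof.
move=> ab ab' ea eb mu mv X f g efg.
have cX := cop_stable ab' (pb_is_pullback (P (h ∘ f) a')) (pb_is_pullback (P (h ∘ f) b')).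
have half (A0 A0' : C) (i : A0 ~> S) (i' : A0' ~> S') (w : A0 ~> A0') (mw : monic w)
    (Y : C) (p : Y ~> X) (q : Y ~> A0') :
    is_pullback h i' i w -> h ∘ f ∘ p = i' ∘ q -> f ∘ p = g ∘ p.
  move=> pbw e.
  have ef : h ∘ (f ∘ p) = i' ∘ q by rewrite composeA.
  have eg : h ∘ (g ∘ p) = i' ∘ q by rewrite composeA -efg.
  case: (pb_sq_lift pbw ef) => f' [<- f2]; case: (pb_sq_lift pbw eg) => g' [<- g2].
  by congr (_ ∘ _); apply: mw; rewrite f2 g2.
apply: (cop_ext cX).
  apply: (half _ _ a a' u mu _ _ _ _ (pb_comm (P (h ∘ f) a'))).
  exact: cop_cartesian_l ab ab' ea eb.
apply: (half _ _ b b' v mv _ _ _ _ (pb_comm (P (h ∘ f) b'))).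
exact: cop_cartesian_r ab ab' ea eb.
Qed.

End Coproducts.

(** * Colimits over multigraphs *)

(** Colimits of diagrams indexed by a directed multigraph: coproducts are those without edges,
    and colimits of functors those whose edges are the arrows of the indexing category. *)
Definition is_gcolim (C : Category) (J : Type) (Ed : J -> J -> Type) (A : J -> C)
    (m : forall j k, Ed j k -> A j ~> A k) (L : C) (i : forall j, A j ~> L) : Prop :=
  (forall j k (u : Ed j k), i k ∘ m j k u = i j) /\
  (forall (X : C) (q : forall j, A j ~> X),
     (forall j k (u : Ed j k), q k ∘ m j k u = q j) ->
     exists! h : L ~> X, forall j, h ∘ i j = q j).

Section GColim.
Context {C : Category} (J : Type) (Ed : J -> J -> Type) (A : J -> C)
  (m : forall j k, Ed j k -> A j ~> A k).

Lemma gcolim_lift (L : C) (i : forall j, A j ~> L) : is_gcolim m i ->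
  forall (X : C) (q : forall j, A j ~> X), (forall j k (u : Ed j k), q k ∘ m u = q j) ->
  exists h : L ~> X, forall j, h ∘ i j = q j.
Proof. by move=> [_ univ] X q /univ [h [hq _]]; exists h. Qed.

Lemma gcolim_ext (L : C) (i : forall j, A j ~> L) : is_gcolim m i ->
  forall (X : C) (h k : L ~> X), (forall j, h ∘ i j = k ∘ i j) -> h = k.
Proof.
move=> [ei univ] X h k e; have [|l [_ uni]] := univ X (fun j => k ∘ i j).
  by move=> j j' u; rewrite -composeA ei.
by rewrite -(uni h) // -(uni k).
Qed.

Lemma gcolim_iso (L L' : C) (i : forall j, A j ~> L) (i' : forall j, A j ~> L') (k : L ~> L') :
  is_gcolim m i -> is_iso k -> (forall j, k ∘ i j = i' j) -> is_gcolim m i'.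
Proof.
move=> ci [l [lk kl]] ei; split; first by move=> j j' u; rewrite -!ei -composeA (proj1 ci).
move=> X q /(gcolim_lift ci) [h hq]; exists (h ∘ l); split.
  by move=> j; rewrite -ei -composeA (comp_l lk) compose_1m.
move=> h' hq'; suff e : h = h' ∘ k by rewrite e -composeA kl compose_m1.
by apply: (gcolim_ext ci) => j; rewrite -composeA ei hq hq'.
Qed.

Lemma gcolim_unique (L L' : C) (i : forall j, A j ~> L) (i' : forall j, A j ~> L') :
  is_gcolim m i -> is_gcolim m i' -> exists k : L ~> L', is_iso k /\ forall j, k ∘ i j = i' j.
Proof.
move=> ci ci'.
have [k ek] := gcolim_lift ci (proj1 ci'); have [l el] := gcolim_lift ci' (proj1 ci).
exists k; split=> //; exists l; split.
  by apply: (gcolim_ext ci) => j; rewrite -composeA ek el compose_1m.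
by apply: (gcolim_ext ci') => j; rewrite -composeA el ek compose_1m.
Qed.

End GColim.

Lemma coproduct_gcolim (C : Category) (I : Type) (A : I -> C) (S : C) (i : forall k, A k ~> S) :
  is_coproduct i <-> is_gcolim (fun j k (u : False) => match u return A j ~> A k with end) i.
Proof.
split=> [ci|[_ univ] X q]; last by apply: univ.
by split=> // X q _; apply: ci.
Qed.

(** * Sequences and their colimits *)

Section Sequences.
Context {C : Category}.

Definition step (n : nat) : @Hom omega n (S n) := Nat.le_succ_diag_r n.

Lemma omega_hom_ind (Q : forall m n : omega, (m ~> n) -> Prop) :
  (forall n, Q n n (idm n)) ->
  (forall m n u, Q m n u -> Q m (S n) (@compose omega _ _ _ (step n) u)) ->
  forall m n u, Q m n u.
Proof.
move=> Q1 QS m; elim=> [|n IH] u.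
  have e : m = 0 by apply: (proj1 (Nat.le_0_r m) u).
  subst m; rewrite (proof_irrelevance (0 <= 0) u (@idm omega 0)); exact: Q1.
case: (Nat.eq_dec m (S n)) => [e|ne].
  subst m; rewrite (proof_irrelevance (S n <= S n) u (@idm omega (S n))); exact: Q1.
have mn : m <= n by case: (proj1 (Nat.le_succ_r m n) u).
rewrite (proof_irrelevance (m <= S n) u (@compose omega _ _ _ (step n) mn)).
exact: QS.
Qed.

Lemma omega_cocone (A : Functor omega C) (X : C) (q : forall n, A n ~> X) :
  (forall n, q (S n) ∘ fmap A (step n) = q n) ->
  forall (m n : omega) (u : m ~> n), q n ∘ fmap A u = q m.
Proof.
move=> eq; apply: omega_hom_ind => [n|m n u IH]; first by rewrite (fmap1 A) compose_m1.
by rewrite fmapM composeA eq.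
Qed.

Lemma nested_step (A : Functor omega C) :
  (forall n, monic (fmap A (step n))) -> nested A.
Proof.
move=> mA; apply: omega_hom_ind => [n|m n u IH].
  by rewrite (fmap1 A) => X f g; rewrite !compose_1m.
by rewrite fmapM; apply: monic_comp.
Qed.

Section Chain.
Context (A : nat -> C) (u : forall n, A n ~> A (S n)).

(** Testing [m = n] before recursing on [n] makes the result depend on the endpoints only, whatever
    the proof of [m <= n]. *)
Fixpoint chain_map (m n : nat) : m <= n -> A m ~> A n :=
  match Nat.eq_dec m n with
  | left e => fun _ => eq_rect m (fun k => A m ~> A k) (idm (A m)) n e
  | right ne =>
    match n return m <> n -> m <= n -> A m ~> A n with
    | 0 => fun ne le => False_rect _ (ne (proj1 (Nat.le_0_r m) le))
    | S n' => fun ne le => u n' ∘ chain_map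
        (match proj1 (Nat.le_succ_r m n') le with
         | or_introl l => l | or_intror e => False_ind _ (ne e) end)
    end ne
  end.

Lemma chain_map1 n (l : n <= n) : chain_map l = idm (A n).
Proof.
case: n l => [|n] l; cbn [chain_map]; case: (Nat.eq_dec _ _) => // e;
  by rewrite (proof_irrelevance _ e eq_refl).
Qed.

Lemma chain_mapS m n (l : m <= n) (l' : m <= S n) : chain_map l' = u n ∘ chain_map l.
Proof.
cbn [chain_map]; case: (Nat.eq_dec _ _) => [e|ne].
  by exfalso; move: l; rewrite e; apply: Nat.nle_succ_diag_l.
by congr (_ ∘ chain_map _); apply: proof_irrelevance.
Qed.

Lemma chain_mapM m n p (h : n <= p) (l : m <= n) (k : m <= p) :
  chain_map k = chain_map h ∘ chain_map l.
Proof.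
elim: p h k => [|p IH] h k.
  have e : n = 0 by apply: (proj1 (Nat.le_0_r n) h).
  subst n; rewrite chain_map1 compose_1m; congr (chain_map _); exact: proof_irrelevance.
case: (Nat.eq_dec n (S p)) => [e|ne].
  subst n; rewrite (chain_map1 h) compose_1m; congr (chain_map _); exact: proof_irrelevance.
have np : n <= p by case: (proj1 (Nat.le_succ_r n p) h).
rewrite (chain_mapS np) (chain_mapS (Nat.le_trans _ _ _ l np)) -composeA.
by congr (_ ∘ _); apply: IH.
Qed.

Definition chain : Functor omega C.
Proof.
exists A chain_map.
- abstract (by move=> a; apply: chain_map1).
- abstract (by move=> *; apply: chain_mapM).
Defined.

Lemma chain_step n : fmap chain (step n) = u n.
Proof.
change (chain_map (step n) = u n).
by rewrite (chain_mapS (Nat.le_refl n)) chain_map1 compose_m1.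
Qed.

End Chain.

Lemma colim_ext (A : Functor omega C) (L : C) (i : forall n, A n ~> L) : is_colimit i ->
  forall (X : C) (h k : L ~> X), (forall n, h ∘ i n = k ∘ i n) -> h = k.
Proof. by move=> ci X h k; apply: (gcolim_ext (m := fun j k u => fmap A u) ci). Qed.

Lemma colim_lift (A : Functor omega C) (L : C) (i : forall n, A n ~> L) : is_colimit i ->
  forall (X : C) (q : forall n, A n ~> X), (forall n, q (S n) ∘ fmap A (step n) = q n) ->
  exists h : L ~> X, forall n, h ∘ i n = q n.
Proof.
move=> [_ univ] X q eq.
by case: (univ X q (omega_cocone eq)) => h [hq _]; exists h.
Qed.

Lemma colim_intro (A : Functor omega C) (L : C) (i : forall n, A n ~> L) :
  (forall n, i (S n) ∘ fmap A (step n) = i n) ->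
  (forall (X : C) (q : forall n, A n ~> X), (forall n, q (S n) ∘ fmap A (step n) = q n) ->
     exists h : L ~> X, forall n, h ∘ i n = q n) ->
  (forall (X : C) (h k : L ~> X), (forall n, h ∘ i n = k ∘ i n) -> h = k) -> is_colimit i.
Proof.
move=> ei ex ext; split; first exact: omega_cocone.
move=> X q eq; case: (ex X q) => [n|h hq]; first exact: eq.
by exists h; split=> // k kq; apply: ext => n; rewrite hq kq.
Qed.

(** The tail of a sequence is cofinal in it. *)
Lemma colim_ext_tail (A : Functor omega C) (L : C) (i : forall n, A n ~> L) : is_colimit i ->
  forall (X : C) (h k : L ~> X), (forall n, h ∘ i (S n) = k ∘ i (S n)) -> h = k.
Proof.
move=> ci X h k e; apply: (colim_ext ci) => n.
by rewrite -(proj1 ci _ _ (step n)) !composeA e.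
Qed.

Lemma colim_iso (A : Functor omega C) (L L' : C) (i : forall n, A n ~> L) (k : L ~> L')
    (i' : forall n, A n ~> L') :
  is_colimit i -> is_iso k -> (forall n, k ∘ i n = i' n) -> is_colimit i'.
Proof. exact: (gcolim_iso (m := fun j k u => fmap A u)). Qed.

Definition const_seq (X : C) : Functor omega C.
Proof.
exists (fun _ => X) (fun _ _ _ => idm X).
- abstract by [].
- abstract (by move=> *; rewrite compose_1m).
Defined.

Lemma const_nested (X : C) : nested (const_seq X).
Proof. by move=> m n u Y f g; rewrite /= !compose_1m. Qed.

Lemma const_colim (X : C) : is_colimit (D := const_seq X) (fun _ => idm X).
Proof.
apply: colim_intro => [n|Y q eq|Y h k /(_ 0)]; rewrite /= ?compose_1m ?compose_m1 //.
exists (q 0) => n; rewrite compose_m1.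
by elim: n => // n ->; rewrite -eq /= compose_m1.
Qed.

End Sequences.

(** * The levelwise pullback of two diagrams *)

Section PullbackFunctor.
Context {J C : Category} (P : PullbackChoice C) (A B S : Functor J C)
  (phi : NatTrans A S) (psi : NatTrans B S).

Lemma pb_functor_proof (j k : J) (u : j ~> k) :
  phi k ∘ (fmap A u ∘ pb1 (P (phi j) (psi j))) = psi k ∘ (fmap B u ∘ pb2 (P (phi j) (psi j))).
Proof.
by rewrite !composeA !ntrans_natural -!composeA pb_comm.
Qed.

Definition pb_functor : Functor J C.
Proof.
exists (fun j => pb (P (phi j) (psi j)))
  (fun j k u => pb_pair (P (phi k) (psi k)) _ _ (pb_functor_proof u)).
- abstract (by move=> j; apply: pb_ext;
    rewrite ?pb1_pair ?pb2_pair fmap1 compose_1m compose_m1).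
- abstract (by move=> a b c g f; apply: pb_ext;
    rewrite composeA ?pb1_pair ?pb2_pair -composeA ?pb1_pair ?pb2_pair fmapM composeA).
Defined.

Definition pb_functor1 : NatTrans pb_functor A.
Proof.
exists (fun j => pb1 (P (phi j) (psi j))).
abstract (by move=> j k u; rewrite /= pb1_pair).
Defined.

Definition pb_functor2 : NatTrans pb_functor B.
Proof.
exists (fun j => pb2 (P (phi j) (psi j))).
abstract (by move=> j k u; rewrite /= pb2_pair).
Defined.

End PullbackFunctor.

Lemma nested_pullback (C : Category) (Q A B S : Functor omega C) (phi : NatTrans A S)
    (psi : NatTrans B S) (pi1 : NatTrans Q A) (pi2 : NatTrans Q B) :
  nested A -> nested B -> (forall n, is_pullback (phi n) (psi n) (pi1 n) (pi2 n)) -> nested Q.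
Proof.
move=> nA nB pbn m n u X h k e; apply: (pb_sq_ext (pbn m)).
  by apply: (nA _ _ u); rewrite !composeA -(ntrans_natural pi1) -!composeA e.
by apply: (nB _ _ u); rewrite !composeA -(ntrans_natural pi2) -!composeA e.
Qed.

(** The levelwise pullback is nested, hence has some colimit; as colimits commute with pullbacks,
    that colimit is another pullback of [f] and [g], so the given one is isomorphic to it. *)
Lemma nested_pullback_colim (C : Category) (P : PullbackChoice C) (sC : suitable_category C)
    (A B S : Functor omega C) (phi : NatTrans A S) (psi : NatTrans B S)
    (LP LA LB LS : C) (iA : forall n, A n ~> LA) (iB : forall n, B n ~> LB)
    (iS : forall n, S n ~> LS) (f : LA ~> LS) (g : LB ~> LS) (p : LP ~> LA) (q : LP ~> LB)
    (iP : forall n, pb_functor P phi psi n ~> LP) :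
  nested A -> nested B -> nested S -> is_colimit iA -> is_colimit iB -> is_colimit iS ->
  (forall n, f ∘ iA n = iS n ∘ phi n) -> (forall n, g ∘ iB n = iS n ∘ psi n) ->
  is_pullback f g p q ->
  (forall n, p ∘ iP n = iA n ∘ pb_functor1 P phi psi n) ->
  (forall n, q ∘ iP n = iB n ∘ pb_functor2 P phi psi n) ->
  is_colimit iP.
Proof.
move=> nA nB nS cA cB cS ef eg pbL ep eq.
have pbn n : is_pullback (phi n) (psi n) (pb_functor1 P phi psi n) (pb_functor2 P phi psi n).
  exact: pb_is_pullback.
have nP : nested (pb_functor P phi psi) := nested_pullback nA nB pbn.
have [L [i ci]] := suitable_nested sC nP.
have [p' ep'] : exists p' : L ~> LA, forall n, p' ∘ i n = iA n ∘ pb_functor1 P phi psi n.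
  apply: (colim_lift ci) => n.
  by rewrite -composeA ntrans_natural composeA (proj1 cA).
have [q' eq'] : exists q' : L ~> LB, forall n, q' ∘ i n = iB n ∘ pb_functor2 P phi psi n.
  apply: (colim_lift ci) => n.
  by rewrite -composeA ntrans_natural composeA (proj1 cB).
have pbL' := suitable_nested_pullback sC nA nB nS pbn ci cA cB cS ef eg ep' eq'.
have [k [ik [pk qk]]] := pb_sq_unique pbL pbL'.
apply: (colim_iso ci ik) => n; apply: (pb_sq_ext pbL).
  by rewrite composeA pk ep ep'.
by rewrite composeA qk eq eq'.
Qed.

(** * The action of a graph on objects over its vertices *)

Section Action.
Context {E : Category} (T : Monad E) (P : PullbackChoice E).
Notation K := (graph_cat T).

Definition vertices : Functor K E.
Proof. by exists (fun C : K => gr0 C) (fun (C D : K) (f : C ~> D) => gm0 f). Defined.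

Definition edges : Functor K E.
Proof. by exists (fun C : K => apex (gr1 C)) (fun (C D : K) (f : C ~> D) => gm1 f). Defined.

(** The apex of the composite of [C], seen as a span, with a span of right leg [q]. It is functorial
    in [q], so that [act C] is an endofunctor of the slice over the vertices of [C]: an element is
    an edge of [C] together with an element of [Q] over each of its inputs. *)
Definition act (C : K) (Q : E) (q : Q ~> gr0 C) : Pullback (fmap T q) (dleg (gr1 C)) :=
  P (fmap T q) (dleg (gr1 C)).
Arguments act C {Q} q.

Lemma act_map_proof (C D : K) (f : C ~> D) (Q R : E) (q : Q ~> gr0 C) (r : R ~> gr0 D)
    (h : Q ~> R) (e : r ∘ h = gm0 f ∘ q) :
  fmap T r ∘ (fmap T h ∘ pb1 (act C q)) = dleg (gr1 D) ∘ (gm1 f ∘ pb2 (act C q)).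
Proof.
by rewrite !composeA gm_d -fmapM e fmapM -!composeA pb_comm.
Qed.

Definition act_map (C D : K) (f : C ~> D) (Q R : E) (q : Q ~> gr0 C) (r : R ~> gr0 D)
    (h : Q ~> R) (e : r ∘ h = gm0 f ∘ q) : act C q ~> act D r :=
  pb_pair (act D r) _ _ (act_map_proof e).

Lemma over_idm (C : K) (Q R : E) (q : Q ~> gr0 C) (r : R ~> gr0 C) (h : Q ~> R) :
  r ∘ h = q -> r ∘ h = gm0 (idm C) ∘ q.
Proof. by move=> ->; rewrite compose_1m. Qed.

Definition act_sub (C : K) (Q R : E) (q : Q ~> gr0 C) (r : R ~> gr0 C)
    (h : Q ~> R) (e : r ∘ h = q) : act C q ~> act C r := act_map (over_idm e).

Section ActMap.
Context (C D : K) (f : C ~> D) (Q R : E) (q : Q ~> gr0 C) (r : R ~> gr0 D)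
  (h : Q ~> R) (e : r ∘ h = gm0 f ∘ q).

Lemma pb1_act_map : pb1 (act D r) ∘ act_map e = fmap T h ∘ pb1 (act C q).
Proof. exact: pb1_pair. Qed.

Lemma pb2_act_map : pb2 (act D r) ∘ act_map e = gm1 f ∘ pb2 (act C q).
Proof. exact: pb2_pair. Qed.

End ActMap.

Section ActSub.
Context (C : K) (Q R : E) (q : Q ~> gr0 C) (r : R ~> gr0 C) (h : Q ~> R) (e : r ∘ h = q).

Lemma pb1_act_sub : pb1 (act C r) ∘ act_sub e = fmap T h ∘ pb1 (act C q).
Proof. exact: pb1_pair. Qed.

Lemma pb2_act_sub : pb2 (act C r) ∘ act_sub e = pb2 (act C q).
Proof. by rewrite /act_sub pb2_act_map /= compose_1m. Qed.

Lemma act_sub_monic : preserves_pullbacks T -> monic h -> monic (act_sub e).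
Proof.
move=> pT mh X u v euv.
apply: pb_ext.
  apply: (preserves_monic pT mh).
  by rewrite !composeA -pb1_act_sub -!composeA euv.
by rewrite -pb2_act_sub -!composeA euv.
Qed.

End ActSub.

(** Maps into [act D r] are compared on inputs and on root edges. *)
Lemma act_ext (D : K) (R : E) (r : R ~> gr0 D) (W : E) (u v : W ~> act D r) :
  pb1 (act D r) ∘ u = pb1 (act D r) ∘ v ->
  pb2 (act D r) ∘ u = pb2 (act D r) ∘ v -> u = v.
Proof. exact: pb_ext. Qed.

Lemma act_map_irr (C D : K) (f : C ~> D) (Q R : E) (q : Q ~> gr0 C) (r : R ~> gr0 D)
    (h h' : Q ~> R) (e : r ∘ h = gm0 f ∘ q) (e' : r ∘ h' = gm0 f ∘ q) :
  h = h' -> act_map e = act_map e'.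
Proof. by move=> eh; apply: act_ext; rewrite ?pb1_act_map ?pb2_act_map ?eh. Qed.

(** Pullbacks commute with pullbacks, and [T] preserves them. *)
Lemma act_pullback : preserves_pullbacks T ->
  forall (C0 C1 C2 C3 : K) (f10 : C1 ~> C0) (f20 : C2 ~> C0) (f31 : C3 ~> C1)
    (f32 : C3 ~> C2) (Q0 Q1 Q2 Q3 : E) (q0 : Q0 ~> gr0 C0) (q1 : Q1 ~> gr0 C1)
    (q2 : Q2 ~> gr0 C2) (q3 : Q3 ~> gr0 C3) (h10 : Q1 ~> Q0) (h20 : Q2 ~> Q0)
    (h31 : Q3 ~> Q1) (h32 : Q3 ~> Q2) (e10 : q0 ∘ h10 = gm0 f10 ∘ q1)
    (e20 : q0 ∘ h20 = gm0 f20 ∘ q2) (e31 : q1 ∘ h31 = gm0 f31 ∘ q3)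
    (e32 : q2 ∘ h32 = gm0 f32 ∘ q3),
  is_pullback (gm0 f10) (gm0 f20) (gm0 f31) (gm0 f32) ->
  is_pullback (gm1 f10) (gm1 f20) (gm1 f31) (gm1 f32) ->
  is_pullback h10 h20 h31 h32 ->
  is_pullback (act_map e10) (act_map e20) (act_map e31) (act_map e32).
Proof.
move=> pT C0 C1 C2 C3 f10 f20 f31 f32 Q0 Q1 Q2 Q3 q0 q1 q2 q3 h10 h20 h31 h32
  e10 e20 e31 e32 sq0 sq1 pbh.
have Tsq0 := pT _ _ _ _ _ _ _ _ sq0; have Tpbh := pT _ _ _ _ _ _ _ _ pbh.
apply: pb_sq_intro.
- apply: act_ext; rewrite !composeA ?pb1_act_map ?pb2_act_map -!composeA
    ?pb1_act_map ?pb2_act_map !composeA.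
    by rewrite (proj1 Tpbh).
  by rewrite (proj1 sq1).
- move=> X u v euv.
  have e1 : fmap T h10 ∘ (pb1 (act C1 q1) ∘ u) = fmap T h20 ∘ (pb1 (act C2 q2) ∘ v).
    by rewrite !composeA -!(pb1_act_map e10) -!(pb1_act_map e20) -!composeA euv.
  have e2 : gm1 f10 ∘ (pb2 (act C1 q1) ∘ u) = gm1 f20 ∘ (pb2 (act C2 q2) ∘ v).
    by rewrite !composeA -!(pb2_act_map e10) -!(pb2_act_map e20) -!composeA euv.
  case: (pb_sq_lift Tpbh e1) => a [a1 a2]; case: (pb_sq_lift sq1 e2) => b [b1 b2].
  have eab : fmap T q3 ∘ a = dleg (gr1 C3) ∘ b.
    apply: (pb_sq_ext Tsq0); rewrite composeA -fmapM.
      by rewrite -e31 fmapM -composeA a1 composeA pb_comm composeA -gm_d -!composeA b1.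
    by rewrite -e32 fmapM -composeA a2 composeA pb_comm composeA -gm_d -!composeA b2.
  exists (pb_pair (act C3 q3) a b eab); split; apply: act_ext;
    rewrite composeA ?pb1_act_map ?pb2_act_map -composeA ?pb1_pair ?pb2_pair //.
- move=> X u v e1 e2; apply: act_ext.
    apply: (pb_sq_ext Tpbh).
      by rewrite !composeA -!(pb1_act_map e31) -!composeA e1.
    by rewrite !composeA -!(pb1_act_map e32) -!composeA e2.
  apply: (pb_sq_ext sq1).
    by rewrite !composeA -!(pb2_act_map e31) -!composeA e1.
  by rewrite !composeA -!(pb2_act_map e32) -!composeA e2.
Qed.

Section ActColimit.
Context (hET : suitable T) (G : Functor omega K) (S : Functor omega E)
  (qn : NatTrans S (functor_comp vertices G)).

Definition act_arity : NatTrans (functor_comp T S) (functor_comp (functor_comp T vertices) G).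
Proof.
exists (fun n => fmap T (qn n)).
abstract (by move=> m n u; rewrite /= -!fmapM (ntrans_natural qn)).
Defined.

Definition act_edge : NatTrans (functor_comp edges G) (functor_comp (functor_comp T vertices) G).
Proof.
exists (fun n => dleg (gr1 (G n))).
abstract (by move=> m n u; rewrite /= gm_d).
Defined.

Definition act_seq : Functor omega E := pb_functor P act_arity act_edge.

Lemma pb1_act_seq (m n : omega) (u : m ~> n) :
  pb1 (act (G n) (qn n)) ∘ fmap act_seq u = fmap T (fmap S u) ∘ pb1 (act (G m) (qn m)).
Proof. exact: pb1_pair. Qed.

Lemma pb2_act_seq (m n : omega) (u : m ~> n) :
  pb2 (act (G n) (qn n)) ∘ fmap act_seq u = gm1 (fmap G u) ∘ pb2 (act (G m) (qn m)).
Proof. exact: pb2_pair. Qed.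

(** [T] preserves colimits of nested sequences, and these commute with pullbacks. *)
Lemma act_colimit (C : K) (j : forall n, G n ~> C) (Q : E) (q : Q ~> gr0 C)
    (i : forall n, S n ~> Q) (e : forall n, q ∘ i n = gm0 (j n) ∘ qn n) :
  nested S -> nested (functor_comp vertices G) -> nested (functor_comp edges G) ->
  is_colimit i -> is_colimit (D := functor_comp vertices G) (fun n => gm0 (j n)) ->
  is_colimit (D := functor_comp edges G) (fun n => gm1 (j n)) ->
  is_colimit (D := act_seq) (fun n => act_map (e n)).
Proof.
move=> nS n0 n1 ci c0 c1; have [sE [[pT _ _] nT]] := hET.
apply: (@nested_pullback_colim E P sE _ _ _ act_arity act_edge _ _ _ _
  (fun n => fmap T (i n)) (fun n => gm1 (j n)) (fun n => fmap T (gm0 (j n)))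
  (fmap T q) (dleg (gr1 C)) (pb1 (act C q)) (pb2 (act C q))).
- by move=> m n u; apply: (preserves_monic pT); apply: nS.
- exact: n1.
- by move=> m n u; apply: (preserves_monic pT); apply: n0.
- exact: nT nS ci.
- exact: c1.
- exact: nT n0 c0.
- by move=> n /=; rewrite -!fmapM e.
- by move=> n /=; rewrite gm_d.
- exact: pb_is_pullback.
- by move=> n; rewrite pb1_act_map.
- by move=> n; rewrite pb2_act_map.
Qed.

End ActColimit.

(** With a constant graph, only the object acted upon varies. *)
Section ActColimitConst.
Context (hET : suitable T) (C : K) (S : Functor omega E) (Q : E) (q : Q ~> gr0 C)
  (i : forall n, S n ~> Q) (ci : is_colimit i).

Definition act_leg_seq : NatTrans S (functor_comp vertices (const_seq C)).
Proof.
exists (fun n => q ∘ i n).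
abstract (by move=> m n u; rewrite /= compose_1m -composeA (proj1 ci)).
Defined.

Lemma act_colimit_const : nested S ->
  is_colimit (D := act_seq act_leg_seq) (fun n => act_sub (eq_refl (q ∘ i n))).
Proof.
move=> nS; apply: act_colimit => //.
- by move=> m n u X f g; rewrite /= !compose_1m.
- by move=> m n u X f g; rewrite /= !compose_1m.
- exact (@const_colim E (gr0 C)).
- exact (@const_colim E (apex (gr1 C))).
Qed.

End ActColimitConst.

End Action.

Arguments act {E T} P C {Q} q.

(** * Trees *)

Section Trees.
Context {E : Category} (T : Monad E) (P : PullbackChoice E).
Notation K := (graph_cat T).
Notation act := (act P).
Notation act_map := (act_map P).
Notation act_sub := (act_sub P).

(** A presentation of [Q] as the object of trees with nodes in [C] and leaves in [X]: stage [n]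
    consists of the trees of height less than [n]. *)
Record Stages (C : K) (X Q : E) (q : Q ~> gr0 C) (e : X ~> Q) (s : act C q ~> Q) := {
  stage :> Functor omega E;
  stage_in : forall n, stage n ~> Q;
  stage_nested : nested stage;
  stage_colim : is_colimit stage_in;
  stage_0 : is_initial (stage 0);
  stage_leaf : forall n, X ~> stage (S n);
  stage_node : forall n, act C (q ∘ stage_in n) ~> stage (S n);
  stage_cop : forall n, is_cop (stage_leaf n) (stage_node n);
  stage_in_leaf : forall n, stage_in (S n) ∘ stage_leaf n = e;
  stage_in_node : forall n,
    stage_in (S n) ∘ stage_node n = s ∘ act_sub (eq_refl (q ∘ stage_in n)) }.

Arguments stage_nested {C X Q q e s} _.
Arguments stage_cop {C X Q q e s} _ n.

Record is_tree (C : K) (X Q : E) (x : X ~> gr0 C) (q : Q ~> gr0 C) (e : X ~> Q)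
    (s : act C q ~> Q) : Prop := {
  tree_leaf_leg : q ∘ e = x;
  tree_node_leg : q ∘ s = cleg (gr1 C) ∘ pb2 (act C q);
  tree_stages : inhabited (Stages e s) }.

(** Induction on height. *)
Lemma tree_ext (C : K) (X Q : E) (x : X ~> gr0 C) (q : Q ~> gr0 C) (e : X ~> Q)
    (s : act C q ~> Q) : is_tree x e s ->
  forall (Z : E) (h k : Q ~> Z), h ∘ e = k ∘ e ->
  (forall (Y : E) (y : Y ~> gr0 C) (g : Y ~> Q) (ey : q ∘ g = y), h ∘ g = k ∘ g ->
     h ∘ (s ∘ act_sub ey) = k ∘ (s ∘ act_sub ey)) ->
  h = k.
Proof.
move=> [_ _ [St]] Z h k e0 eS; apply: (colim_ext (stage_colim St)).
elim=> [|n IH]; first exact: initial_ext (stage_0 St) _ _ _.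
apply: (cop_ext (stage_cop St n)); rewrite -!composeA.
  by rewrite stage_in_leaf.
by rewrite stage_in_node; apply: eS.
Qed.

Hypothesis hET : suitable T.
Let sE : suitable_category E := proj1 hET.
Let pT : preserves_pullbacks T := cartesian_functor (suitable_cartesian_monad (proj2 hET)).

Section StagesTheory.
Context (C : K) (X Q : E) (q : Q ~> gr0 C) (e : X ~> Q)
    (s : act C q ~> Q) (St : Stages e s).

Lemma stage_in_monic n : monic (stage_in St n).
Proof. exact: (@suitable_nested_monic _ sE _ _ _ (stage_nested St) (stage_colim St) n). Qed.

Lemma stage_in_step n : stage_in St (S n) ∘ fmap St (step n) = stage_in St n.
Proof. exact: (proj1 (stage_colim St)). Qed.

Lemma stage_leg_step n : q ∘ stage_in St (S n) ∘ fmap St (step n) = q ∘ stage_in St n.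
Proof. by rewrite -composeA stage_in_step. Qed.

Lemma stage_step_leaf n : fmap St (step (S n)) ∘ stage_leaf St n = stage_leaf St (S n).
Proof.
by apply: (@stage_in_monic (S (S n))); rewrite composeA stage_in_step !stage_in_leaf.
Qed.

Lemma stage_step_node n : fmap St (step (S n)) ∘ stage_node St n =
  stage_node St (S n) ∘ act_sub (stage_leg_step n).
Proof.
apply: (@stage_in_monic (S (S n))); rewrite !composeA stage_in_step !stage_in_node.
rewrite -composeA; congr (_ ∘ _); apply: act_ext.
  by rewrite composeA !pb1_act_sub -composeA pb1_act_sub composeA -fmapM stage_in_step.
by rewrite composeA !pb2_act_sub.
Qed.

Lemma node_ext (Z : E) (h k : act C q ~> Z) :
  (forall n, h ∘ act_sub (eq_refl (q ∘ stage_in St n)) =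
     k ∘ act_sub (eq_refl (q ∘ stage_in St n))) -> h = k.
Proof.
exact: (colim_ext (act_colimit_const P hET q (stage_colim St) (stage_nested St))).
Qed.

(** Definition by recursion on height, along a map of graphs. *)
Lemma stages_rec (x : X ~> gr0 C) (D : K) (f : C ~> D) (Z : E) (z0 : Z ~> gr0 D)
    (l : X ~> Z) (z : act D z0 ~> Z) :
  q ∘ e = x -> q ∘ s = cleg (gr1 C) ∘ pb2 (act C q) ->
  z0 ∘ l = gm0 f ∘ x -> z0 ∘ z = cleg (gr1 D) ∘ pb2 (act D z0) ->
  exists (h : Q ~> Z) (eh : z0 ∘ h = gm0 f ∘ q),
    h ∘ e = l /\ h ∘ s = z ∘ act_map eh.
Proof.
move=> qe qs zl zz.
pose part n := {h : St n ~> Z | z0 ∘ h = gm0 f ∘ (q ∘ stage_in St n)}.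
have part0 : part 0.
  apply: constructive_indefinite_description.
  case: (stage_0 St Z) => h _; exists h; exact: initial_ext (stage_0 St) _ _ _.
have partS n (hn : part n) : {h : part (S n) | proj1_sig h ∘ stage_leaf St n = l /\
    proj1_sig h ∘ stage_node St n = z ∘ act_map (proj2_sig hn)}.
  apply: constructive_indefinite_description.
  case: (cop_lift (stage_cop St n) l (z ∘ act_map (proj2_sig hn))) => h [h1 h2].
  have eh : z0 ∘ h = gm0 f ∘ (q ∘ stage_in St (S n)).
    apply: (cop_ext (stage_cop St n)); rewrite -!composeA ?h1 ?h2.
      by rewrite stage_in_leaf qe.
    rewrite stage_in_node composeA zz -composeA pb2_act_map (comp_l qs).
    by rewrite -(composeA (cleg _)) pb2_act_sub !composeA gm_c.
  by exists (exist _ h eh).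
have [hs [ho [hs_leaf hs_node]]] : exists (hs : forall n, St n ~> Z)
    (ho : forall n, z0 ∘ hs n = gm0 f ∘ (q ∘ stage_in St n)),
    (forall n, hs (S n) ∘ stage_leaf St n = l) /\
    (forall n, hs (S n) ∘ stage_node St n = z ∘ act_map (ho n)).
  pose hs : forall n, part n := nat_rect part part0 (fun n hn => proj1_sig (partS n hn)).
  exists (fun n => proj1_sig (hs n)), (fun n => proj2_sig (hs n)).
  by split=> n; case: (proj2_sig (partS n (hs n))).
have hs_step n : hs (S n) ∘ fmap St (step n) = hs n.
  elim: n => [|n IH]; first exact: initial_ext (stage_0 St) _ _ _.
  apply: (cop_ext (stage_cop St n)); rewrite -composeA.
    by rewrite stage_step_leaf !hs_leaf.
  rewrite stage_step_node composeA !hs_node -composeA; congr (_ ∘ _); apply: act_ext.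
    by rewrite composeA !pb1_act_map -composeA pb1_act_sub composeA -fmapM IH.
  by rewrite composeA !pb2_act_map -composeA pb2_act_sub.
have [h hP] := colim_lift (stage_colim St) hs_step.
have eh : z0 ∘ h = gm0 f ∘ q.
  by apply: (colim_ext (stage_colim St)) => n; rewrite -!composeA hP ho.
exists h, eh; split.
  by rewrite -(stage_in_leaf St 0) composeA hP hs_leaf.
apply: node_ext => n.
rewrite -!composeA -stage_in_node composeA hP hs_node; congr (_ ∘ _); apply: act_ext.
  by rewrite composeA !pb1_act_map -composeA pb1_act_sub composeA -fmapM hP.
by rewrite composeA !pb2_act_map -composeA pb2_act_sub.
Qed.

(** The decompositions of the stages into leaves and nodes are compatible, so they pass to the
    colimit. *)
Lemma stages_cop : is_cop e s.
Proof.
apply: cop_intro => [Z u v|Z h k eu ev]; last first.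
  apply: (colim_ext_tail (stage_colim St)) => n.
  apply: (cop_ext (stage_cop St n)); rewrite -!composeA.
    by rewrite stage_in_leaf.
  by rewrite stage_in_node !composeA ev.
have ex n : {h : St n ~> Z | match n return (St n ~> Z) -> Prop with 0 => fun _ => True
   | S m => fun h => h ∘ stage_leaf St m = u /\
       h ∘ stage_node St m = v ∘ act_sub (eq_refl (q ∘ stage_in St m)) end h}.
  apply: constructive_indefinite_description; case: n => [|n].
    by case: (stage_0 St Z) => h _; exists h.
  exact (cop_lift (stage_cop St n) u (v ∘ act_sub (eq_refl (q ∘ stage_in St n)))).
have ex_step n : proj1_sig (ex (S n)) ∘ fmap St (step n) = proj1_sig (ex n).
  case: n => [|n]; first exact: initial_ext (stage_0 St) _ _ _.
  have [l1 n1] := proj2_sig (ex (S n)); have [l2 n2] := proj2_sig (ex (S (S n))).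
  apply: (cop_ext (stage_cop St n)); rewrite -composeA.
    by rewrite stage_step_leaf l1 l2.
  rewrite stage_step_node composeA n1 n2 -composeA; congr (_ ∘ _); apply: act_ext.
    by rewrite composeA !pb1_act_sub -composeA pb1_act_sub composeA -fmapM stage_in_step.
  by rewrite composeA !pb2_act_sub.
have [h hP] := colim_lift (stage_colim St) ex_step; exists h; split.
  by rewrite -(stage_in_leaf St 0) composeA hP; case: (proj2_sig (ex 1)).
apply: node_ext => n.
rewrite -composeA -stage_in_node composeA hP.
by case: (proj2_sig (ex (S n))).
Qed.

End StagesTheory.

Lemma tree_rec (C : K) (X Q : E) (x : X ~> gr0 C) (q : Q ~> gr0 C) (e : X ~> Q)
    (s : act C q ~> Q) : is_tree x e s ->
  forall (D : K) (f : C ~> D) (Z : E) (z0 : Z ~> gr0 D) (l : X ~> Z) (z : act D z0 ~> Z),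
  z0 ∘ l = gm0 f ∘ x -> z0 ∘ z = cleg (gr1 D) ∘ pb2 (act D z0) ->
  exists (h : Q ~> Z) (eh : z0 ∘ h = gm0 f ∘ q), h ∘ e = l /\ h ∘ s = z ∘ act_map eh.
Proof. by move=> [qe qs [St]] D f Z z0 l z; apply: stages_rec. Qed.

Lemma tree_rec_unique (C : K) (X Q : E) (x : X ~> gr0 C) (q : Q ~> gr0 C) (e : X ~> Q)
    (s : act C q ~> Q) : is_tree x e s ->
  forall (D : K) (f : C ~> D) (Z : E) (z0 : Z ~> gr0 D) (z : act D z0 ~> Z) (h k : Q ~> Z)
    (eh : z0 ∘ h = gm0 f ∘ q) (ek : z0 ∘ k = gm0 f ∘ q),
  h ∘ e = k ∘ e -> h ∘ s = z ∘ act_map eh -> k ∘ s = z ∘ act_map ek -> h = k.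
Proof.
move=> tQ D f Z z0 z h k eh ek e0 hs ks; apply: (tree_ext tQ) => // Y y g ey IH.
rewrite (comp_l hs) (comp_l ks) -!composeA; congr (_ ∘ _); apply: act_ext.
  rewrite !(comp_l (pb1_act_map _ _)) -!composeA !pb1_act_sub !composeA -!fmapM.
  by rewrite IH.
by rewrite !(comp_l (pb2_act_map _ _)).
Qed.

Lemma tree_cop (C : K) (X Q : E) (x : X ~> gr0 C) (q : Q ~> gr0 C) (e : X ~> Q)
    (s : act C q ~> Q) : is_tree x e s -> is_cop e s.
Proof. by move=> [_ _ [St]]; apply: stages_cop. Qed.

(** The inverse is defined by recursion; the two composites are identities by induction. *)
Lemma tree_iso (C : K) (X Q Q' : E) (x : X ~> gr0 C) (q : Q ~> gr0 C) (e : X ~> Q)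
    (s : act C q ~> Q) (q' : Q' ~> gr0 C) (e' : X ~> Q') (s' : act C q' ~> Q')
    (k : Q' ~> Q) (ek : q ∘ k = q') :
  is_tree x e s -> is_tree x e' s' -> k ∘ e' = e -> k ∘ s' = s ∘ act_sub ek -> is_iso k.
Proof.
move=> tQ tQ' ke ks.
have [||l [el [le ls]]] := tree_rec tQ (f := idm C) (z0 := q') (l := e') (z := s').
    by rewrite (tree_leaf_leg tQ') /= compose_1m.
  exact: tree_node_leg tQ'.
exists l; split.
  apply: (tree_ext tQ') => [|Y y g ey eg]; first by rewrite -composeA ke le compose_1m.
  rewrite -composeA (comp_l ks) compose_1m -composeA (comp_l ls) -composeA.
  congr (_ ∘ _); apply: act_ext.
    rewrite composeA pb1_act_map -composeA (comp_l (pb1_act_sub P ek)) -composeA pb1_act_sub.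
    by rewrite !composeA -!fmapM eg compose_1m.
  rewrite composeA pb2_act_map /= compose_1m composeA pb2_act_sub.
  by rewrite pb2_act_sub.
apply: (tree_ext tQ) => [|Y y g ey eg]; first by rewrite -composeA le ke compose_1m.
rewrite -composeA (comp_l ls) compose_1m -composeA (comp_l ks) -composeA.
congr (_ ∘ _); apply: act_ext.
  rewrite composeA pb1_act_sub -composeA (comp_l (pb1_act_map P el)) -composeA pb1_act_sub.
  by rewrite !composeA -!fmapM eg compose_1m.
rewrite composeA pb2_act_sub composeA pb2_act_map /= compose_1m.
by rewrite pb2_act_sub.
Qed.

(** The stages of [Q] are the pullbacks of the stages of [R]: the hypotheses make stability
    of coproducts turn the decomposition of each stage of [R] into one of the stage of [Q].
    Objects of trees other than the first one constructed are all recognised in this way. *)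
Lemma tree_pullback (C D : K) (f : C ~> D) (X Y Q R : E) (fx : X ~> Y)
    (x : X ~> gr0 C) (q : Q ~> gr0 C) (e : X ~> Q) (s : act C q ~> Q)
    (y : Y ~> gr0 D) (r : R ~> gr0 D) (e' : Y ~> R) (s' : act D r ~> R)
    (h : Q ~> R) (eh : r ∘ h = gm0 f ∘ q) :
  q ∘ e = x -> q ∘ s = cleg (gr1 C) ∘ pb2 (act C q) ->
  is_pullback h e' e fx -> is_pullback h s' s (act_map eh) ->
  is_tree y e' s' -> is_tree x e s.
Proof.
move=> qe qs pbe pbs [_ _ [St]]; split=> //.
pose hc : NatTrans (const_seq Q) (const_seq R) :=
  {| ntrans := (fun _ => h) : forall n, const_seq Q n ~> const_seq R n;
     ntrans_natural := fun m n u => eq_trans (compose_m1 _) (eq_sym (compose_1m _)) |}.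
have ei (m n : omega) (u : m ~> n) : stage_in St n ∘ fmap St u = idm R ∘ stage_in St m.
  by rewrite compose_1m (proj1 (stage_colim St)).
pose ic : NatTrans St (const_seq R) :=
  {| ntrans := stage_in St : forall n, St n ~> const_seq R n; ntrans_natural := ei |}.
pose Sg := pb_functor P hc ic.
have pbn n : is_pullback h (stage_in St n) (pb1 (P h (stage_in St n)))
    (pb2 (P h (stage_in St n))) := pb_is_pullback _.
have eleaf n : h ∘ e = stage_in St (S n) ∘ (stage_leaf St n ∘ fx).
  by rewrite composeA stage_in_leaf (proj1 pbe).
have eleg n : (r ∘ stage_in St n) ∘ pb2 (P h (stage_in St n)) =
    gm0 f ∘ (q ∘ pb1 (P h (stage_in St n))).
  by rewrite -composeA -pb_comm !composeA eh.
have enode n : h ∘ (s ∘ act_sub (eq_refl (q ∘ pb1 (P h (stage_in St n))))) =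
    stage_in St (S n) ∘ (stage_node St n ∘ act_map (eleg n)).
  rewrite !composeA stage_in_node (proj1 pbs) -!composeA; congr (_ ∘ _); apply: act_ext.
    rewrite !composeA pb1_act_map pb1_act_sub -!composeA pb1_act_sub pb1_act_map.
    by rewrite !composeA -!fmapM pb_comm.
  by rewrite !composeA pb2_act_map !pb2_act_sub -composeA pb2_act_sub pb2_act_map.
unshelve refine (inhabits (@Build_Stages _ _ _ _ e s Sg (fun n => pb1 (P h (stage_in St n)))
  _ _ _ (fun n => pb_pair (P h (stage_in St (S n))) _ _ (eleaf n))
        (fun n => pb_pair (P h (stage_in St (S n))) _ _ (enode n)) _ _ _)).
- apply: nested_step => n; apply: (@monic_cancel _ _ _ _ (pb1 (P h (stage_in St (S n))))).
  rewrite /= pb1_pair compose_1m; apply: monic_pullback (pbn n) _; exact: stage_in_monic.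
- apply: (nested_pullback_colim sE (f := h) (g := idm R) (p := idm Q) (q := h)
    (@const_nested _ Q) (stage_nested St) (@const_nested _ R) (const_colim Q)
    (stage_colim St) (const_colim R)).
  + by move=> n; rewrite /= compose_1m compose_m1.
  + by move=> n; rewrite compose_1m.
  + apply: pb_sq_sym; exact: pb_sq_id.
  + by [].
  + by move=> n; rewrite /= pb_comm.
- exact (initial_strict sE (pb2 (P h (stage_in St 0))) (stage_0 St)).
- move=> n.
  apply: (cop_stable sE (f := pb2 (P h (stage_in St (S n)))) (q := fx)
            (q' := act_map (eleg n)) (stage_cop St n)).
    apply: pb_sq_sym; apply: (pb_sq_cancel (pb_sq_sym (pbn (S n)))); rewrite ?pb2_pair //.
    by rewrite pb1_pair stage_in_leaf; apply: pb_sq_sym.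
  apply: pb_sq_sym; apply: (pb_sq_cancel (pb_sq_sym (pbn (S n)))); rewrite ?pb2_pair //.
  rewrite pb1_pair stage_in_node; apply: pb_sq_paste (pb_sq_sym pbs).
  apply: act_pullback => //=; [exact: pb_sq_id|exact: pb_sq_id|apply: pb_sq_sym; exact: pbn].
- by move=> n; rewrite pb1_pair.
- by move=> n; rewrite pb1_pair.
Qed.

End Trees.

(** * Existence of objects of trees *)

Section TreeExists.
Context {E : Category} (T : Monad E) (P : PullbackChoice E) (hET : suitable T).
Notation K := (graph_cat T).
Notation act := (act P).
Notation act_map := (act_map P).
Notation act_sub := (act_sub P).
Let sE : suitable_category E := proj1 hET.
Let pT : preserves_pullbacks T := cartesian_functor (suitable_cartesian_monad (proj2 hET)).

Context (C : K) (X : E) (x : X ~> gr0 C).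

Record Over := { over_obj :> E; over_leg : over_obj ~> gr0 C }.

Record NextStage (o : Over) := {
  next : Over;
  next_leaf : X ~> next;
  next_node : act C (over_leg o) ~> next;
  next_cop : is_cop next_leaf next_node;
  next_leaf_leg : over_leg next ∘ next_leaf = x;
  next_node_leg : over_leg next ∘ next_node = cleg (gr1 C) ∘ pb2 (act C (over_leg o)) }.

Lemma next_stage (o : Over) : inhabited (NextStage o).
Proof.
have [S [a [b ab]]] := cop_exists sE X (act C (over_leg o)).
have [l [l1 l2]] := cop_lift ab x (cleg (gr1 C) ∘ pb2 (act C (over_leg o))).
exact: (inhabits (@Build_NextStage o {| over_leg := l |} a b ab l1 l2)).
Qed.

(** The initial algebra of [X + C_1 ∘ -] as the colimit of its iterates on the initial object. *)
Lemma tree_exists : exists (Q : E) (q : Q ~> gr0 C) (e : X ~> Q) (s : act C q ~> Q),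
  is_tree x e s.
Proof.
have nx (o : Over) : NextStage o.
  have ex : exists n : NextStage o, True by case: (next_stage o) => n; exists n.
  exact: (proj1_sig (constructive_indefinite_description _ ex)).
have [Z iZ] := initial_exists sE; have [z _] := iZ (gr0 C).
pose st := nat_rect (fun _ => Over) {| over_leg := z |} (fun _ o => next (nx o)).
pose lf n : X ~> st (S n) := next_leaf (nx (st n)).
pose nd n : act C (over_leg (st n)) ~> st (S n) := next_node (nx (st n)).
have cp n : is_cop (lf n) (nd n) := next_cop _.
have lf_leg n : over_leg (st (S n)) ∘ lf n = x := next_leaf_leg _.
have nd_leg n : over_leg (st (S n)) ∘ nd n = cleg (gr1 C) ∘ pb2 (act C (over_leg (st n))) :=
  next_node_leg _.
have [u [ul [u_lf u_nd]]] : exists (u : forall n, st n ~> st (S n))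
    (ul : forall n, over_leg (st (S n)) ∘ u n = over_leg (st n)),
    (forall n, u (S n) ∘ lf n = lf (S n)) /\
    (forall n, u (S n) ∘ nd n = nd (S n) ∘ act_sub (ul n)).
  pose U n := {u : st n ~> st (S n) | over_leg (st (S n)) ∘ u = over_leg (st n)}.
  have u0 : U 0.
    apply: constructive_indefinite_description; case: (iZ (st 1)) => u _.
    by exists u; exact: initial_ext iZ _ _ _.
  have uS n (un : U n) : {u : U (S n) | proj1_sig u ∘ lf n = lf (S n) /\
      proj1_sig u ∘ nd n = nd (S n) ∘ act_sub (proj2_sig un)}.
    apply: constructive_indefinite_description.
    case: (cop_lift (cp n) (lf (S n)) (nd (S n) ∘ act_sub (proj2_sig un))) => v [v1 v2].
    have vl : over_leg (st (S (S n))) ∘ v = over_leg (st (S n)).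
      apply: (cop_ext (cp n)); rewrite -composeA ?v1 ?v2.
        by rewrite !lf_leg.
      by rewrite composeA !nd_leg -composeA pb2_act_sub.
    by exists (exist _ v vl).
  pose us : forall n, U n := nat_rect U u0 (fun n un => proj1_sig (uS n un)).
  exists (fun n => proj1_sig (us n)), (fun n => proj2_sig (us n)).
  by split=> n; case: (proj2_sig (uS n (us n))).
(* The sequence is nested: [act C] preserves monics, and so do sums. *)
have mono n : monic (u n).
{ elim: n => [|n IH]; first exact: initial_monic sE _ _ _ iZ.
  apply: (cop_monic_sum sE P (u := idm X) (v := act_sub (ul n)) (cp n) (cp (S n))).
  + by rewrite compose_m1 u_lf.
  + by rewrite u_nd.
  + by move=> Y f g; rewrite !compose_1m.
  + exact: act_sub_monic. }
pose A := chain u.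
have nA : nested A.
  apply: nested_step => n; rewrite (chain_step u).
  exact: mono.
have [Q [i ci]] := suitable_nested sE nA.
have iu n : i (S n) ∘ u n = i n by rewrite -(proj1 ci _ _ (step n)) -/A chain_step.
have [q qi] : exists q : Q ~> gr0 C, forall n, q ∘ i n = over_leg (st n).
  by apply: (colim_lift ci) => n; rewrite (chain_step u) ul.
(* The leg of a stage equals the restriction of [q] only propositionally; acting by an identity
   over this equation passes from one to the other. *)
have conv n : over_leg (st n) ∘ idm _ = q ∘ i n by rewrite compose_m1 qi.
have conv' n : q ∘ i n ∘ idm _ = over_leg (st n) by rewrite compose_m1 qi.
pose nd' n : act C (q ∘ i n) ~> st (S n) := nd n ∘ act_sub (conv n).
have cA := act_colimit_const P hET q ci nA.
have [s sP] : exists s : act C q ~> Q, forall n,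
    s ∘ act_sub (eq_refl (q ∘ i n)) = i (S n) ∘ nd' n.
  apply: (colim_lift cA) => n.
  transitivity (i (S (S n)) ∘ (u (S n) ∘ nd' n)); last by rewrite composeA iu.
  rewrite -composeA; congr (_ ∘ _); rewrite /nd' (comp_l (u_nd n)) -!composeA; congr (_ ∘ _).
  apply: act_ext.
    rewrite !composeA !pb1_act_sub -!composeA pb1_act_sub.
    rewrite (pb1_act_seq P (act_leg_seq q ci)) (chain_step u) !composeA -!fmapM.
    by rewrite compose_1m compose_m1.
  rewrite !composeA !pb2_act_sub (pb2_act_seq P (act_leg_seq q ci)).
  by rewrite /= compose_1m.
have e_eq n : i (S n) ∘ lf n = i 1 ∘ lf 0.
  by elim: n => // n <-; rewrite -(iu (S n)) -composeA u_lf.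
exists Q, q, (i 1 ∘ lf 0), s; split.
- by rewrite composeA qi lf_leg.
- apply: (colim_ext cA) => n.
  rewrite -!composeA sP (comp_l (qi (S n))) /nd' (comp_l (nd_leg n)).
  by rewrite -!composeA !pb2_act_sub.
- apply: inhabits; apply: (@Build_Stages _ _ _ _ _ _ _ _ _ A i nA ci iZ lf nd') => //.
  move=> n; apply: cop_intro => [Y v w|Y h k e1 e2].
    case: (cop_lift (cp n) v (w ∘ act_sub (conv' n))) => h [h1 h2]; exists h; split=> //.
    rewrite /nd' composeA h2 -composeA -[RHS]compose_m1; congr (_ ∘ _).
    apply: act_ext; rewrite composeA ?pb1_act_sub ?pb2_act_sub -?composeA
      ?pb1_act_sub ?pb2_act_sub compose_m1 //.
    by rewrite !fmap1 !compose_1m.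
  apply: (cop_ext (cp n)) => //.
  have eid : nd n = nd' n ∘ act_sub (conv' n).
    rewrite /nd' -composeA -[LHS]compose_m1; congr (_ ∘ _).
    apply: act_ext; rewrite composeA ?pb1_act_sub ?pb2_act_sub -?composeA
      ?pb1_act_sub ?pb2_act_sub compose_m1 //.
    by rewrite !fmap1 !compose_1m.
  by rewrite eid (comp_l e2) -composeA.
Qed.

End TreeExists.

(** * The free multicategory on a graph *)

Section FreeTree.
Context {E : Category} (T : Monad E) (P : PullbackChoice E) (hET : suitable T).
Notation K := (graph_cat T).
Notation act := (act P).
Notation act_map := (act_map P).
Notation act_sub := (act_sub P).

Lemma terminal_exists : exists I : E, forall X : E, exists! h : X ~> I, True.
Proof.
pose V : Category := {| Obj := False; Hom := fun _ _ => False;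
  idm := fun a => match a with end;
  compose := fun a _ _ _ _ => match a with end;
  compose_1m := fun a => match a with end;
  compose_m1 := fun a => match a with end;
  composeA := fun a => match a with end |}.
have D : Functor V E.
  by exists (fun a : V => match a with end) (fun a : V => match a with end); case.
have fV : finite_category V by split; [exists nil|case].
have [I [p [_ univ]]] := suitable_cartesian (proj1 hET) D fV.
exists I => X; case: (univ X (fun j : V => match j with end)) => [[]|h [_ uni]].
by exists h; split=> // k _; apply: uni => -[].
Qed.

Record FreeTree (C : K) := {
  ft :> E;
  ft_d : ft ~> T (gr0 C);
  ft_c : ft ~> gr0 C;
  ft_leaf : gr0 C ~> ft;
  ft_node : act C ft_c ~> ft;
  ft_tree : is_tree (idm (gr0 C)) ft_leaf ft_node;
  ft_d_leaf : ft_d ∘ ft_leaf = eta T (gr0 C);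
  ft_d_node : ft_d ∘ ft_node = mu T (gr0 C) ∘ (fmap T ft_d ∘ pb1 (act C ft_c)) }.

(** The arity of a tree, its family of leaves, is computed by recursion along the unique map
    to the terminal graph, whose algebras include those of [T]. *)
Lemma free_tree_exists (C : K) : inhabited (FreeTree C).
Proof.
have [A [c [e [s tA]]]] := tree_exists P hET (idm (gr0 C)).
have [I tI] := terminal_exists.
pose bang X : X ~> I := proj1_sig (constructive_indefinite_description _ (tI X)).
have bang_ext X (h k : X ~> I) : h = k.
  by have [l [_ uni]] := tI X; rewrite -(uni h) // -(uni k).
pose D : K := {| gr0 := I; gr1 := {| apex := T I; dleg := idm (T I); cleg := bang (T I) |} |}.
have fd : dleg (gr1 D) ∘ (fmap T (bang (gr0 C)) ∘ dleg (gr1 C)) =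
    fmap T (bang (gr0 C)) ∘ dleg (gr1 C) by rewrite /= compose_1m.
pose f : C ~> D := @Build_GraphMap _ _ C D (bang (gr0 C)) _ fd (bang_ext _ _ _).
have [||d [ed [d_leaf d_node]]] := tree_rec hET tA (f := f) (z0 := bang (T (gr0 C)))
  (l := eta T (gr0 C)) (z := mu T (gr0 C) ∘ pb1 (act D (bang (T (gr0 C))))).
    exact: bang_ext.
  exact: bang_ext.
apply: inhabits; apply: (@Build_FreeTree C A d c e s tA d_leaf).
by rewrite d_node -composeA pb1_act_map.
Qed.

Definition free_tree (C : K) : FreeTree C.
Proof.
have ex : exists n : FreeTree C, True by case: (free_tree_exists C) => n; exists n.
exact: (proj1_sig (constructive_indefinite_description _ ex)).
Qed.

Definition free_graph (C : K) : K := {| gr0 := gr0 C;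
  gr1 := {| apex := free_tree C; dleg := ft_d (free_tree C); cleg := ft_c (free_tree C) |} |}.

(** Composing the span of trees on [C] with [x] labels the leaves of the trees by elements of [X];
    the result is the object of trees with leaves in [X]. *)
Section Forest.
Context (C : K).
Let FC : K := free_graph C.
Let A : E := free_tree C.
Notation d := (ft_d (free_tree C)).
Notation c := (ft_c (free_tree C)).
Notation leaf := (ft_leaf (free_tree C)).
Notation node := (ft_node (free_tree C)).
Let tA := ft_tree (free_tree C).

Lemma leaf_leg : c ∘ leaf = idm (gr0 C).
Proof. exact: tree_leaf_leg tA. Qed.

Lemma node_leg : c ∘ node = cleg (gr1 C) ∘ pb2 (act C c).
Proof. exact: tree_node_leg tA. Qed.

Context (X : E) (x : X ~> gr0 C).

Definition forest_leg : act FC x ~> gr0 C := c ∘ pb2 (act FC x).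

Lemma forest_leaf_proof : fmap T x ∘ eta T X = d ∘ (leaf ∘ x).
Proof. by rewrite composeA ft_d_leaf eta_natural. Qed.

Definition forest_leaf : X ~> act FC x := pb_pair (act FC x) _ _ forest_leaf_proof.

Lemma forest_node_proof :
  fmap T x ∘ (mu T X ∘ (fmap T (pb1 (act FC x)) ∘ pb1 (act C forest_leg))) =
  d ∘ (node ∘ act_sub (eq_refl forest_leg)).
Proof.
rewrite !composeA ft_d_node -!composeA pb1_act_sub (comp_l (eq_sym (mu_natural T x))).
rewrite -composeA; congr (_ ∘ _).
by rewrite !composeA -!fmapM pb_comm.
Qed.

(** On leaves the labellings of the branches are concatenated by [mu]; on trees a node is added
    below the branches. *)
Definition forest_node : act C forest_leg ~> act FC x :=
  pb_pair (act FC x) _ _ forest_node_proof.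

Lemma pb1_forest_leaf : pb1 (act FC x) ∘ forest_leaf = eta T X.
Proof. exact: pb1_pair. Qed.

Lemma pb2_forest_leaf : pb2 (act FC x) ∘ forest_leaf = leaf ∘ x.
Proof. exact: pb2_pair. Qed.

Lemma pb1_forest_node : pb1 (act FC x) ∘ forest_node =
  mu T X ∘ (fmap T (pb1 (act FC x)) ∘ pb1 (act C forest_leg)).
Proof. exact: pb1_pair. Qed.

Lemma pb2_forest_node : pb2 (act FC x) ∘ forest_node = node ∘ act_sub (eq_refl forest_leg).
Proof. exact: pb2_pair. Qed.

(** By [tree_pullback] over the trees on [C] themselves: pasted with the pullback defining
    [act (free_graph C) x], the two squares to be checked become naturality squares of [eta]
    and [mu]. *)
Lemma forest_tree : is_tree x forest_leaf forest_node.
Proof.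
have [cT _] := proj2 hET; have pT := cartesian_functor cT.
have pbF : is_pullback (ft_d (free_tree C)) (fmap T x) (pb2 (act FC x)) (pb1 (act FC x)).
  by apply: pb_sq_sym; exact: (pb_is_pullback (act FC x)).
have eS : node ∘ act_sub (eq_refl forest_leg) = pb2 (act FC x) ∘ forest_node.
  by rewrite pb2_forest_node.
apply: (tree_pullback hET (f := idm C) (fx := x) (y := idm (gr0 C)) (h := pb2 (act FC x))
  (eh := over_idm (eq_refl forest_leg)) _ _ _ _ tA).
- by rewrite /forest_leg -composeA pb2_forest_leaf composeA leaf_leg compose_1m.
- by rewrite /forest_leg -composeA pb2_forest_node composeA node_leg -composeA pb2_act_sub.
- apply: pb_sq_sym; apply: (pb_sq_cancel pbF); first by rewrite pb2_forest_leaf.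
  rewrite ft_d_leaf pb1_forest_leaf.
  exact: cartesian_eta cT _ _ _.
- apply: pb_sq_sym; apply: (pb_sq_cancel pbF) => //.
  rewrite ft_d_node pb1_forest_node.
  apply: (pb_sq_paste (g1 := fmap T (fmap T x))); last exact: cartesian_mu cT _ _ _.
  apply: (pb_sq_paste (g1 := fmap T (pb2 (act FC x)))).
  { apply: pb_sq_intro.
    + by rewrite pb1_act_sub.
    + move=> Y u v e.
      have ev : fmap T forest_leg ∘ v = dleg (gr1 C) ∘ (pb2 (act C c) ∘ u).
        by rewrite composeA -pb_comm -composeA e composeA -fmapM.
      exists (pb_pair (act C forest_leg) v _ ev); rewrite pb1_pair; split=> //.
      by apply: act_ext; rewrite composeA ?pb1_act_sub ?pb2_act_sub -?composeA
        ?pb1_pair ?pb2_pair.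
    + move=> Y u v e1 e2; apply: act_ext => //.
      by rewrite -!(pb2_act_sub P (eq_refl forest_leg)) -!composeA e1. }
  exact: pT pbF.
Qed.

End Forest.

Section ForestSub.
Context {C : K} {X Y : E} {x : X ~> gr0 C} {y : Y ~> gr0 C} {h : X ~> Y} (e : y ∘ h = x).
Let FC : K := free_graph C.

Definition forest_sub : act FC x ~> act FC y.
Proof. refine (act_sub _); exact: e. Defined.

Lemma pb1_forest_sub : pb1 (act FC y) ∘ forest_sub = fmap T h ∘ pb1 (act FC x).
Proof. exact: pb1_act_sub. Qed.

Lemma pb2_forest_sub : pb2 (act FC y) ∘ forest_sub = pb2 (act FC x).
Proof. exact: pb2_act_sub. Qed.

Lemma forest_leaf_natural : forest_sub ∘ forest_leaf x = forest_leaf y ∘ h.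
Proof.
apply: act_ext; rewrite composeA ?pb1_forest_sub ?pb2_forest_sub.
  by rewrite -composeA !pb1_forest_leaf composeA pb1_forest_leaf eta_natural.
by rewrite !pb2_forest_leaf composeA pb2_forest_leaf -e composeA.
Qed.

Lemma forest_leg_sub : forest_leg y ∘ forest_sub = forest_leg x.
Proof. by rewrite /forest_leg -composeA pb2_forest_sub. Qed.

End ForestSub.

(** ** Grafting *)

Section Grafting.
Context (C : K).
Let FC : K := free_graph C.
Notation d := (ft_d (free_tree C)).
Notation c := (ft_c (free_tree C)).
Notation leaf := (ft_leaf (free_tree C)).
Notation node := (ft_node (free_tree C)).

(** Composition of trees, by recursion on the lower tree: its leaves are replaced by the trees that
    label them, and its nodes are kept. *)
Lemma graft_exists : exists (g : act FC c ~> free_tree C) (e : c ∘ g = forest_leg c),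
  g ∘ forest_leaf c = idm (free_tree C) /\ g ∘ forest_node c = node ∘ act_sub e.
Proof.
have [||g [eg [gl gn]]] := tree_rec hET (forest_tree c) (f := idm C) (z0 := c)
  (l := idm (free_tree C)) (z := node).
    by rewrite compose_1m compose_m1.
  exact: node_leg.
have e : c ∘ g = forest_leg c by rewrite eg compose_1m.
exists g, e; split=> //; rewrite gn; congr (_ ∘ _).
by apply: act_map_irr.
Qed.

Definition graft : act FC c ~> free_tree C :=
  proj1_sig (constructive_indefinite_description _ graft_exists).

Lemma graft_leg : c ∘ graft = c ∘ pb2 (act FC c).
Proof.
by rewrite /graft; case: constructive_indefinite_description => g [].
Qed.

Lemma graft_leaf : graft ∘ forest_leaf c = idm (free_tree C).
Proof.
by rewrite /graft; case: constructive_indefinite_description => g [? []].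
Qed.

Lemma graft_node : graft ∘ forest_node c = node ∘ act_sub graft_leg.
Proof.
move: graft_leg; rewrite /graft; case: constructive_indefinite_description => g [e [_ gn]] /= e'.
by rewrite gn; congr (_ ∘ _); apply: act_map_irr.
Qed.

Lemma graft_d : d ∘ graft = mu T (gr0 C) ∘ (fmap T d ∘ pb1 (act FC c)).
Proof.
apply: (tree_ext (forest_tree c)) => [|Y y g ey IH].
  rewrite -composeA graft_leaf compose_m1 -!composeA pb1_forest_leaf.
  by rewrite -eta_natural composeA mu_eta compose_1m.
rewrite -!composeA (comp_l graft_node) -composeA (comp_l (ft_d_node _)).
rewrite (comp_l (pb1_forest_node _)) -!composeA (comp_l (pb1_act_sub P _)) !pb1_act_sub.
rewrite -(composeA (fmap T graft)) pb1_act_sub.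
rewrite (comp_l (eq_sym (mu_natural T d))) -!composeA.
transitivity (mu T (gr0 C) ∘ (fmap T (d ∘ graft ∘ g) ∘ pb1 (act C y))).
  by rewrite !fmapM -!composeA.
by rewrite IH !fmapM -!composeA (comp_l (mu_mu T _)) -!composeA.
Qed.

End Grafting.

End FreeTree.

(** * The monad laws of a multicategory on generalized elements *)

Section MulticatLaws.
Context {E : Category} (T : Monad E) (P : PullbackChoice E) (M : Multicat T P).
Notation K := (graph_cat T).
Notation MM := (act P (M : K) (cleg (gr1 M))).

Definition mcomp : MM ~> apex (gr1 M) := mc_comp M.
Definition mids : gr0 M ~> apex (gr1 M) := mc_ids M.

Lemma mcomp_d : dleg (gr1 M) ∘ mcomp = mu T (gr0 M) ∘ (fmap T (dleg (gr1 M)) ∘ pb1 MM).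
Proof. by rewrite composeA; exact: (smap_d (mc_comp M)). Qed.

Lemma mcomp_c : cleg (gr1 M) ∘ mcomp = cleg (gr1 M) ∘ pb2 MM.
Proof. exact: (smap_c (mc_comp M)). Qed.

Lemma mids_d : dleg (gr1 M) ∘ mids = eta T (gr0 M).
Proof. exact: (smap_d (mc_ids M)). Qed.

Lemma mids_c : cleg (gr1 M) ∘ mids = idm (gr0 M).
Proof. exact: (smap_c (mc_ids M)). Qed.

(** [w] is a family of composable pairs indexed by the inputs of one further edge. Composing the
    pairs first gives [t1]; [t3] is the lower pair, and composing it first gives [t2]. *)
Lemma mcomp_assoc (W : E) (w : W ~> T MM) (t1 t2 t3 : W ~> MM) :
  pb1 MM ∘ t1 = fmap T mcomp ∘ w -> pb1 MM ∘ t3 = fmap T (pb2 MM) ∘ w ->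
  pb1 MM ∘ t2 = mu T (apex (gr1 M)) ∘ (fmap T (pb1 MM) ∘ w) ->
  pb2 MM ∘ t3 = pb2 MM ∘ t1 -> pb2 MM ∘ t2 = mcomp ∘ t3 -> mcomp ∘ t1 = mcomp ∘ t2.
Proof.
move=> e1 e3 e2 f3 f2.
pose M3 := span_pb P (gr1 M) (span_comp P (gr1 M) (gr1 M)).
have e : fmap T (cleg (gr1 M) ∘ pb2 MM) ∘ w = dleg (gr1 M) ∘ (pb2 MM ∘ t1).
  by rewrite fmapM -composeA -e3 composeA pb_comm -composeA f3.
pose u := pb_pair M3 _ _ e.
have u1 : pb1 M3 ∘ u = w by exact: pb1_pair.
have u2 : pb2 M3 ∘ u = pb2 MM ∘ t1 by exact: pb2_pair.
have := f_equal (fun z => z ∘ u) (mc_assoc M); rewrite -!composeA.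
have -> : span_hcomp P (span_idm (gr1 M)) (mc_comp M) ∘ u = t1.
  apply: (@act_ext _ _ P M); rewrite /= /span_comp_map.
    by rewrite pb1_pair_l -composeA -/M3 u1 e1.
  by rewrite pb2_pair_l -composeA -/M3 u2 compose_1m.
move=> ->; congr (_ ∘ _).
apply: (@act_ext _ _ P M); rewrite /= /span_comp_map.
  rewrite pb1_pair_l fmap1 compose_1m pb1_pair_l e2 -!composeA.
  by rewrite -/M3 u1.
rewrite pb2_pair_l f2 -[LHS]composeA; congr (_ ∘ _).
rewrite pb2_pair_l.
apply: (@act_ext _ _ P M).
  by rewrite pb1_pair_l e3 -composeA -/M3 u1.
by rewrite pb2_pair_l f3 -/M3 u2.
Qed.

Lemma mcomp_unitl (W : E) (a : W ~> apex (gr1 M)) (t : W ~> MM) :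
  pb1 MM ∘ t = eta T (apex (gr1 M)) ∘ a -> pb2 MM ∘ t = mids ∘ (cleg (gr1 M) ∘ a) ->
  mcomp ∘ t = a.
Proof.
move=> e1 e2; rewrite -[RHS]compose_1m -(mc_unitl M) -!composeA; congr (_ ∘ _).
apply: (@act_ext _ _ P M); rewrite /= /span_comp_map.
  by rewrite pb1_pair_l -composeA pb1_pair_l fmap1 compose_1m.
by rewrite pb2_pair_l -composeA pb2_pair_l.
Qed.

Lemma mcomp_unitr (W : E) (a : W ~> apex (gr1 M)) (t : W ~> MM) :
  pb1 MM ∘ t = fmap T mids ∘ (dleg (gr1 M) ∘ a) -> pb2 MM ∘ t = a ->
  mcomp ∘ t = a.
Proof.
move=> e1 e2; rewrite -[RHS]compose_1m -(mc_unitr M) -!composeA; congr (_ ∘ _).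
apply: (@act_ext _ _ P M); rewrite /= /span_comp_map.
  by rewrite pb1_pair_l -composeA pb1_pair_l.
by rewrite pb2_pair_l -composeA pb2_pair_l !compose_1m.
Qed.

End MulticatLaws.

(** * The multicategory of trees *)

Section FreeMulticat.
Context {E : Category} (T : Monad E) (P : PullbackChoice E) (hET : suitable T).
Notation K := (graph_cat T).
Notation act := (act P).
Notation act_map := (act_map P).
Notation act_sub := (act_sub P).
Notation free_graph := (free_graph P hET).
Notation forest_leg := (forest_leg P hET).
Notation forest_leaf := (forest_leaf P hET).
Notation forest_node := (forest_node P hET).
Notation forest_sub := (forest_sub P hET).
Notation d C := (ft_d (free_tree P hET C)).
Notation c C := (ft_c (free_tree P hET C)).
Notation leaf C := (ft_leaf (free_tree P hET C)).
Notation node C := (ft_node (free_tree P hET C)).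
Notation graft := (graft P hET).

Section Structure.
Context (C : K).
Let FC : K := free_graph C.
Let A : E := free_tree P hET C.
Notation d := (d C).
Notation c := (c C).
Notation leaf := (leaf C).
Notation node := (node C).
Notation graft := (graft C).
Notation AA := (act FC c).

Lemma act_sub_comp (X Y Z : E) (x : X ~> gr0 C) (y : Y ~> gr0 C) (z : Z ~> gr0 C)
    (g : X ~> Y) (h : Y ~> Z) (eg : y ∘ g = x) (eh : z ∘ h = y) (e : z ∘ (h ∘ g) = x) :
  act_sub eh ∘ act_sub eg = act_sub e.
Proof.
apply: act_ext; rewrite composeA ?pb1_act_sub ?pb2_act_sub -?composeA
  ?pb1_act_sub ?pb2_act_sub //.
by rewrite fmapM composeA.
Qed.

Definition free_ids : SpanMap (span_id T (gr0 C)) (gr1 FC).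
Proof.
exists leaf.
- abstract (exact: ft_d_leaf).
- abstract (exact: leaf_leg).
Defined.

Definition free_comp : SpanMap (span_comp P (gr1 FC) (gr1 FC)) (gr1 FC).
Proof.
exists graft.
- abstract (by rewrite /= graft_d composeA).
- abstract (exact: graft_leg).
Defined.

Lemma graft_node_sub (Y : E) (y : Y ~> gr0 C) (g : Y ~> AA) (ey : forest_leg c ∘ g = y)
    (ey' : c ∘ (graft ∘ g) = y) :
  graft ∘ (forest_node c ∘ act_sub ey) = node ∘ act_sub ey'.
Proof.
by rewrite (comp_l (graft_node _ _ _)) -composeA (act_sub_comp _ _ ey').
Qed.

Lemma forest_sub_node (X Z : E) (x : X ~> gr0 C) (z : Z ~> gr0 C) (g : X ~> Z) (e : z ∘ g = x)
    (Y : E) (y : Y ~> gr0 C) (k : Y ~> act FC x) (ey : forest_leg x ∘ k = y)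
    (ey' : forest_leg z ∘ (forest_sub e ∘ k) = y) :
  forest_sub e ∘ (forest_node x ∘ act_sub ey) = forest_node z ∘ act_sub ey'.
Proof.
apply: (@act_ext _ _ P FC).
  rewrite (comp_l (pb1_forest_sub _ _ _)) -composeA (comp_l (pb1_forest_node _ _ _)) -!composeA.
  rewrite (comp_l (pb1_forest_node _ _ _)) -!composeA !pb1_act_sub.
  rewrite (comp_l (eq_sym (mu_natural _ _))) -!composeA; congr (_ ∘ _).
  by rewrite !composeA -!fmapM !composeA pb1_forest_sub fmapM.
rewrite (comp_l (pb2_forest_sub _ _ _)) !(comp_l (pb2_forest_node _ _ _)) -!composeA.
congr (_ ∘ _).
apply: act_ext.
  rewrite !(comp_l (pb1_act_sub _ _)) -!composeA !pb1_act_sub !composeA -!fmapM.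
  by rewrite composeA pb2_forest_sub.
by rewrite !(comp_l (pb2_act_sub _ _)) !pb2_act_sub.
Qed.

(** Both sides send nodes to nodes, as maps out of the object of trees whose leaves are labelled by
    composable pairs, and they agree on leaves. *)
Lemma graft_assoc (k : act FC (forest_leg c) ~> AA) :
  pb1 AA ∘ k = mu T A ∘ (fmap T (pb1 AA) ∘ pb1 (act FC (forest_leg c))) ->
  pb2 AA ∘ k = graft ∘ forest_sub (eq_refl (forest_leg c)) ->
  graft ∘ forest_sub (graft_leg P hET C) = graft ∘ k.
Proof.
move=> k1 k2.
have kleg : forest_leg c ∘ k = forest_leg (forest_leg c).
  by rewrite -composeA k2 composeA graft_leg -composeA pb2_forest_sub.
apply: (tree_ext (forest_tree P hET (forest_leg c))) => [|Y y g ey IH].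
  rewrite -composeA forest_leaf_natural composeA graft_leaf compose_1m -composeA.
  rewrite -[LHS]compose_m1; congr (_ ∘ _).
  apply: (@act_ext _ _ P FC); rewrite composeA ?k1 ?k2 -!composeA compose_m1.
    by rewrite pb1_forest_leaf -eta_natural composeA mu_eta compose_1m.
  by rewrite forest_leaf_natural composeA graft_leaf compose_1m.
have e1 : forest_leg c ∘ (forest_sub (graft_leg P hET C) ∘ g) = y.
  by rewrite composeA forest_leg_sub.
have e2 : c ∘ (graft ∘ (forest_sub (graft_leg P hET C) ∘ g)) = y.
  by rewrite composeA graft_leg.
have e3 : forest_leg c ∘ (k ∘ g) = y by rewrite composeA kleg.
have e4 : c ∘ (graft ∘ (k ∘ g)) = y by rewrite composeA graft_leg.
have e5 : forest_leg c ∘ (forest_sub (eq_refl (forest_leg c)) ∘ g) = y.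
  by rewrite composeA forest_leg_sub.
have e6 : c ∘ (graft ∘ (forest_sub (eq_refl (forest_leg c)) ∘ g)) = y.
  by rewrite composeA graft_leg.
have -> : graft ∘ forest_sub (graft_leg P hET C) ∘ (forest_node (forest_leg c) ∘ act_sub ey) =
    node ∘ act_sub e2.
  by rewrite -composeA (forest_sub_node _ e1) (graft_node_sub _ e2).
have -> : graft ∘ k ∘ (forest_node (forest_leg c) ∘ act_sub ey) = node ∘ act_sub e4.
  rewrite -composeA -(graft_node_sub e3); congr (_ ∘ _).
  apply: (@act_ext _ _ P FC).
    rewrite (comp_l k1) -!composeA (comp_l (pb1_forest_node _ _ _)).
    rewrite (comp_l (pb1_forest_node _ _ _)) -!composeA !pb1_act_sub.
    rewrite (comp_l (eq_sym (mu_natural _ _))) -!composeA (comp_l (mu_mu _ _)) -!composeA.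
    by congr (_ ∘ _); rewrite !composeA -!fmapM !composeA k1 !composeA.
  rewrite (comp_l k2) -composeA (forest_sub_node _ e5) (graft_node_sub _ e6).
  rewrite (comp_l (pb2_forest_node _ _ _)) -composeA; congr (_ ∘ _).
  apply: act_ext.
    rewrite (comp_l (pb1_act_sub _ _)) -composeA !pb1_act_sub !composeA -!fmapM.
    by rewrite !composeA k2.
  by rewrite (comp_l (pb2_act_sub _ _)) !pb2_act_sub.
by congr (_ ∘ _); apply: act_map_irr; rewrite !composeA.
Qed.

Lemma graft_unitr (k : A ~> AA) :
  pb1 AA ∘ k = fmap T leaf ∘ d -> pb2 AA ∘ k = idm A -> graft ∘ k = idm A.
Proof.
move=> k1 k2.
have kleg : forest_leg c ∘ k = c by rewrite -composeA k2 compose_m1.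
apply: (tree_ext (ft_tree _)) => [|Y y g ey IH].
  have kl : k ∘ leaf = forest_leaf c ∘ leaf.
    apply: (@act_ext _ _ P FC).
      by rewrite (comp_l k1) (comp_l (pb1_forest_leaf _ _ _)) -composeA ft_d_leaf eta_natural.
    rewrite (comp_l k2) (comp_l (pb2_forest_leaf _ _ _)) compose_1m -composeA leaf_leg.
    by rewrite compose_m1.
  by rewrite -composeA kl composeA graft_leaf.
have e3 : forest_leg c ∘ (k ∘ g) = y by rewrite composeA kleg.
have e4 : c ∘ (graft ∘ (k ∘ g)) = y by rewrite composeA graft_leg.
rewrite compose_1m -composeA.
have -> : k ∘ (node ∘ act_sub ey) = forest_node c ∘ act_sub e3.
  apply: (@act_ext _ _ P FC).
    rewrite (comp_l k1) -!composeA (comp_l (pb1_forest_node _ _ _)).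
    rewrite (comp_l (ft_d_node _)) -!composeA !pb1_act_sub.
    rewrite (comp_l (eq_sym (mu_natural _ _))) -!composeA.
    by congr (_ ∘ _); rewrite !composeA -!fmapM !composeA k1.
  rewrite (comp_l k2) compose_1m (comp_l (pb2_forest_node _ _ _)) -composeA; congr (_ ∘ _).
  apply: act_ext.
    rewrite (comp_l (pb1_act_sub _ _)) -composeA !pb1_act_sub !composeA -!fmapM.
    by rewrite !composeA k2 compose_1m.
  by rewrite (comp_l (pb2_act_sub _ _)) !pb2_act_sub.
rewrite (graft_node_sub _ e4); congr (_ ∘ _); apply: act_map_irr.
by rewrite composeA IH compose_1m.
Qed.
Definition free_multicat : Multicat T P.
Proof.
unshelve refine {| mc_graph := FC; mc_ids := free_ids; mc_comp := free_comp |}.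
- abstract (
    have -> : span_hcomp P (span_idm (gr1 FC)) free_comp =
      forest_sub (graft_leg P hET C) :> (act FC (forest_leg c) ~> AA);
    [ apply: (@act_ext _ _ P FC); rewrite ?pb1_forest_sub ?pb2_forest_sub /= /span_comp_map
        ?pb1_pair ?pb2_pair ?compose_1m //
    | rewrite -composeA; apply: graft_assoc; rewrite /= /span_comp_map
        ?pb1_pair_l ?pb2_pair_l ?fmap1 ?compose_1m;
      [ by rewrite pb1_pair composeA
      | rewrite -[LHS]composeA; congr (_ ∘ _); rewrite pb2_pair; apply: (@act_ext _ _ P FC);
        by rewrite ?pb1_forest_sub ?pb2_forest_sub ?pb1_pair ?pb2_pair ] ]).
- abstract (rewrite -composeA -[RHS](graft_leaf P hET C); congr (_ ∘ _);
    apply: (@act_ext _ _ P FC); rewrite ?pb1_forest_leaf ?pb2_forest_leaf /= /span_comp_map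
      ?pb1_pair_l ?pb2_pair_l -[LHS]composeA ?pb1_pair ?pb2_pair ?fmap1 ?compose_1m //).
- abstract (rewrite -composeA; apply: graft_unitr; rewrite /= /span_comp_map
      ?pb1_pair_l ?pb2_pair_l -[LHS]composeA ?pb1_pair ?pb2_pair ?compose_1m //).
Defined.

End Structure.
End FreeMulticat.

(** * The universal property of the free multicategory *)

Section FreeUniversal.
Context {E : Category} (T : Monad E) (P : PullbackChoice E) (hET : suitable T).
Notation K := (graph_cat T).
Notation MC := (multicat_cat T P).
Notation act := (act P).
Notation act_map := (act_map P).
Notation act_sub := (act_sub P).
Notation free_graph := (free_graph P hET).
Notation free_multicat := (free_multicat P hET).
Notation forest_leg := (forest_leg P hET).
Notation forest_leaf := (forest_leaf P hET).
Notation forest_node := (forest_node P hET).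
Notation forest_sub := (forest_sub P hET).
Notation d C := (ft_d (free_tree P hET C)).
Notation c C := (ft_c (free_tree P hET C)).
Notation leaf C := (ft_leaf (free_tree P hET C)).
Notation node C := (ft_node (free_tree P hET C)).
Notation graft := (graft P hET).

Section Unit.
Context (C : K).

Lemma corolla_proof : fmap T (c C) ∘ (fmap T (leaf C) ∘ dleg (gr1 C)) =
  dleg (gr1 C) ∘ idm (apex (gr1 C)).
Proof. by rewrite composeA -fmapM leaf_leg fmap1 compose_1m compose_m1. Qed.

(** The tree with a single node, all of whose branches are bare leaves. *)
Definition corolla : apex (gr1 C) ~> act C (c C) := pb_pair (act C (c C)) _ _ corolla_proof.

Definition free_unit : C ~> free_graph C.
Proof.
unshelve refine (@Build_GraphMap _ _ C (free_graph C) (idm (gr0 C)) (node C ∘ corolla) _ _).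
- abstract (rewrite composeA ft_d_node -!composeA pb1_pair (composeA (fmap T _)) -fmapM;
    by rewrite ft_d_leaf composeA mu_fmap_eta fmap1).
- abstract (by rewrite composeA node_leg -composeA pb2_pair compose_m1 compose_1m).
Defined.

(** A tree is the graft of its branches onto the corolla of its root. *)
Lemma graft_corolla (k : act C (c C) ~> act (free_graph C) (c C)) :
  pb1 (act (free_graph C) (c C)) ∘ k = pb1 (act C (c C)) ->
  pb2 (act (free_graph C) (c C)) ∘ k = gm1 free_unit ∘ pb2 (act C (c C)) ->
  graft C ∘ k = node C.
Proof.
move=> k1 k2.
have el : forest_leg (c C) ∘ forest_leaf (c C) = c C.
  exact: (tree_leaf_leg (forest_tree P hET (c C))).
have ei : c C ∘ (graft C ∘ forest_leaf (c C)) = c C by rewrite graft_leaf compose_m1.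
have -> : k = forest_node (c C) ∘ act_sub el.
  apply: (@act_ext _ _ P (free_graph C)).
    rewrite k1 (comp_l (pb1_forest_node _ _ _)) -!composeA pb1_act_sub.
    rewrite (composeA (fmap T _)) -fmapM pb1_forest_leaf.
    by rewrite (comp_l (mu_fmap_eta _ _)) compose_1m.
  rewrite k2 (comp_l (pb2_forest_node _ _ _)) -!composeA; congr (_ ∘ _).
  apply: act_ext.
    rewrite pb1_pair_l (comp_l (pb1_act_sub _ _)) -!composeA pb1_act_sub.
    rewrite (composeA (fmap T (pb2 _))) -fmapM pb2_forest_leaf fmapM -composeA.
    by rewrite pb_comm.
  by rewrite pb2_pair_l compose_1m (comp_l (pb2_act_sub _ _)) pb2_act_sub.
rewrite (graft_node_sub el ei) -[RHS]compose_m1; congr (_ ∘ _).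
apply: act_ext; rewrite ?pb1_act_sub ?pb2_act_sub compose_m1 //.
by rewrite graft_leaf fmap1 compose_1m.
Qed.

End Unit.

Section Lift.
Context (C : K) (M : Multicat T P).
Notation MM := (act (M : K) (cleg (gr1 M))).

Lemma free_map_leg (g : (free_multicat C : MC) ~> M) (f : C ~> (M : K)) :
  (mm_graph g : (free_graph C : K) ~> M) ∘ free_unit C = f ->
  gm0 g = gm0 f /\ cleg (gr1 M) ∘ gm1 g = gm0 f ∘ c C.
Proof.
move=> <-; rewrite gm_c.
by split; [symmetry; exact: compose_m1|congr (_ ∘ _); symmetry; exact: compose_m1].
Qed.

(** A map of multicategories preserves the decomposition of [graft_corolla], so it obeys
    the recursion that defines maps out of an object of trees. *)
Lemma free_map_node (g : (free_multicat C : MC) ~> M) (f : C ~> (M : K))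
    (eg : cleg (gr1 M) ∘ gm1 g = gm0 f ∘ c C) :
  (mm_graph g : (free_graph C : K) ~> M) ∘ free_unit C = f ->
  gm1 g ∘ node C = mcomp M ∘ act_map eg.
Proof.
move=> ef.
have ek : fmap T (c C) ∘ pb1 (act C (c C)) = d C ∘ (gm1 (free_unit C) ∘ pb2 (act C (c C))).
  rewrite pb_comm composeA; congr (_ ∘ _).
  by rewrite (gm_d (free_unit C) : d C ∘ gm1 (free_unit C) = _) fmap1 compose_1m.
pose k := pb_pair (act (free_graph C) (c C)) _ _ ek.
have k1 : pb1 (act (free_graph C) (c C)) ∘ k = pb1 (act C (c C)) by exact: pb1_pair.
have k2 : pb2 (act (free_graph C) (c C)) ∘ k = gm1 (free_unit C) ∘ pb2 (act C (c C)).
  exact: pb2_pair.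
rewrite -(graft_corolla k1 k2) (comp_l (mm_comp g)) -composeA; congr (_ ∘ _).
apply: (@act_ext _ _ P (M : K)).
  by rewrite (comp_l (pb1_graph_map_square P g)) -composeA k1 pb1_act_map.
rewrite (comp_l (pb2_graph_map_square P g)) -composeA k2 pb2_act_map composeA.
by rewrite -ef.
Qed.

Lemma free_lift_unique (g g' : (free_multicat C : MC) ~> M) (f : C ~> (M : K)) :
  (mm_graph g : (free_graph C : K) ~> M) ∘ free_unit C = f ->
  (mm_graph g' : (free_graph C : K) ~> M) ∘ free_unit C = f -> g = g'.
Proof.
move=> ef ef'.
have [e0 ec] := free_map_leg ef; have [e0' ec'] := free_map_leg ef'.
apply: MulticatMap_eq; apply: GraphMap_eq; first by rewrite e0 e0'.
apply: (tree_rec_unique (ft_tree _) (eh := ec) (ek := ec') _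
  (free_map_node ec ef) (free_map_node ec' ef')).
by have := mm_ids g; have := mm_ids g'; rewrite /= e0 e0' => -> ->.
Qed.

(** The extension evaluates a tree recursively in [M]. Compatibility with composition is an induction
    on the lower tree, where leaves use the left unit law of [M] and nodes its associativity;
    the right unit law makes the extension agree with [f] on corollas. *)
Lemma free_lift (f : C ~> (M : K)) : exists g : (free_multicat C : MC) ~> M,
  (mm_graph g : (free_graph C : K) ~> M) ∘ free_unit C = f.
Proof.
have [||h [eh [h_leaf h_node]]] := tree_rec hET (ft_tree (free_tree P hET C)) (f := f)
  (z0 := cleg (gr1 M)) (l := mids M ∘ gm0 f) (z := mcomp M).
    by rewrite composeA mids_c compose_1m compose_m1.
  exact: mcomp_c.
have h_d : dleg (gr1 M) ∘ h = fmap T (gm0 f) ∘ d C.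
  apply: (tree_ext (ft_tree _)) => [|Y y g ey IH].
    rewrite -!composeA h_leaf ft_d_leaf -eta_natural.
    by rewrite composeA mids_d.
  rewrite -!composeA (comp_l h_node) -composeA (comp_l (mcomp_d _)) -!composeA.
  rewrite (comp_l (pb1_act_map _ _)) -!composeA pb1_act_sub (comp_l (ft_d_node _)) -!composeA.
  rewrite pb1_act_sub (comp_l (eq_sym (mu_natural _ _))) -!composeA; congr (_ ∘ _).
  by rewrite !composeA -!fmapM IH.
pose g := @Build_GraphMap _ _ (free_graph C) M (gm0 f) h h_d eh.
have g_ids : gm1 g ∘ mc_ids (free_multicat C) = mc_ids M ∘ gm0 g by exact: h_leaf.
pose sq : act (free_graph C) (c C) ~> MM := graph_map_square P g.
have sq1 : pb1 MM ∘ sq = fmap T h ∘ pb1 (act (free_graph C) (c C)).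
  exact: pb1_graph_map_square.
have sq2 : pb2 MM ∘ sq = h ∘ pb2 (act (free_graph C) (c C)).
  exact: pb2_graph_map_square.
have g_comp : gm1 g ∘ mc_comp (free_multicat C) = mc_comp M ∘ graph_map_square P g.
{ change (h ∘ graft C = mcomp M ∘ sq).
  apply: (tree_ext (forest_tree P hET (c C))) => [|Y y k ey IH].
    rewrite -composeA graft_leaf compose_m1 -composeA; symmetry; apply: mcomp_unitl.
      by rewrite (comp_l sq1) -composeA pb1_forest_leaf eta_natural.
    by rewrite (comp_l sq2) -composeA pb2_forest_leaf (comp_l h_leaf) eh composeA.
  have e1 : c C ∘ (graft C ∘ k) = y by rewrite composeA graft_leg.
  have e2 : c C ∘ (pb2 (act (free_graph C) (c C)) ∘ k) = y by rewrite composeA.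
  rewrite -!composeA (graft_node_sub _ e1) (comp_l h_node) -composeA.
  apply: (mcomp_assoc (w := fmap T (sq ∘ k) ∘ pb1 (act C y)) (t3 := act_map eh ∘ act_sub e2)).
  - rewrite (comp_l (pb1_act_map _ _)) -composeA pb1_act_sub !composeA -!fmapM.
    by rewrite !composeA IH.
  - rewrite (comp_l (pb1_act_map _ _)) -composeA pb1_act_sub !composeA -!fmapM.
    by rewrite !composeA sq2.
  - rewrite (comp_l sq1) -composeA (comp_l (pb1_forest_node _ _ _)) -!composeA pb1_act_sub.
    rewrite (comp_l (eq_sym (mu_natural _ _))) -!composeA; congr (_ ∘ _).
    by rewrite !composeA -!fmapM !composeA sq1.
  - by rewrite !(comp_l (pb2_act_map _ _)) -!composeA !pb2_act_sub.
  - rewrite (comp_l sq2) -composeA (comp_l (pb2_forest_node _ _ _)) -composeA.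
    rewrite (comp_l h_node) -composeA; congr (_ ∘ (_ ∘ _)); apply: act_ext.
      rewrite (comp_l (pb1_act_sub _ _)) -composeA !pb1_act_sub !composeA -!fmapM.
      by [].
    by rewrite (comp_l (pb2_act_sub _ _)) !pb2_act_sub. }
exists (@Build_MulticatMap _ _ _ (free_multicat C) M g g_ids g_comp).
apply: GraphMap_eq => /=; first by rewrite compose_m1.
rewrite composeA h_node -composeA; apply: mcomp_unitr; last first.
  by rewrite (comp_l (pb2_act_map _ _)) -composeA pb2_pair compose_m1.
rewrite (comp_l (pb1_act_map _ _)) -composeA pb1_pair gm_d !composeA -!fmapM.
by rewrite h_leaf.
Qed.

End Lift.

End FreeUniversal.

(** * Adjunctions from universal arrows *)

Section UniversalArrows.
Context {C D : Category} (U : Functor D C) (F0 : C -> D) (u : forall c : C, c ~> U (F0 c)).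
Hypothesis u_lift : forall (c : C) (d : D) (f : c ~> U d),
  exists g : F0 c ~> d, fmap U g ∘ u c = f.
Hypothesis u_unique : forall (c : C) (d : D) (g g' : F0 c ~> d),
  fmap U g ∘ u c = fmap U g' ∘ u c -> g = g'.

Definition extend (c : C) (d : D) (f : c ~> U d) : F0 c ~> d :=
  proj1_sig (constructive_indefinite_description _ (u_lift f)).

Lemma extendP (c : C) (d : D) (f : c ~> U d) : fmap U (extend f) ∘ u c = f.
Proof. exact: proj2_sig (constructive_indefinite_description _ (u_lift f)). Qed.

Definition universal_functor : Functor C D.
Proof.
exists F0 (fun a b f => extend (u b ∘ f)).
- abstract (by move=> a; apply: u_unique; rewrite extendP fmap1 compose_1m compose_m1).
- abstract (by move=> a b c g f; apply: u_unique;
    rewrite extendP fmapM -composeA extendP !composeA extendP).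
Defined.

Definition universal_adjunction : Adjunction universal_functor U.
Proof.
unshelve refine (@Build_Adjunction C D universal_functor U u (fun d => extend (idm (U d)))
  _ _ _ _).
- abstract (by move=> a b f; rewrite extendP).
- abstract (by move=> a b f; apply: u_unique;
    rewrite /= !fmapM -!composeA !extendP composeA extendP compose_1m compose_m1).
- abstract (by move=> c; apply: u_unique;
    rewrite /= fmapM -composeA extendP composeA extendP fmap1).
- abstract (by move=> d; rewrite extendP).
Defined.

End UniversalArrows.

(** * Monadicity over graphs *)

(** The converse of [mcomp_assoc], [mcomp_unitl] and [mcomp_unitr]: it suffices to instantiate
    the laws at the generic element. *)
Section MulticatElements.
Context {E : Category} (T : Monad E) (P : PullbackChoice E) (C : graph_cat T)
  (ids : SpanMap (span_id T (gr0 C)) (gr1 C))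
  (comp : SpanMap (span_comp P (gr1 C) (gr1 C)) (gr1 C)).
Notation CC := (act P C (cleg (gr1 C))).

Let cmp : CC ~> apex (gr1 C) := comp.

Hypothesis assoc_elt : forall (W : E) (w : W ~> T CC) (t1 t2 t3 : W ~> CC),
  pb1 CC ∘ t1 = fmap T cmp ∘ w -> pb1 CC ∘ t3 = fmap T (pb2 CC) ∘ w ->
  pb1 CC ∘ t2 = mu T (apex (gr1 C)) ∘ (fmap T (pb1 CC) ∘ w) ->
  pb2 CC ∘ t3 = pb2 CC ∘ t1 -> pb2 CC ∘ t2 = cmp ∘ t3 -> cmp ∘ t1 = cmp ∘ t2.

Hypothesis unitl_elt : forall (t : apex (gr1 C) ~> CC),
  pb1 CC ∘ t = eta T (apex (gr1 C)) -> pb2 CC ∘ t = ids ∘ cleg (gr1 C) ->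
  cmp ∘ t = idm (apex (gr1 C)).

Hypothesis unitr_elt : forall (t : apex (gr1 C) ~> CC),
  pb1 CC ∘ t = fmap T ids ∘ dleg (gr1 C) -> pb2 CC ∘ t = idm (apex (gr1 C)) ->
  cmp ∘ t = idm (apex (gr1 C)).

Definition multicat_of_elements : Multicat T P.
Proof.
unshelve refine {| mc_graph := C; mc_ids := ids; mc_comp := comp |}.
- abstract (rewrite -composeA;
    apply: (assoc_elt (w := pb1 (span_pb P (gr1 C) (span_comp P (gr1 C) (gr1 C))))
      (t3 := pb_pair CC _ _ (span_assoc_proof P (gr1 C) (gr1 C) (gr1 C))));
    rewrite /= /span_comp_map ?pb1_pair_l ?pb2_pair_l ?pb1_pair ?pb2_pair ?fmap1 ?compose_1m //;
    [ by rewrite pb1_pair -[LHS]composeA | by rewrite -[LHS]composeA pb2_pair ]).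
- abstract (rewrite -composeA; apply: unitl_elt; rewrite /= /span_comp_map
      ?pb1_pair_l ?pb2_pair_l -[LHS]composeA ?pb1_pair ?pb2_pair ?fmap1 ?compose_1m //).
- abstract (rewrite -composeA; apply: unitr_elt; rewrite /= /span_comp_map
      ?pb1_pair_l ?pb2_pair_l -[LHS]composeA ?pb1_pair ?pb2_pair ?compose_1m //).
Defined.

End MulticatElements.

Section MulticatMonadic.
Context {E : Category} (T : Monad E) (P : PullbackChoice E).
Notation K := (graph_cat T).
Notation MC := (multicat_cat T P).
Notation U := (forgetful T P).
Context (F : Functor K MC) (adj : Adjunction F U).
Notation sq := (graph_map_square P).
Notation act := (act P).

Section OfAlgebra.
Context (X : Algebra (adj_monad adj)).
Let C : K := acarrier X.
Let FC : Multicat T P := F C.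
Let a : (FC : K) ~> C := aact X.
Let h : C ~> (FC : K) := unit adj C.
Notation CC := (act C (cleg (gr1 C))).
Notation FF := (act (FC : K) (cleg (gr1 FC))).

Let ah : a ∘ h = idm C.
Proof. exact: (aact_eta X). Qed.

Let ah0 : gm0 a ∘ gm0 h = idm (gr0 C).
Proof. by have := f_equal (@gm0 _ _ _ _) ah. Qed.

Let ah1 : gm1 a ∘ gm1 h = idm (apex (gr1 C)).
Proof. by have := f_equal (@gm1 _ _ _ _) ah. Qed.

Let s : FF ~> CC := sq a.
Let r : CC ~> FF := sq h.

Let pb1_s : pb1 CC ∘ s = fmap T (gm1 a) ∘ pb1 FF.
Proof. exact: pb1_graph_map_square. Qed.
Let pb2_s : pb2 CC ∘ s = gm1 a ∘ pb2 FF.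
Proof. exact: pb2_graph_map_square. Qed.
Let pb1_r : pb1 FF ∘ r = fmap T (gm1 h) ∘ pb1 CC.
Proof. exact: pb1_graph_map_square. Qed.
Let pb2_r : pb2 FF ∘ r = gm1 h ∘ pb2 CC.
Proof. exact: pb2_graph_map_square. Qed.

Definition alg_ids_map : gr0 C ~> apex (gr1 C) := gm1 a ∘ (mids FC ∘ gm0 h).
Definition alg_comp_map : CC ~> apex (gr1 C) := gm1 a ∘ (mcomp FC ∘ r).

(** An algebra structure is split by the unit, and it coequalizes the free multicategory
    structure of its carrier; so that structure descends along it. *)
Lemma alg_act_ids : gm1 a ∘ mids FC = alg_ids_map ∘ gm0 a.
Proof.
pose FFC : Multicat T P := F (FC : K).
pose Fa : (FFC : K) ~> (FC : K) := mm_graph (fmap F a).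
pose e : (FFC : K) ~> (FC : K) := mm_graph (counit adj (F C)).
pose hh : (FC : K) ~> (FFC : K) := unit adj (FC : K).
have nat0 : gm0 h ∘ gm0 a = gm0 Fa ∘ gm0 hh.
  by have := f_equal (@gm0 _ _ _ _) (unit_natural adj a).
have al1 : gm1 a ∘ gm1 e = gm1 a ∘ gm1 Fa.
  by have := f_equal (@gm1 _ _ _ _) (aact_mu X).
have eh0 : gm0 e ∘ gm0 hh = idm _.
  by have := f_equal (@gm0 _ _ _ _) (unit_counit adj (F C)).
have ie : gm1 e ∘ mids FFC = mids FC ∘ gm0 e := mm_ids (counit adj (F C)).
have iFa : gm1 Fa ∘ mids FFC = mids FC ∘ gm0 Fa := mm_ids (fmap F a).
rewrite /alg_ids_map -!composeA nat0 (comp_l (eq_sym iFa)) -composeA (comp_l (eq_sym al1)).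
by rewrite -composeA (comp_l ie) -composeA eh0 compose_m1.
Qed.

Lemma alg_act_comp : gm1 a ∘ mcomp FC = alg_comp_map ∘ s.
Proof.
pose FFC : Multicat T P := F (FC : K).
pose Fa : (FFC : K) ~> (FC : K) := mm_graph (fmap F a).
pose e : (FFC : K) ~> (FC : K) := mm_graph (counit adj (F C)).
pose hh : (FC : K) ~> (FFC : K) := unit adj (FC : K).
have nat0 : h ∘ a = Fa ∘ hh by exact: (unit_natural adj a).
have al1 : gm1 a ∘ gm1 e = gm1 a ∘ gm1 Fa.
  by have := f_equal (@gm1 _ _ _ _) (aact_mu X).
have eh0 : e ∘ hh = idm _ by exact: (unit_counit adj (F C)).
have ie : gm1 e ∘ mcomp FFC = mcomp FC ∘ sq e := mm_comp (counit adj (F C)).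
have iFa : gm1 Fa ∘ mcomp FFC = mcomp FC ∘ sq Fa := mm_comp (fmap F a).
have rs : r ∘ s = sq Fa ∘ sq hh.
  by rewrite /r /s -(graph_map_squareM P h a) nat0 graph_map_squareM.
rewrite /alg_comp_map -!composeA rs (comp_l (eq_sym iFa)) -composeA (comp_l (eq_sym al1)).
rewrite -composeA (comp_l ie) -composeA -graph_map_squareM eh0 graph_map_square1.
by rewrite compose_m1.
Qed.

Lemma alg_ids_d : dleg (gr1 C) ∘ alg_ids_map = eta T (gr0 C).
Proof.
rewrite /alg_ids_map composeA gm_d -composeA (comp_l (mids_d FC)) composeA.
by rewrite -eta_natural -composeA ah0 compose_m1.
Qed.

Lemma alg_ids_c : cleg (gr1 C) ∘ alg_ids_map = idm (gr0 C).
Proof.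
rewrite /alg_ids_map composeA gm_c -composeA (comp_l (mids_c FC)) compose_1m.
exact: ah0.
Qed.

Lemma alg_comp_d : dleg (gr1 C) ∘ alg_comp_map =
  mu T (gr0 C) ∘ fmap T (dleg (gr1 C)) ∘ pb1 CC.
Proof.
rewrite /alg_comp_map composeA gm_d -composeA (comp_l (mcomp_d FC)) -!composeA pb1_r.
rewrite (comp_l (eq_sym (mu_natural T (gm0 a)))) -composeA; congr (_ ∘ _).
rewrite !composeA -!fmapM; congr (fmap T _ ∘ _).
by rewrite -composeA gm_d composeA -fmapM ah0 fmap1 compose_1m.
Qed.

Lemma alg_comp_c : cleg (gr1 C) ∘ alg_comp_map = cleg (gr1 C) ∘ pb2 CC.
Proof.
rewrite /alg_comp_map composeA gm_c -composeA (comp_l (mcomp_c FC)) -composeA pb2_r.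
by rewrite (composeA (cleg _)) gm_c !composeA ah0 compose_1m.
Qed.

Definition alg_ids : SpanMap (span_id T (gr0 C)) (gr1 C) :=
  @Build_SpanMap _ _ _ _ (span_id T (gr0 C)) _ alg_ids_map alg_ids_d alg_ids_c.

Definition alg_comp : SpanMap (span_comp P (gr1 C) (gr1 C)) (gr1 C) :=
  @Build_SpanMap _ _ _ _ (span_comp P (gr1 C) (gr1 C)) _ alg_comp_map alg_comp_d alg_comp_c.

(** An evaluation in the free multicategory determines the evaluation in [C] of the image pair;
    every pair arises so, as [s] is split by [r]. *)
Lemma alg_split (W : E) (t : W ~> CC) (t' : W ~> FF) (x : W ~> apex (gr1 FC)) :
  mcomp FC ∘ t' = x -> s ∘ t' = t -> alg_comp_map ∘ t = gm1 a ∘ x.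
Proof. by move=> <- <-; rewrite composeA -alg_act_comp -composeA. Qed.

Lemma alg_assoc (W : E) (w : W ~> T CC) (t1 t2 t3 : W ~> CC) :
  pb1 CC ∘ t1 = fmap T alg_comp_map ∘ w -> pb1 CC ∘ t3 = fmap T (pb2 CC) ∘ w ->
  pb1 CC ∘ t2 = mu T (apex (gr1 C)) ∘ (fmap T (pb1 CC) ∘ w) ->
  pb2 CC ∘ t3 = pb2 CC ∘ t1 -> pb2 CC ∘ t2 = alg_comp_map ∘ t3 ->
  alg_comp_map ∘ t1 = alg_comp_map ∘ t2.
Proof.
move=> e1 e3 e2 f3 f2.
pose w' := fmap T r ∘ w.
have pb2_w' : fmap T (pb2 FF) ∘ w' = fmap T (gm1 h) ∘ (pb1 CC ∘ t3).
  by rewrite /w' composeA -fmapM pb2_r fmapM -composeA e3.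
have c1 : fmap T (cleg (gr1 FC)) ∘ (fmap T (mcomp FC) ∘ w') =
    dleg (gr1 FC) ∘ (gm1 h ∘ (pb2 CC ∘ t1)).
  rewrite composeA -fmapM mcomp_c fmapM -composeA pb2_w' composeA -fmapM gm_c fmapM -composeA.
  by rewrite (composeA (fmap T (cleg _))) pb_comm -composeA f3 composeA -gm_d -composeA.
have c2 : fmap T (cleg (gr1 FC)) ∘ (mu T (apex (gr1 FC)) ∘ (fmap T (pb1 FF) ∘ w')) =
    dleg (gr1 FC) ∘ (mcomp FC ∘ (r ∘ t3)).
  rewrite (comp_l (eq_sym (mu_natural T _))) (comp_l (mcomp_d FC)) -!composeA; congr (_ ∘ _).
  rewrite (composeA (pb1 _)) pb1_r -composeA -pb2_w' !composeA -!fmapM.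
  by rewrite pb_comm.
pose t1' := pb_pair FF _ _ c1; pose t2' := pb_pair FF _ _ c2.
have law : mcomp FC ∘ t1' = mcomp FC ∘ t2'.
  apply: (mcomp_assoc (w := w') (t3 := r ∘ t3)); rewrite ?pb1_pair ?pb2_pair //.
    by rewrite composeA pb1_r -composeA pb2_w'.
  by rewrite composeA pb2_r -composeA f3.
have s1 : s ∘ t1' = t1.
  apply: (@act_ext _ _ P C).
    rewrite (comp_l pb1_s) -composeA pb1_pair e1 /w' !composeA -!fmapM.
    by rewrite /alg_comp_map -composeA.
  by rewrite (comp_l pb2_s) -composeA pb2_pair composeA ah1 compose_1m.
have s2 : s ∘ t2' = t2.
  apply: (@act_ext _ _ P C).
    rewrite (comp_l pb1_s) -composeA pb1_pair e2 (comp_l (eq_sym (mu_natural _ _))) -composeA.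
    congr (_ ∘ _); rewrite /w' !composeA -!fmapM; congr (fmap T _ ∘ _).
    by rewrite -composeA pb1_r composeA -fmapM ah1 fmap1 compose_1m.
  by rewrite (comp_l pb2_s) -composeA pb2_pair f2 /alg_comp_map -!composeA.
by rewrite (alg_split law s1) (alg_split (eq_refl _) s2).
Qed.

Lemma alg_unitl (t : apex (gr1 C) ~> CC) :
  pb1 CC ∘ t = eta T (apex (gr1 C)) -> pb2 CC ∘ t = alg_ids_map ∘ cleg (gr1 C) ->
  alg_comp_map ∘ t = idm (apex (gr1 C)).
Proof.
move=> e1 e2.
have c1 : fmap T (cleg (gr1 FC)) ∘ (eta T (apex (gr1 FC)) ∘ gm1 h) =
    dleg (gr1 FC) ∘ (mids FC ∘ (cleg (gr1 FC) ∘ gm1 h)).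
  by rewrite (comp_l (mids_d FC)) (comp_l (eq_sym (eta_natural T _))) composeA.
rewrite (alg_split (t' := pb_pair FF _ _ c1) (x := gm1 h)) //.
  by apply: mcomp_unitl; rewrite ?pb1_pair ?pb2_pair.
apply: (@act_ext _ _ P C).
  rewrite (comp_l pb1_s) -composeA pb1_pair e1 (comp_l (eq_sym (eta_natural _ _))) -composeA.
  by rewrite ah1 compose_m1.
rewrite (comp_l pb2_s) -composeA pb2_pair e2 gm_c /alg_ids_map.
by rewrite -!composeA.
Qed.

Lemma alg_unitr (t : apex (gr1 C) ~> CC) :
  pb1 CC ∘ t = fmap T alg_ids_map ∘ dleg (gr1 C) -> pb2 CC ∘ t = idm (apex (gr1 C)) ->
  alg_comp_map ∘ t = idm (apex (gr1 C)).
Proof.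
move=> e1 e2.
have c1 : fmap T (cleg (gr1 FC)) ∘ (fmap T (mids FC) ∘ (dleg (gr1 FC) ∘ gm1 h)) =
    dleg (gr1 FC) ∘ gm1 h.
  by rewrite composeA -fmapM mids_c fmap1 compose_1m.
rewrite (alg_split (t' := pb_pair FF _ _ c1) (x := gm1 h)) //.
  by apply: mcomp_unitr; rewrite ?pb1_pair ?pb2_pair.
apply: (@act_ext _ _ P C).
  rewrite (comp_l pb1_s) -composeA pb1_pair e1 gm_d !composeA -!fmapM /alg_ids_map.
  by rewrite -composeA.
by rewrite (comp_l pb2_s) -composeA pb2_pair e2 ah1.
Qed.

Definition alg_multicat : Multicat T P :=
  multicat_of_elements (ids := alg_ids) (comp := alg_comp) alg_assoc alg_unitl alg_unitr.

Definition alg_multicat_act : F C ~> (alg_multicat : MC) :=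
  @Build_MulticatMap _ _ _ FC alg_multicat a alg_act_ids alg_act_comp.

End OfAlgebra.

Section OfAlgebraMap.
Context (X Y : Algebra (adj_monad adj)) (f : AlgebraMap X Y).
Let C : K := acarrier X.
Let D : K := acarrier Y.
Let g : C ~> D := amap f.

Let Fg : (mc_graph (F C) : K) ~> mc_graph (F D) := mm_graph (fmap F g).
Let g_act : g ∘ aact X = aact Y ∘ Fg := amap_act f.
Let g_unit : unit adj D ∘ g = Fg ∘ unit adj C := unit_natural adj g.

Let g_act1 : gm1 g ∘ gm1 (aact X) = gm1 (aact Y) ∘ gm1 Fg.
Proof. exact: (f_equal (@gm1 _ _ _ _) g_act). Qed.

Let g_unit0 : gm0 (unit adj D) ∘ gm0 g = gm0 Fg ∘ gm0 (unit adj C).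
Proof. exact: (f_equal (@gm0 _ _ _ _) g_unit). Qed.

Lemma alg_map_ids : gm1 g ∘ alg_ids_map X = alg_ids_map Y ∘ gm0 g.
Proof.
rewrite /alg_ids_map -!composeA g_unit0 (comp_l g_act1) -composeA.
congr (_ ∘ _); rewrite !composeA; congr (_ ∘ _); exact: (mm_ids (fmap F g)).
Qed.

Lemma alg_map_comp : gm1 g ∘ alg_comp_map X = alg_comp_map Y ∘ sq g.
Proof.
rewrite /alg_comp_map -!composeA -graph_map_squareM g_unit graph_map_squareM (comp_l g_act1).
rewrite -composeA.
congr (_ ∘ _); rewrite !composeA; congr (_ ∘ _); exact: (mm_comp (fmap F g)).
Qed.

Definition alg_multicat_map : (alg_multicat X : MC) ~> alg_multicat Y :=
  @Build_MulticatMap _ _ _ (alg_multicat X) (alg_multicat Y) g alg_map_ids alg_map_comp.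

End OfAlgebraMap.

Definition alg_functor : Functor (algebra_cat (adj_monad adj)) MC.
Proof.
unshelve refine {| fobj := alg_multicat : algebra_cat (adj_monad adj) -> MC;
  fmap := alg_multicat_map |}.
- abstract (by move=> X; apply: MulticatMap_eq).
- abstract (by move=> X Y Z g f; apply: MulticatMap_eq).
Defined.

Lemma alg_comparison (M : MC) :
  alg_ids_map (comparison_obj adj M) = mids M /\
  alg_comp_map (comparison_obj adj M) = mcomp M.
Proof.
pose C : K := mc_graph M; pose h := unit adj C.
pose e : (mc_graph (F C) : K) ~> C := mm_graph (counit adj M).
have eh : e ∘ h = idm _ by exact: (unit_counit adj M).
have ie : gm1 e ∘ mids (F C) = mids M ∘ gm0 e := mm_ids (counit adj M).
have ce : gm1 e ∘ mcomp (F C) = mcomp M ∘ sq e := mm_comp (counit adj M).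
split.
  have eh0 : gm0 e ∘ gm0 h = idm _ := f_equal (@gm0 _ _ _ _) eh.
  by rewrite /alg_ids_map (comp_l ie) -composeA eh0 compose_m1.
rewrite /alg_comp_map (comp_l ce) -composeA -graph_map_squareM.
by rewrite eh graph_map_square1 compose_m1.
Qed.

Section ComparisonIso.
Context (M : MC).
Let M' : Multicat T P := alg_multicat (comparison_obj adj M).

Lemma comparison_iso_ids :
  gm1 (idm (mc_graph M : K)) ∘ mc_ids M' = mc_ids M ∘ gm0 (idm (mc_graph M : K)).
Proof. by rewrite compose_1m compose_m1; exact: (proj1 (alg_comparison M)). Qed.

Lemma comparison_iso_comp :
  gm1 (idm (mc_graph M : K)) ∘ mc_comp M' = mc_comp M ∘ sq (idm (mc_graph M : K)).
Proof. by rewrite graph_map_square1 compose_1m compose_m1; exact: (proj2 (alg_comparison M)). Qed.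

Definition comparison_iso : (M' : MC) ~> M :=
  @Build_MulticatMap _ _ _ M' M (idm (mc_graph M : K)) comparison_iso_ids comparison_iso_comp.

Lemma comparison_isoP : is_iso comparison_iso.
Proof.
have ids' : gm1 (idm (mc_graph M : K)) ∘ mc_ids M = mc_ids M' ∘ gm0 (idm (mc_graph M : K)).
  by rewrite compose_1m compose_m1; symmetry; exact: (proj1 (alg_comparison M)).
have comp' : gm1 (idm (mc_graph M : K)) ∘ mc_comp M = mc_comp M' ∘ sq (idm (mc_graph M : K)).
  rewrite graph_map_square1 compose_1m compose_m1; symmetry; exact: (proj2 (alg_comparison M)).
exists (@Build_MulticatMap _ _ _ M M' (idm (mc_graph M : K)) ids' comp').
by split; apply: MulticatMap_eq; exact: (@compose_1m K).
Qed.

End ComparisonIso.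

(** Both maps agree after the split epimorphism [Fa], by naturality of the counit at
    [alg_multicat_act]. *)
Lemma counit_alg_multicat (X : Algebra (adj_monad adj)) :
  mm_graph (counit adj (alg_multicat X)) = aact X.
Proof.
pose C : K := acarrier X; pose FC : K := mc_graph (F C).
pose a : FC ~> C := aact X.
pose e : FC ~> C := mm_graph (counit adj (alg_multicat X)).
pose eF : (mc_graph (F FC) : K) ~> FC := mm_graph (counit adj (F C)).
pose Fa : (mc_graph (F FC) : K) ~> FC := mm_graph (fmap F a).
pose Fh : FC ~> mc_graph (F FC) := mm_graph (fmap F (unit adj C)).
have nat : e ∘ Fa = a ∘ eF.
  exact: (f_equal (@mm_graph _ _ _ _ _) (counit_natural adj (alg_multicat_act X))).
have mult : a ∘ eF = a ∘ Fa by exact: (aact_mu X).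
have split : Fa ∘ Fh = idm FC.
  have := f_equal (@mm_graph _ _ _ _ _) (fmapM F a (unit adj C)).
  by rewrite (aact_eta X : a ∘ unit adj C = idm C) fmap1.
change (e = a).
by rewrite -(compose_m1 e) -(compose_m1 a) -split !composeA nat mult.
Qed.

Lemma counit_alg_idm (X : Algebra (adj_monad adj)) :
  idm (acarrier X) ∘ aact (comparison_obj adj (alg_multicat X)) =
  aact X ∘ fmap (adj_monad adj) (idm (acarrier X)).
Proof.
rewrite fmap1; etransitivity; first exact: compose_1m.
by etransitivity; [exact: (counit_alg_multicat X)|symmetry; exact: compose_m1].
Qed.

Lemma counit_alg_idm_inv (X : Algebra (adj_monad adj)) :
  idm (acarrier X) ∘ aact X =
  aact (comparison_obj adj (alg_multicat X)) ∘ fmap (adj_monad adj) (idm (acarrier X)).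
Proof.
rewrite fmap1; etransitivity; first exact: compose_1m.
by symmetry; etransitivity; [exact: compose_m1|exact: (counit_alg_multicat X)].
Qed.

(** An algebra is a split quotient of the free one on its carrier, and [C |-> C_1 ∘ C_1], being
    a functor of the graph [C], preserves this quotient; so the multicategory structure passes to
    it. *)
Theorem multicat_monadic : monadic adj.
Proof.
exists alg_functor; split.
  unshelve refine (ex_intro _ (@Build_NatTrans _ _ (functor_comp alg_functor (comparison adj))
    (functor_id MC) comparison_iso _) _) => [M N f|M]; last exact: comparison_isoP.
  apply: MulticatMap_eq.
  by etransitivity; [exact: (@compose_1m K)|symmetry; exact: (@compose_m1 K)].
unshelve refine (ex_intro _ (@Build_NatTrans _ _ (functor_comp (comparison adj) alg_functor)
  (functor_id (algebra_cat (adj_monad adj)))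
  (fun X => @Build_AlgebraMap _ _ (comparison_obj adj (alg_multicat X)) X
     (idm (acarrier X)) (counit_alg_idm X)) _) _) => [X Y f|X].
  apply: AlgebraMap_eq.
  by etransitivity; [exact: (@compose_1m K)|symmetry; exact: (@compose_m1 K)].
exists (@Build_AlgebraMap _ _ X (comparison_obj adj (alg_multicat X))
     (idm (acarrier X)) (counit_alg_idm_inv X)).
by split; apply: AlgebraMap_eq; exact: (@compose_1m K).
Qed.

End MulticatMonadic.

(** * Limits and colimits of graphs *)

Section LimitFacts.
Context {J C : Category} (D : Functor J C) (L : C) (p : forall j, L ~> D j) (lp : is_limit p).

Lemma lim_lift (X : C) (q : forall j, X ~> D j) :
  (forall (i j : J) (u : i ~> j), fmap D u ∘ q i = q j) ->
  exists h : X ~> L, forall j, p j ∘ h = q j.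
Proof. by move=> /(proj2 lp) [h [hq _]]; exists h. Qed.

Lemma lim_ext (X : C) (h k : X ~> L) : (forall j, p j ∘ h = p j ∘ k) -> h = k.
Proof.
move=> e; have [|l [_ uni]] := proj2 lp X (fun j => p j ∘ k).
  by move=> i j u; rewrite composeA (proj1 lp).
by rewrite -(uni h) // -(uni k).
Qed.

End LimitFacts.

Section Graphs.
Context {E : Category} (T : Monad E).
Notation K := (graph_cat T).

Section GraphColim.
Context (J : Type) (Ed : J -> J -> Type) (A : J -> K) (m : forall j k, Ed j k -> A j ~> A k).
Notation m0 := (fun j k (u : Ed j k) => gm0 (m u)).
Notation m1 := (fun j k (u : Ed j k) => gm1 (m u)).

Lemma graph_gcolim (L : K) (i : forall j, A j ~> L) :
  is_gcolim m0 (fun j => gm0 (i j)) -> is_gcolim m1 (fun j => gm1 (i j)) -> is_gcolim m i.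
Proof.
move=> c0 c1; split.
  by move=> j k u; apply: GraphMap_eq; [exact: (proj1 c0)|exact: (proj1 c1)].
move=> X q eq.
have [h0 e0] : exists h0 : gr0 L ~> gr0 X, forall j, h0 ∘ gm0 (i j) = gm0 (q j).
  by apply: (gcolim_lift c0) => j k u; rewrite -(eq j k u).
have [h1 e1] : exists h1 : apex (gr1 L) ~> apex (gr1 X), forall j, h1 ∘ gm1 (i j) = gm1 (q j).
  by apply: (gcolim_lift c1) => j k u; rewrite -(eq j k u).
have hd : dleg (gr1 X) ∘ h1 = fmap T h0 ∘ dleg (gr1 L).
  apply: (gcolim_ext c1) => j.
  by rewrite -!composeA e1 !gm_d composeA -fmapM e0.
have hc : cleg (gr1 X) ∘ h1 = h0 ∘ cleg (gr1 L).
  apply: (gcolim_ext c1) => j.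
  by rewrite -!composeA e1 !gm_c composeA e0.
exists (@Build_GraphMap _ _ L X h0 h1 hd hc); split.
  by move=> j; apply: GraphMap_eq.
move=> k ek; apply: GraphMap_eq.
  by apply: (gcolim_ext c0) => j; rewrite e0 -(ek j).
by apply: (gcolim_ext c1) => j; rewrite e1 -(ek j).
Qed.

Lemma graph_gcolim_exists (L0 L1 : E) (i0 : forall j, gr0 (A j) ~> L0)
    (i1 : forall j, apex (gr1 (A j)) ~> L1) :
  is_gcolim m0 i0 -> is_gcolim m1 i1 -> exists (L : K) (i : forall j, A j ~> L),
    is_gcolim m0 (fun j => gm0 (i j)) /\ is_gcolim m1 (fun j => gm1 (i j)).
Proof.
move=> c0 c1.
have [d ed] : exists d : L1 ~> T L0, forall j, d ∘ i1 j = fmap T (i0 j) ∘ dleg (gr1 (A j)).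
  apply: (gcolim_lift c1) => j k u.
  by rewrite -composeA gm_d composeA -fmapM (proj1 c0).
have [c ec] : exists c : L1 ~> L0, forall j, c ∘ i1 j = i0 j ∘ cleg (gr1 (A j)).
  apply: (gcolim_lift c1) => j k u.
  by rewrite -composeA gm_c composeA (proj1 c0).
exists {| gr0 := L0; gr1 := {| apex := L1; dleg := d; cleg := c |} |}.
by exists (fun j => @Build_GraphMap _ _ (A j)
  {| gr0 := L0; gr1 := {| apex := L1; dleg := d; cleg := c |} |} (i0 j) (i1 j) (ed j) (ec j)).
Qed.

(** Componentwise colimits being colimits, every colimit is isomorphic to a componentwise one. *)
Lemma gcolim_graph (L0 L1 : E) (i0 : forall j, gr0 (A j) ~> L0)
    (i1 : forall j, apex (gr1 (A j)) ~> L1) (L : K) (i : forall j, A j ~> L) :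
  is_gcolim m0 i0 -> is_gcolim m1 i1 -> is_gcolim m i ->
  is_gcolim m0 (fun j => gm0 (i j)) /\ is_gcolim m1 (fun j => gm1 (i j)).
Proof.
move=> c0 c1 ci; have [L' [i' [c0' c1']]] := graph_gcolim_exists c0 c1.
have [k [[l [lk kl]] ek]] := gcolim_unique (graph_gcolim c0' c1') ci.
split.
  apply: (gcolim_iso c0' (k := gm0 k)); last by move=> j; rewrite -(ek j).
  by exists (gm0 l); split; [exact: (f_equal (@gm0 _ _ _ _) lk)|exact: (f_equal (@gm0 _ _ _ _) kl)].
apply: (gcolim_iso c1' (k := gm1 k)); last by move=> j; rewrite -(ek j).
by exists (gm1 l); split; [exact: (f_equal (@gm1 _ _ _ _) lk)|exact: (f_equal (@gm1 _ _ _ _) kl)].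
Qed.

End GraphColim.

Hypothesis hET : suitable T.
Context (P : PullbackChoice E).
Let sE : suitable_category E := proj1 hET.
Let pT : preserves_pullbacks T := cartesian_functor (suitable_cartesian_monad (proj2 hET)).

Section GraphPullback.
Context (A B S : K) (f : A ~> S) (g : B ~> S).

(** The arities of the induced map are compared in the pullback of vertices, which [T] preserves. *)
Lemma graph_pullback (Q : K) (p : Q ~> A) (q : Q ~> B) :
  is_pullback (gm0 f) (gm0 g) (gm0 p) (gm0 q) ->
  is_pullback (gm1 f) (gm1 g) (gm1 p) (gm1 q) -> is_pullback f g p q.
Proof.
move=> pb0 pb1; have Tpb := pT pb0; apply: pb_sq_intro.
- by apply: GraphMap_eq; [exact: (proj1 pb0)|exact: (proj1 pb1)].
- move=> X u v e.
  have e0 : gm0 f ∘ gm0 u = gm0 g ∘ gm0 v := f_equal (@gm0 _ _ _ _) e.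
  have e1 : gm1 f ∘ gm1 u = gm1 g ∘ gm1 v := f_equal (@gm1 _ _ _ _) e.
  have [h0 [hp0 hq0]] := pb_sq_lift pb0 e0.
  have [h1 [hp1 hq1]] := pb_sq_lift pb1 e1.
  have hd : dleg (gr1 Q) ∘ h1 = fmap T h0 ∘ dleg (gr1 X).
    apply: (pb_sq_ext Tpb); rewrite !composeA -gm_d -fmapM -composeA ?hp1 ?hq1 gm_d.
      by rewrite hp0.
    by rewrite hq0.
  have hc : cleg (gr1 Q) ∘ h1 = h0 ∘ cleg (gr1 X).
    apply: (pb_sq_ext pb0); rewrite !composeA -gm_c -composeA ?hp1 ?hq1 gm_c.
      by rewrite hp0.
    by rewrite hq0.
  by exists (@Build_GraphMap _ _ X Q h0 h1 hd hc); split; apply: GraphMap_eq.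
- move=> X h k e1 e2; apply: GraphMap_eq.
    by apply: (pb_sq_ext pb0); [exact: (f_equal (@gm0 _ _ _ _) e1)|exact: (f_equal (@gm0 _ _ _ _) e2)].
  by apply: (pb_sq_ext pb1); [exact: (f_equal (@gm1 _ _ _ _) e1)|exact: (f_equal (@gm1 _ _ _ _) e2)].
Qed.

Lemma pullback_graph (Q : K) (p : Q ~> A) (q : Q ~> B) : is_pullback f g p q ->
  is_pullback (gm0 f) (gm0 g) (gm0 p) (gm0 q) /\
  is_pullback (gm1 f) (gm1 g) (gm1 p) (gm1 q).
Proof.
move=> pbq.
pose P0 := P (gm0 f) (gm0 g); pose P1 := P (gm1 f) (gm1 g).
have Tpb := pT (pb_is_pullback P0).
have ed : fmap T (gm0 f) ∘ (dleg (gr1 A) ∘ pb1 P1) = fmap T (gm0 g) ∘ (dleg (gr1 B) ∘ pb2 P1).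
  by rewrite !composeA -!gm_d -!composeA pb_comm.
have ec : gm0 f ∘ (cleg (gr1 A) ∘ pb1 P1) = gm0 g ∘ (cleg (gr1 B) ∘ pb2 P1).
  by rewrite !composeA -!gm_c -!composeA pb_comm.
have [d [d1 d2]] := pb_sq_lift Tpb ed.
pose Q' : K := {| gr0 := P0; gr1 := {| apex := P1; dleg := d; cleg := pb_pair P0 _ _ ec |} |}.
pose p' : Q' ~> A := @Build_GraphMap _ _ Q' A (pb1 P0) (pb1 P1) (eq_sym d1) (eq_sym (pb1_pair _ _)).
pose q' : Q' ~> B := @Build_GraphMap _ _ Q' B (pb2 P0) (pb2 P1) (eq_sym d2) (eq_sym (pb2_pair _ _)).
have pb0 : is_pullback (gm0 f) (gm0 g) (gm0 p') (gm0 q') := pb_is_pullback P0.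
have pb1 : is_pullback (gm1 f) (gm1 g) (gm1 p') (gm1 q') := pb_is_pullback P1.
have [k [[l [lk kl]] [pk qk]]] := pb_sq_unique (graph_pullback pb0 pb1) pbq.
split.
  apply: (pb_sq_iso pb0 _ (f_equal (@gm0 _ _ _ _) pk) (f_equal (@gm0 _ _ _ _) qk)).
  by exists (gm0 l); split; [exact: (f_equal (@gm0 _ _ _ _) lk)|exact: (f_equal (@gm0 _ _ _ _) kl)].
apply: (pb_sq_iso pb1 _ (f_equal (@gm1 _ _ _ _) pk) (f_equal (@gm1 _ _ _ _) qk)).
by exists (gm1 l); split; [exact: (f_equal (@gm1 _ _ _ _) lk)|exact: (f_equal (@gm1 _ _ _ _) kl)].
Qed.

End GraphPullback.

Lemma monic_graph (A B : K) (f : A ~> B) : monic f -> monic (gm0 f) /\ monic (gm1 f).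
Proof. by move=> /monic_pb /pullback_graph [/monic_pb m0 /monic_pb m1]. Qed.

Lemma graph_monic (A B : K) (f : A ~> B) : monic (gm0 f) -> monic (gm1 f) -> monic f.
Proof. by move=> /monic_pb m0 /monic_pb m1; apply/monic_pb/graph_pullback. Qed.

(** An edge of the limit is a compatible family of edges, together with a lift of the family of
    their arities along the comparison from [T] of the limit of the vertices to the limit of
    [T] of the vertices; this pullback makes up for [T] preserving only pullbacks. *)
Lemma graph_cartesian : cartesian_category K.
Proof.
move=> J D fJ; have cE := suitable_cartesian sE.
have [L0 [p lp]] := cE J (functor_comp (vertices T) D) fJ.
have [M [m lm]] := cE J (functor_comp (edges T) D) fJ.
have [N [k lk]] := cE J (functor_comp T (functor_comp (vertices T) D)) fJ.
have [a ea] : exists a : M ~> N, forall j, k j ∘ a = dleg (gr1 (D j)) ∘ m j.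
  apply: (lim_lift lk) => i j u.
  by rewrite composeA -(gm_d (fmap D u)) -composeA (proj1 lm i j u).
have [b eb] : exists b : T L0 ~> N, forall j, k j ∘ b = fmap T (p j).
  by apply: (lim_lift lk) => i j u; rewrite -fmapM (proj1 lp i j u).
have [c ec] : exists c : M ~> L0, forall j, p j ∘ c = cleg (gr1 (D j)) ∘ m j.
  apply: (lim_lift lp) => i j u.
  by rewrite composeA -(gm_c (fmap D u)) -composeA (proj1 lm i j u).
pose L1 := P a b.
pose L : K := {| gr0 := L0; gr1 := {| apex := L1; dleg := pb2 L1; cleg := c ∘ pb1 L1 |} |}.
have pd j : dleg (gr1 (D j)) ∘ (m j ∘ pb1 L1) = fmap T (p j) ∘ dleg (gr1 L).
  by rewrite composeA -ea -eb -!composeA pb_comm.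
have pc j : cleg (gr1 (D j)) ∘ (m j ∘ pb1 L1) = p j ∘ cleg (gr1 L).
  by rewrite /= !composeA ec.
exists L, (fun j => @Build_GraphMap _ _ L (D j) (p j) (m j ∘ pb1 L1) (pd j) (pc j)); split.
  move=> i j u; apply: GraphMap_eq; first exact: (proj1 lp).
  by rewrite /= composeA (proj1 lm i j u).
move=> X q eq.
have [h0 e0] : exists h0 : gr0 X ~> L0, forall j, p j ∘ h0 = gm0 (q j).
  by apply: (lim_lift lp) => i j u; rewrite -(eq i j u).
have [h e] : exists h : apex (gr1 X) ~> M, forall j, m j ∘ h = gm1 (q j).
  by apply: (lim_lift lm) => i j u; rewrite -(eq i j u).
have eh : a ∘ h = b ∘ (fmap T h0 ∘ dleg (gr1 X)).
  apply: (lim_ext lk) => j.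
  by rewrite (comp_l (ea j)) (comp_l (eb j)) -composeA e gm_d composeA -fmapM e0.
pose h1 := pb_pair L1 _ _ eh.
have hd : dleg (gr1 L) ∘ h1 = fmap T h0 ∘ dleg (gr1 X) by exact: pb2_pair.
have hc : cleg (gr1 L) ∘ h1 = h0 ∘ cleg (gr1 X).
  apply: (lim_ext lp) => j.
  by rewrite /= -!composeA pb1_pair (comp_l (ec j)) -composeA e gm_c composeA e0.
exists (@Build_GraphMap _ _ X L h0 h1 hd hc); split.
  by move=> j; apply: GraphMap_eq; rewrite /= ?e0 // -composeA pb1_pair e.
move=> g eg.
have g0 : h0 = gm0 g by apply: (lim_ext lp) => j; rewrite e0 -(eg j).
apply: GraphMap_eq => //=; apply: pb_ext; rewrite ?pb1_pair ?pb2_pair.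
  by apply: (lim_ext lm) => j; rewrite e composeA -(eg j).
by rewrite g0; symmetry; exact: (gm_d g).
Qed.

Lemma graph_coproduct (I : Type) (A : I -> K) (S : K) (i : forall k, A k ~> S) :
  is_finite I -> (is_coproduct i <->
    is_coproduct (fun k => gm0 (i k)) /\ is_coproduct (fun k => gm1 (i k))).
Proof.
move=> fI; split; last first.
  move=> [/coproduct_gcolim c0 /coproduct_gcolim c1]; apply/coproduct_gcolim.
  by apply: graph_gcolim; [have [_ u] := c0|have [_ u] := c1]; split=> // X q _; exact: u.
move=> /coproduct_gcolim ci.
have [S0 [i0 c0]] := suitable_coproducts sE (fun k => gr0 (A k)) fI.
have [S1 [i1 c1]] := suitable_coproducts sE (fun k => apex (gr1 (A k))) fI.
have [||[_ u0] [_ u1]] := gcolim_graph (i0 := i0) (i1 := i1) _ _ ci.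
- by split=> // X q _; exact: c0.
- by split=> // X q _; exact: c1.
- by split=> X q; [exact: u0|exact: u1].
Qed.

Lemma graph_initial (Z : K) : is_initial Z -> is_initial (gr0 Z) /\ is_initial (apex (gr1 Z)).
Proof.
pose A (k : False) : K := match k with end.
pose i (k : False) : A k ~> Z := match k with end.
move=> /(proj1 (initial_coproduct i)) /(graph_coproduct i false_finite) [c0 c1].
split; first exact: (proj2 (initial_coproduct _) c0).
exact: (proj2 (initial_coproduct _) c1).
Qed.

Lemma nested_graph (A : Functor omega K) : nested A ->
  nested (functor_comp (vertices T) A) /\ nested (functor_comp (edges T) A).
Proof. by move=> nA; split=> m n u; case: (monic_graph (nA m n u)). Qed.

Lemma graph_colim (A : Functor omega K) (L : K) (i : forall n, A n ~> L) : nested A ->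
  is_colimit i <-> is_colimit (D := functor_comp (vertices T) A) (fun n => gm0 (i n)) /\
                   is_colimit (D := functor_comp (edges T) A) (fun n => gm1 (i n)).
Proof.
move=> /nested_graph [n0 n1]; split; last by move=> [c0 c1]; apply: graph_gcolim.
have [L0 [i0 c0]] := suitable_nested sE n0.
have [L1 [i1 c1]] := suitable_nested sE n1.
exact: (gcolim_graph c0 c1).
Qed.

Definition whisker (J : Category) (V : Functor K E) (A B : Functor J K) (f : NatTrans A B) :
  NatTrans (functor_comp V A) (functor_comp V B).
Proof.
exists (fun j => fmap V (f j)).
abstract (by move=> j k u; rewrite /= -!fmapM ntrans_natural).
Defined.

Theorem graph_suitable : suitable_category K.
Proof.
split.
- exact: graph_cartesian.
- move=> I A fI.
  have [S0 [i0 c0]] := suitable_coproducts sE (fun k => gr0 (A k)) fI.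
  have [S1 [i1 c1]] := suitable_coproducts sE (fun k => apex (gr1 (A k))) fI.
  have [||S [i [c0' c1']]] := graph_gcolim_exists (Ed := fun _ _ => False)
    (m := fun j k u => match u return A j ~> A k with end) (i0 := i0) (i1 := i1).
  + by split=> // X q _; exact: c0.
  + by split=> // X q _; exact: c1.
  + by exists S, i; apply/coproduct_gcolim; apply: graph_gcolim.
- move=> A S i /(graph_coproduct i bool_finite) [c0 c1].
  have [m0 d0] := suitable_disjoint sE c0; have [m1 d1] := suitable_disjoint sE c1.
  split=> [b|Z u v /graph_initial [z0 z1]]; first exact: graph_monic.
  by apply: graph_pullback; [exact: d0|exact: d1].
- move=> I A S i fI /(graph_coproduct i fI) [c0 c1] X f Q p q pbs.
  apply/(graph_coproduct _ fI); split.
    by apply: (suitable_stable sE fI c0) => k; case: (pullback_graph (pbs k)) => pb0 _; exact: pb0.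
  by apply: (suitable_stable sE fI c1) => k; case: (pullback_graph (pbs k)) => _ pb1; exact: pb1.
- move=> A nA; have [n0 n1] := nested_graph nA.
  have [L0 [i0 c0]] := suitable_nested sE n0.
  have [L1 [i1 c1]] := suitable_nested sE n1.
  have [L [i [c0' c1']]] := graph_gcolim_exists (m := fun j k u => fmap A u) c0 c1.
  by exists L, i; apply: graph_gcolim.
- move=> Q A B S phi psi p q nA nB nS pbs LP LA LB LS iP iA iB iS cP cA cB cS f g p' q' ef eg ep eq.
  have nP : nested Q := nested_pullback nA nB pbs.
  have [nA0 nA1] := nested_graph nA; have [nB0 nB1] := nested_graph nB.
  have [nS0 nS1] := nested_graph nS.
  have [cP0 cP1] := proj1 (graph_colim _ nP) cP; have [cA0 cA1] := proj1 (graph_colim _ nA) cA.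
  have [cB0 cB1] := proj1 (graph_colim _ nB) cB; have [cS0 cS1] := proj1 (graph_colim _ nS) cS.
  have pb0 n := proj1 (pullback_graph (pbs n)); have pb1 n := proj2 (pullback_graph (pbs n)).
  apply: graph_pullback.
  { apply: (suitable_nested_pullback sE (phi := whisker (vertices T) phi)
      (psi := whisker (vertices T) psi) (pi1 := whisker (vertices T) p)
      (pi2 := whisker (vertices T) q) nA0 nB0 nS0 pb0 cP0 cA0 cB0 cS0) => n.
    + exact: (f_equal (@gm0 _ _ _ _) (ef n)).
    + exact: (f_equal (@gm0 _ _ _ _) (eg n)).
    + exact: (f_equal (@gm0 _ _ _ _) (ep n)).
    + exact: (f_equal (@gm0 _ _ _ _) (eq n)). }
  apply: (suitable_nested_pullback sE (phi := whisker (edges T) phi)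
    (psi := whisker (edges T) psi) (pi1 := whisker (edges T) p)
    (pi2 := whisker (edges T) q) nA1 nB1 nS1 pb1 cP1 cA1 cB1 cS1) => n.
  + exact: (f_equal (@gm1 _ _ _ _) (ef n)).
  + exact: (f_equal (@gm1 _ _ _ _) (eg n)).
  + exact: (f_equal (@gm1 _ _ _ _) (ep n)).
  + exact: (f_equal (@gm1 _ _ _ _) (eq n)).
- move=> A L i nA /(graph_colim _ nA) [c0 c1] n; have [n0 n1] := nested_graph nA.
  apply: graph_monic.
    exact: (@suitable_nested_monic _ sE _ _ _ n0 c0 n).
  exact: (@suitable_nested_monic _ sE _ _ _ n1 c1 n).
Qed.

End Graphs.

(** * Cartesianness of maps defined by recursion *)

Section TreeSquare.
Context {E : Category} (T : Monad E) (P : PullbackChoice E) (hET : suitable T).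
Notation K := (graph_cat T).
Notation act := (act P).
Notation act_sub := (act_sub P).
Let pT : preserves_pullbacks T := cartesian_functor (suitable_cartesian_monad (proj2 hET)).

(** A square whose horizontal sides [r] and [t0] are defined by recursion is a pullback as soon
    as the data of the recursions form pullback squares: the pullback of [r] and [w] is
    an object of trees on [C] by [tree_pullback]. *)
Lemma tree_square (C D C' D' : K) (f : C ~> D) (f' : C' ~> D') (g : C ~> C') (g' : D ~> D')
    (X Y Q R Z W : E) (fx : X ~> Y)
    (x : X ~> gr0 C) (q0 : Q ~> gr0 C) (e0 : X ~> Q) (s0 : act C q0 ~> Q)
    (y : Y ~> gr0 D) (rl : R ~> gr0 D) (e' : Y ~> R) (s' : act D rl ~> R)
    (zl : Z ~> gr0 C') (z : act C' zl ~> Z) (wl : W ~> gr0 D') (a : act D' wl ~> W)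
    (w : Z ~> W) (r : R ~> W) (h0 : Q ~> R) (t0 : Q ~> Z)
    (ew : wl ∘ w = gm0 f' ∘ zl) (er : wl ∘ r = gm0 g' ∘ rl)
    (eh0 : rl ∘ h0 = gm0 f ∘ q0) (et0 : zl ∘ t0 = gm0 g ∘ q0) :
  is_pullback (gm0 g') (gm0 f') (gm0 f) (gm0 g) ->
  is_pullback (gm1 g') (gm1 f') (gm1 f) (gm1 g) ->
  zl ∘ z = cleg (gr1 C') ∘ pb2 (act C' zl) ->
  is_pullback a w (act_map P ew) z ->
  is_pullback (r ∘ e') w fx (t0 ∘ e0) ->
  r ∘ s' = a ∘ act_map P er -> t0 ∘ s0 = z ∘ act_map P et0 ->
  h0 ∘ e0 = e' ∘ fx -> h0 ∘ s0 = s' ∘ act_map P eh0 -> r ∘ h0 = w ∘ t0 ->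
  is_tree x e0 s0 -> is_tree y e' s' -> is_pullback r w h0 t0.
Proof.
move=> g0 g1 zleg pba pbe rs ts he hs comm tQ tR.
pose Q' := P r w; have pbQ : is_pullback r w (pb1 Q') (pb2 Q') := pb_is_pullback Q'.
have [q [eh et]] : exists q : Q' ~> gr0 C, gm0 f ∘ q = rl ∘ pb1 Q' /\ gm0 g ∘ q = zl ∘ pb2 Q'.
  by apply: (pb_sq_lift g0); rewrite !composeA -er -ew -!composeA pb_comm.
have ee : r ∘ (e' ∘ fx) = w ∘ (t0 ∘ e0) by rewrite composeA (proj1 pbe).
have es : r ∘ (s' ∘ act_map P (eq_sym eh)) = w ∘ (z ∘ act_map P (eq_sym et)).
  rewrite (comp_l rs) (comp_l (eq_sym (proj1 pba))) -!composeA; congr (_ ∘ _).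
  apply: act_ext.
    rewrite !(comp_l (pb1_act_map _ _)) -!composeA !pb1_act_map.
    by rewrite !composeA -!fmapM pb_comm.
  rewrite !(comp_l (pb2_act_map _ _)) -!composeA !pb2_act_map.
  by rewrite !composeA (proj1 g1).
pose e := pb_pair Q' _ _ ee; pose s := pb_pair Q' _ _ es.
have e1 : pb1 Q' ∘ e = e' ∘ fx by exact: pb1_pair.
have e2 : pb2 Q' ∘ e = t0 ∘ e0 by exact: pb2_pair.
have s1 : pb1 Q' ∘ s = s' ∘ act_map P (eq_sym eh) by exact: pb1_pair.
have s2 : pb2 Q' ∘ s = z ∘ act_map P (eq_sym et) by exact: pb2_pair.
have tQ' : is_tree x e s.
{ apply: (tree_pullback hET (f := f) (fx := fx) (h := pb1 Q') (eh := eq_sym eh) _ _ _ _ tR).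
  - apply: (pb_sq_ext g0); rewrite composeA ?eh ?et -composeA ?e1 ?e2 composeA.
      by rewrite -composeA -he composeA eh0 -composeA (tree_leaf_leg tQ).
    by rewrite et0 -composeA (tree_leaf_leg tQ).
  - apply: (pb_sq_ext g0); rewrite composeA ?eh ?et -composeA ?s1 ?s2 composeA.
      by rewrite (tree_node_leg tR) -composeA pb2_act_map !composeA gm_c.
    by rewrite zleg -composeA pb2_act_map !composeA gm_c.
  - apply: pb_sq_sym; apply: (pb_sq_cancel pbQ); first by rewrite e1.
    by rewrite e2.
  - apply: pb_sq_sym; apply: (pb_sq_cancel pbQ); first by rewrite s1.
    by rewrite s2 rs; apply: pb_sq_paste pba; apply: act_pullback. }
pose k := pb_pair Q' _ _ comm.
have k1 : pb1 Q' ∘ k = h0 by exact: pb1_pair.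
have k2 : pb2 Q' ∘ k = t0 by exact: pb2_pair.
have kq : q ∘ k = q0.
  apply: (pb_sq_ext g0); rewrite composeA ?eh ?et -composeA ?k1 ?k2 //.
apply: (pb_sq_iso pbQ _ k1 k2); apply: (tree_iso hET (ek := kq) tQ' tQ).
  apply: (pb_sq_ext pbQ); rewrite composeA ?k1 ?k2 ?e1 ?e2 //.
apply: (pb_sq_ext pbQ); rewrite composeA ?k1 ?k2.
  rewrite hs (comp_l s1) -composeA; congr (_ ∘ _); apply: act_ext.
    by rewrite (comp_l (pb1_act_map _ _)) -composeA pb1_act_sub pb1_act_map -k1 fmapM composeA.
  by rewrite (comp_l (pb2_act_map _ _)) -composeA pb2_act_sub pb2_act_map.
rewrite ts (comp_l s2) -composeA; congr (_ ∘ _); apply: act_ext.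
  by rewrite (comp_l (pb1_act_map _ _)) -composeA pb1_act_sub pb1_act_map -k2 fmapM composeA.
by rewrite (comp_l (pb2_act_map _ _)) -composeA pb2_act_sub pb2_act_map.
Qed.

End TreeSquare.

(** * The free multicategory monad is suitable *)

Section FreeMonad.
Context {E : Category} (T : Monad E) (P : PullbackChoice E) (hET : suitable T).
Notation K := (graph_cat T).
Notation MC := (multicat_cat T P).
Notation act := (act P).
Notation act_sub := (act_sub P).
Notation free_graph := (free_graph P hET).
Notation free_multicat := (free_multicat P hET).
Notation forest_leg := (forest_leg P hET).
Notation forest_leaf := (forest_leaf P hET).
Notation forest_node := (forest_node P hET).
Notation A C := (ft (free_tree P hET C)).
Notation c C := (ft_c (free_tree P hET C)).
Notation leaf C := (ft_leaf (free_tree P hET C)).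
Notation node C := (ft_node (free_tree P hET C)).
Notation graft := (graft P hET).
Let sE : suitable_category E := proj1 hET.
Let pT : preserves_pullbacks T := cartesian_functor (suitable_cartesian_monad (proj2 hET)).

Lemma free_universal_unique (C : K) (M : MC) (g g' : (free_multicat C : MC) ~> M) :
  fmap (forgetful T P) g ∘ free_unit P hET C = fmap (forgetful T P) g' ∘ free_unit P hET C ->
  g = g'.
Proof. by move=> e; apply: (free_lift_unique e). Qed.

Definition free_functor : Functor K MC :=
  @universal_functor K MC (forgetful T P) free_multicat (free_unit P hET)
    (fun C M f => free_lift hET f) free_universal_unique.

Definition free_adjunction : Adjunction free_functor (forgetful T P) :=
  @universal_adjunction K MC (forgetful T P) free_multicat (free_unit P hET)
    (fun C M f => free_lift hET f) free_universal_unique.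

Notation TT := (adj_monad free_adjunction).

Definition tree_map (C D : K) (f : C ~> D) : A C ~> A D := gm1 (fmap TT f).

Section TreeMap.
Context (C D : K) (f : C ~> D).

Let Ff : (free_multicat C : MC) ~> free_multicat D := fmap free_functor f.

Let Tf_unit : (mm_graph Ff : (free_graph C : K) ~> free_graph D)
  ∘ free_unit P hET C = free_unit P hET D ∘ f.
Proof. symmetry; exact: (unit_natural free_adjunction f). Qed.

Lemma free_gm0 : gm0 (fmap TT f) = gm0 f.
Proof.
by have [e _] := free_map_leg (g := Ff) Tf_unit; etransitivity; [exact: e|exact: compose_1m].
Qed.

Lemma tree_map_leg : c D ∘ tree_map f = gm0 f ∘ c C.
Proof. by have := gm_c (fmap TT f); rewrite free_gm0. Qed.

Lemma tree_map_leaf : tree_map f ∘ leaf C = leaf D ∘ gm0 f.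
Proof. by have := mm_ids (fmap free_functor f : MulticatMap _ _); rewrite -free_gm0. Qed.

Lemma tree_map_node : tree_map f ∘ node C = node D ∘ act_map P tree_map_leg.
Proof.
have [_ ec] := free_map_leg (g := Ff) Tf_unit.
have eD : c D ∘ idm (A D) = gm0 (free_unit P hET D) ∘ c D by rewrite compose_m1 compose_1m.
have nD : graft D ∘ @act_map _ _ P D (free_graph D) (free_unit P hET D) _ _ _ _ _ eD = node D.
  apply: graft_corolla; first by rewrite pb1_act_map fmap1 compose_1m.
  by rewrite pb2_act_map.
etransitivity; first exact: (free_map_node (g := Ff) ec Tf_unit).
rewrite -nD -composeA; congr (_ ∘ _).
apply: (@act_ext _ _ P (free_graph D)).
  by rewrite (comp_l (pb1_act_map _ _)) -composeA !pb1_act_map fmap1 compose_1m.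
by rewrite (comp_l (pb2_act_map _ _)) -composeA !pb2_act_map composeA.
Qed.

(** [tree_map f] is the sum of a map of leaves and a map of nodes. *)
Lemma leaf_cartesian : is_pullback (tree_map f) (leaf D) (leaf C) (gm0 f).
Proof.
exact: (cop_cartesian_l sE P (tree_cop hET (ft_tree _)) (tree_cop hET (ft_tree _))
  tree_map_leaf tree_map_node).
Qed.

Lemma node_cartesian : is_pullback (tree_map f) (node D) (node C) (act_map P tree_map_leg).
Proof.
exact: (cop_cartesian_r sE P (tree_cop hET (ft_tree _)) (tree_cop hET (ft_tree _))
  tree_map_leaf tree_map_node).
Qed.

End TreeMap.

Lemma free_preserves_pullbacks : preserves_pullbacks TT.
Proof.
move=> Q B C D f g p q /(pullback_graph hET P) [pb0 pb1].
have comm : f ∘ p = g ∘ q by apply: GraphMap_eq; [exact: (proj1 pb0)|exact: (proj1 pb1)].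
apply: (graph_pullback hET).
  by rewrite !free_gm0.
apply: (tree_square hET (ew := tree_map_leg g) (er := tree_map_leg f) (eh0 := tree_map_leg p)
  (et0 := tree_map_leg q) pb0 pb1 (tree_node_leg (ft_tree _))
  (pb_sq_sym (node_cartesian g)) _ (tree_map_node f) (tree_map_node q)
  (tree_map_leaf p) (tree_map_node p) _ (ft_tree _) (ft_tree _)).
  rewrite tree_map_leaf (tree_map_leaf q).
  exact: pb_sq_paste pb0 (pb_sq_sym (leaf_cartesian g)).
have := f_equal (fun h => gm1 (fmap TT h)) comm.
by rewrite !fmapM.
Qed.

(** ** The unit *)

(** A tree is a corolla exactly when its branches are bare leaves. *)
Lemma corolla_leaf_pullback (C : K) :
  is_pullback (fmap T (leaf C)) (pb1 (act C (c C))) (dleg (gr1 C)) (corolla P hET C).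
Proof.
have k2 : pb2 (act C (c C)) ∘ corolla P hET C = idm _ by exact: pb2_pair.
have k1 : pb1 (act C (c C)) ∘ corolla P hET C = fmap T (leaf C) ∘ dleg (gr1 C).
  exact: pb1_pair.
apply: pb_sq_intro => // [X u v e|X u v _ e]; last first.
  by rewrite -(compose_1m u) -(compose_1m v) -k2 -!composeA e.
have ed : dleg (gr1 C) ∘ (pb2 (act C (c C)) ∘ v) = u.
  by rewrite composeA -pb_comm -composeA -e composeA -fmapM leaf_leg fmap1 compose_1m.
exists (pb2 (act C (c C)) ∘ v); split=> //; apply: act_ext.
  by rewrite (comp_l k1) -composeA ed e.
by rewrite (comp_l k2) compose_1m.
Qed.

Lemma corolla_cartesian (C D : K) (f : C ~> D) :
  is_pullback (corolla P hET D) (act_map P (tree_map_leg f)) (gm1 f) (corolla P hET C).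
Proof.
apply: pb_sq_sym; apply: (pb_sq_cancel (pb_sq_sym (corolla_leaf_pullback D))).
  apply: act_ext.
    rewrite (comp_l (pb1_act_map _ _)) -composeA pb1_pair (composeA (pb1 _)) pb1_pair.
    by rewrite -composeA gm_d !composeA -!fmapM tree_map_leaf.
  rewrite (comp_l (pb2_act_map _ _)) -composeA pb2_pair (composeA (pb2 _)) pb2_pair.
  by rewrite compose_1m compose_m1.
rewrite pb1_act_map gm_d.
exact: pb_sq_paste (pb_sq_sym (corolla_leaf_pullback C)) (pT (leaf_cartesian f)).
Qed.

Lemma free_eta_cartesian (C D : K) (f : C ~> D) :
  is_pullback (eta TT D) (fmap TT f) f (eta TT C).
Proof.
apply: (graph_pullback hET); first by rewrite free_gm0; exact: pb_sq_id.
exact: pb_sq_paste (corolla_cartesian f) (pb_sq_sym (node_cartesian f)).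
Qed.

(** ** The multiplication *)

(** The recursion defining [graft] has the identity as datum on leaves and [node] on nodes. *)
Lemma graft_cartesian (C D : K) (f : C ~> D)
    (e : c D ∘ tree_map f = gm0 (fmap TT f : (free_graph C : K) ~> free_graph D) ∘ c C) :
  is_pullback (graft D) (tree_map f)
    (@act_map _ _ P (free_graph C) (free_graph D) (fmap TT f) _ _ _ _ _ e) (graft C).
Proof.
set h := act_map _ _.
have h1 : pb1 (act (free_graph D) (c D)) ∘ h = fmap T (tree_map f) ∘ pb1 (act (free_graph C) (c C)).
  exact: pb1_act_map.
have h2 : pb2 (act (free_graph D) (c D)) ∘ h = tree_map f ∘ pb2 (act (free_graph C) (c C)).
  exact: pb2_act_map.
have eh : forest_leg (c D) ∘ h = gm0 f ∘ forest_leg (c C).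
  by rewrite -composeA h2 !composeA tree_map_leg.
have idl (F : K) : c F ∘ graft F = gm0 (idm F) ∘ forest_leg (c F).
  by rewrite graft_leg compose_1m.
have gn (F : K) : graft F ∘ forest_node (c F) = node F ∘ act_map P (idl F).
  by rewrite graft_node; congr (_ ∘ _); apply: act_map_irr.
apply: (tree_square hET (ew := tree_map_leg f) (er := idl D) (et0 := idl C) (eh0 := eh) _ _
  (tree_node_leg (ft_tree _)) (pb_sq_sym (node_cartesian f)) _ (gn D) (gn C) _ _ _
  (forest_tree P hET (c C)) (forest_tree P hET (c D))).
- exact: pb_sq_id.
- exact: pb_sq_id.
- by rewrite !graft_leaf; exact: pb_sq_id.
- apply: (@act_ext _ _ P (free_graph D)).
    rewrite (comp_l h1) (comp_l (pb1_forest_leaf _ _ _)) -composeA pb1_forest_leaf.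
    by rewrite eta_natural.
  rewrite (comp_l h2) (comp_l (pb2_forest_leaf _ _ _)) -composeA pb2_forest_leaf.
  by rewrite composeA tree_map_leaf -!composeA tree_map_leg.
- apply: (@act_ext _ _ P (free_graph D)).
    rewrite (comp_l h1) (comp_l (pb1_forest_node _ _ _)) -!composeA pb1_forest_node pb1_act_map.
    rewrite (comp_l (eq_sym (mu_natural _ _))) -composeA; congr (_ ∘ _).
    by rewrite !composeA -!fmapM h1.
  rewrite (comp_l h2) (comp_l (pb2_forest_node _ _ _)) -!composeA pb2_forest_node.
  rewrite (comp_l (tree_map_node f)) -composeA; congr (_ ∘ _); apply: act_ext.
    rewrite (comp_l (pb1_act_map _ _)) (comp_l (pb1_act_sub _ _)) -!composeA pb1_act_sub pb1_act_map.
    by rewrite !composeA -!fmapM h2.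
  rewrite (comp_l (pb2_act_map _ _)) (comp_l (pb2_act_sub _ _)) -!composeA pb2_act_sub pb2_act_map.
  by [].
- have -> : h = graph_map_square P (fmap TT f).
    apply: (@act_ext _ _ P (free_graph D)).
      by rewrite h1; symmetry; exact: (pb1_graph_map_square P (fmap TT f)).
    by rewrite h2; symmetry; exact: (pb2_graph_map_square P (fmap TT f)).
  by symmetry; exact: (mm_comp (fmap free_functor f : MulticatMap _ _)).
Qed.

(** The multiplication is the extension of an identity, hence the recursion with data [leaf] and
    [graft]. *)
Lemma free_mu_cartesian (C D : K) (f : C ~> D) :
  is_pullback (mu TT D) (fmap TT f) (fmap TT (fmap TT f)) (mu TT C).
Proof.
pose ct (F : K) : (free_multicat (free_graph F) : MC) ~> free_multicat F :=
  counit free_adjunction (free_multicat F).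
have mu_unit (F : K) : (mm_graph (ct F) : (free_graph (free_graph F) : K) ~> free_graph F)
    ∘ free_unit P hET (free_graph F) = idm (free_graph F : K).
  exact: (unit_counit free_adjunction (free_multicat F)).
have mu0 (F : K) : gm0 (mu TT F) = idm (gr0 F) := proj1 (free_map_leg (g := ct F) (mu_unit F)).
have ml (F : K) : c F ∘ gm1 (mu TT F) = gm0 (idm (free_graph F : K)) ∘ c (free_graph F).
  exact: (proj2 (free_map_leg (g := ct F) (mu_unit F))).
have mn (F : K) : gm1 (mu TT F) ∘ node (free_graph F) =
    graft F ∘ @act_map _ _ P (free_graph F) (free_graph F) (idm _) _ _ _ _ _ (ml F).
  exact: (free_map_node (g := ct F) (ml F) (mu_unit F)).
have mleaf (F : K) : gm1 (mu TT F) ∘ leaf (free_graph F) = leaf F.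
  have := mm_ids (counit free_adjunction (free_multicat F)); rewrite /= => ->.
  by rewrite -[RHS]compose_m1; congr (_ ∘ _); exact: mu0.
have nat : mu TT D ∘ fmap TT (fmap TT f) = fmap TT f ∘ mu TT C := mu_natural TT f.
apply: (graph_pullback hET).
  by rewrite !mu0 !free_gm0; exact: pb_sq_id.
have Tf_leg : c D ∘ tree_map f = gm0 (fmap TT f : (free_graph C : K) ~> free_graph D) ∘ c C.
  exact: (gm_c (fmap TT f)).
apply: (@tree_square E T P hET (free_graph C) (free_graph D) (free_graph C) (free_graph D)
  (fmap TT f) (fmap TT f) (idm _) (idm _) _ _ _ _ _ _ (gm0 (fmap TT f)) _ _ _ _ _ _ _ _
  (c C) (graft C) (c D) (graft D) _ _ _ _ Tf_leg (ml D) (tree_map_leg (fmap TT f)) (ml C) _ _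
  (graft_leg P hET C) (graft_cartesian Tf_leg) _ (mn D) (mn C)
  (tree_map_leaf (fmap TT f)) (tree_map_node (fmap TT f)) _ (ft_tree _) (ft_tree _)).
- exact: pb_sq_id.
- exact: pb_sq_id.
- rewrite (mleaf D) (mleaf C) free_gm0; apply: pb_sq_sym; exact: (leaf_cartesian f).
- exact: (f_equal (@gm1 _ _ _ _) nat).
Qed.

(** ** Colimits of nested sequences *)

Section FreeColimit.
Context (G : Functor omega K) (L : K) (i : forall n, G n ~> L).
Hypotheses (nG : nested G) (ci : is_colimit i).

Let nTG : nested (functor_comp TT G).
Proof. by move=> m n u; apply: (preserves_monic free_preserves_pullbacks); exact: nG. Qed.

Let c0 := proj1 (proj1 (graph_colim hET P i nG) ci).
Let c1 := proj2 (proj1 (graph_colim hET P i nG) ci).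

Let tree_step n : A (G n) ~> A (G (S n)) := tree_map (fmap G (step n)).

Definition tree_legs : NatTrans (functor_comp (edges T) (functor_comp TT G))
    (functor_comp (vertices T) G).
Proof.
exists (fun n => c (G n)).
abstract (by move=> m n u; exact: (tree_map_leg (fmap G u))).
Defined.

(** The colimit [Q] of the objects of trees inherits their decompositions into leaves and nodes, and
    it maps to the trees on [L] as a sum of maps on these parts. The corresponding squares are
    therefore pullbacks, and [tree_pullback] makes [Q] an object of trees on [L]. *)
Lemma free_colim_edges :
  is_colimit (D := functor_comp (edges T) (functor_comp TT G)) (fun n => tree_map (i n)).
Proof.
have [n0 n1] := nested_graph hET P nG; have [_ nS] := nested_graph hET P nTG.
have [Q [j cj]] := suitable_nested sE nS.
have jS n : j (S n) ∘ tree_step n = j n := proj1 cj _ _ (step n).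
have iS n : i (S n) ∘ fmap G (step n) = i n := proj1 ci _ _ (step n).
have iS0 n : gm0 (i (S n)) ∘ gm0 (fmap G (step n)) = gm0 (i n).
  exact: (f_equal (@gm0 _ _ _ _) (iS n)).
have [h hj] : exists h : Q ~> A L, forall n, h ∘ j n = tree_map (i n).
  apply: (colim_lift cj) => n.
  by have := f_equal (fun k => gm1 (fmap TT k)) (iS n); rewrite fmapM.
pose q := c L ∘ h.
have qj n : q ∘ j n = gm0 (i n) ∘ c (G n) by rewrite -composeA hj tree_map_leg.
have cact : is_colimit (D := act_seq P tree_legs) (fun n => act_map P (qj n)).
  exact: (act_colimit (qn := tree_legs) P hET qj nS n0 n1 cj c0 c1).
have act_stepE n (e : c (G (S n)) ∘ tree_step n = gm0 (fmap G (step n)) ∘ c (G n)) :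
    fmap (act_seq P tree_legs) (step n) = act_map P e.
  by apply: act_ext; rewrite ?(pb1_act_seq P tree_legs) ?(pb2_act_seq P tree_legs)
    ?pb1_act_map ?pb2_act_map.
have [e eP] : exists e : gr0 L ~> Q, forall n, e ∘ gm0 (i n) = j n ∘ leaf (G n).
  apply: (colim_lift c0) => n.
  by rewrite -composeA -(jS n) -!composeA tree_map_leaf.
have [s sP] : exists s : act L q ~> Q, forall n, s ∘ act_map P (qj n) = j n ∘ node (G n).
  apply: (colim_lift cact) => n.
  by rewrite (act_stepE _ (tree_map_leg _)) -(jS n) -!composeA tree_map_node.
have he : h ∘ e = leaf L ∘ idm (gr0 L).
  apply: (colim_ext c0) => n.
  by rewrite compose_m1 -composeA eP composeA hj tree_map_leaf.
have hs : h ∘ s = node L ∘ act_sub (eq_refl q).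
  apply: (colim_ext cact) => n.
  rewrite -!composeA sP (comp_l (hj n)) tree_map_node; congr (_ ∘ _); apply: act_ext.
    by rewrite (comp_l (pb1_act_sub _ _)) -composeA !pb1_act_map composeA -fmapM hj.
  by rewrite (comp_l (pb2_act_sub _ _)) !pb2_act_map.
have es : is_cop e s.
  apply: cop_intro => [Z u v|Z k l eu ev]; last first.
    apply: (colim_ext cj) => n; apply: (cop_ext (tree_cop hET (ft_tree _))).
      by rewrite -!composeA -eP !composeA eu.
    by rewrite -!composeA -sP !composeA ev.
  have ex n : {k : A (G n) ~> Z | k ∘ leaf (G n) = u ∘ gm0 (i n) /\
      k ∘ node (G n) = v ∘ act_map P (qj n)}.
    apply: constructive_indefinite_description.
    exact: (cop_lift (tree_cop hET (ft_tree _)) _ _).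
  have [k kj] : exists k : Q ~> Z, forall n, k ∘ j n = proj1_sig (ex n).
    apply: (colim_lift cj) => n.
    have [l1 m1] := proj2_sig (ex n); have [l2 m2] := proj2_sig (ex (S n)).
    apply: (cop_ext (tree_cop hET (ft_tree _))); rewrite -composeA.
      rewrite (tree_map_leaf (fmap G (step n))) composeA l1.
      by rewrite l2 -composeA iS0.
    rewrite (tree_map_node (fmap G (step n))) composeA m1 m2 -composeA -act_stepE.
    by rewrite (proj1 cact).
  exists k; split.
    apply: (colim_ext c0) => n; rewrite -composeA eP composeA kj.
    by case: (proj2_sig (ex n)).
  apply: (colim_ext cact) => n; rewrite -composeA sP composeA kj.
  by case: (proj2_sig (ex n)).
have tQ : is_tree (idm (gr0 L)) e s.
{ apply: (tree_pullback hET (f := idm L) (h := h) (eh := over_idm (eq_refl q)) _ _ _ _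
    (ft_tree (free_tree P hET L))).
  - by rewrite /q -composeA he compose_m1 leaf_leg.
  - by rewrite /q -composeA hs composeA node_leg -composeA pb2_act_sub.
  - exact: (cop_cartesian_l sE P es (tree_cop hET (ft_tree _)) he hs).
  - exact: (cop_cartesian_r sE P es (tree_cop hET (ft_tree _)) he hs). }
apply: (colim_iso cj _ hj); apply: (tree_iso hET (ek := eq_refl q) (ft_tree _) tQ) => //.
by rewrite he compose_m1.
Qed.

Lemma free_colim : is_colimit (D := functor_comp TT G) (fun n => fmap TT (i n)).
Proof.
apply: (proj2 (graph_colim hET P _ nTG)); split; last exact: free_colim_edges.
apply: colim_intro => [n|Z q eq|Z h k e].
- rewrite !free_gm0 /= free_gm0; exact: (proj1 c0 _ _ (step n)).
- have [h hP] : exists h : gr0 L ~> Z, forall n, h ∘ gm0 (i n) = q n.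
    by apply: (colim_lift c0) => n; rewrite -(eq n) /= free_gm0.
  by exists h => n; rewrite free_gm0 hP.
- by apply: (colim_ext c0) => n; have := e n; rewrite free_gm0.
Qed.

End FreeColimit.

Lemma free_monad_suitable : suitable TT.
Proof.
split; first exact: graph_suitable hET P.
split; last by move=> G L i nG ci; exact: free_colim.
split; [exact: free_preserves_pullbacks|exact: free_eta_cartesian|exact: free_mu_cartesian].
Qed.

End FreeMonad.

Theorem theorem3p3p1 (E : Category) (T : Monad E) (P : PullbackChoice E)
    (hET : suitable T) :
  exists (F : Functor (graph_cat T) (multicat_cat T P))
         (adj : Adjunction F (forgetful T P)),
    monadic adj /\ suitable (adj_monad adj).
Proof.
exists (free_functor P hET), (free_adjunction P hET).
by split; [exact: multicat_monadic|exact: free_monad_suitable].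
Qed.
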